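(* Let $\sigma=(\sigma_t)_{t\ge 0}$ be the interchange process on the $2$-dimensional Hamming graph $H(2,n)$, let $V_t(k)$ denote the set of vertices lying in cycles of $\sigma_t$ of length at least $k$, and let $t=t(n)=\beta n^2$ with $\beta>0$ fixed. (Subcritical phase.) If $\beta<1/2$, then there exists a constant $C>0$ such that $$\lim_{n\to\infty}\mathbb P\big(|V_t(C\log n)|=0\big)=1.$$ (Supercritical phase.) If $\beta>1/2$, then for any $\varepsilon>0$ there exists a constant $C>0$ such that $$\lim_{n\to\infty}\mathbb P\big(|V_t(n^{2-\varepsilon})|\ge Cn^2\big)=1.$$
   Context: The Hamming graph $H(2,n)=(V,E)$ ($n\ge 2$) has vertex set $V=\{0,\dots,n-1\}^2$, with an edge between any two distinct vertices lying on the same row or on the same column (i.e. differing in exactly one coordinate). Thus $|V|=n^2$ and $|E|=n^2(n-1)$. The interchange process $(\sigma_t)_{t\ge0}$ on $H(2,n)$ is the continuous-time Markov process of permutations of $V$ with $\sigma_0=\mathrm{id}$ in which, at total rate $1$, an edge $e=\{v,w\}\in E$ is chosen uniformly at random and the current permutation is composed with the transposition $(v\,w)$ (the particles at the two ends of $e$ are swapped). For $v\in V$, $\mathrm{orb}_t(v)=\{\sigma_t^{\ell}(v):\ell=0,1,2,\dots\}$ is the cycle of $\sigma_t$ containing $v$, where $\sigma_t^\ell$ is the $\ell$-fold composition. For real $k>0$, $V_t(k)=\{v\in V: |\mathrm{orb}_t(v)|\ge k\}$. The constants $C$ do not depend on $n$ (they may depend on $\beta$, and in the supercritical case also on $\varepsilon$).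 *)

(* Defs.v *)
From mathcomp Require Import all_boot all_order all_fingroup all_algebra.
From mathcomp Require Import all_classical all_reals all_analysis.

Set Implicit Arguments.
Unset Strict Implicit.
Unset Printing Implicit Defensive.

Import Order.TTheory GRing.Theory Num.Theory.
Import numFieldNormedType.Exports.

Local Open Scope classical_set_scope.
Local Open Scope ring_scope.

Definition hamming_vertex (n : nat) : finType := ('I_n * 'I_n)%type.

(* Exactly one of the two coordinates differs. *)
Definition hamming_adj (n : nat) : rel (hamming_vertex n) :=
  fun u v => (u.1 == v.1) (+) (u.2 == v.2).

Definition hamming_edges (n : nat) : {set {set hamming_vertex n}} :=
  [set E | [exists u, exists v, hamming_adj u v && (E == [set u; v]%SET)]]%SET.

(* The transposition exchanging the two ends of an edge, seen as a two-element
   set; see edge_swapE. *)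
Definition edge_swap (V : finType) (E : {set V}) : {perm V} :=
  if enum E is [:: u; v] then tperm u v else 1%g.

Lemma edge_swapE (V : finType) (u v : V) :
  u != v -> edge_swap [set u; v]%SET = tperm u v.
Proof.
move=> uv; rewrite /edge_swap.
have : perm_eq (enum [set u; v]%SET) [:: u; v].
  apply: uniq_perm; first exact: enum_uniq.
    by rewrite /= inE uv.
  by move=> x; rewrite mem_enum !inE.
case: (enum _) => [|a [|b [|c s]]] p; have /= := perm_size p => // _.
have := perm_mem p; have := perm_uniq p; rewrite /= !inE uv /= !andbT => ab h.
have := h a; have := h b; rewrite !inE !eqxx orbT /= => /esym hb /esym ha.
case/orP: ha => /eqP ?; case/orP: hb => /eqP ?; subst => //.
- by rewrite eqxx in ab.
- exact: tpermC.
- by rewrite eqxx in ab.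
Qed.

(* The library has no independence of random variables.  For discrete random
   variables the product rules on cylinder events used below characterize
   it, and measurability amounts to measurability of the level sets. *)
Record poisson_process (R : realType) (d : measure_display)
    (T : measurableType d) (P : probability T R) (rate : R)
    (N : R -> T -> nat) : Prop := {
  poisson_meas : forall (t : R) k, 0 <= t -> measurable [set w | N t w = k];
  poisson_init : forall w, N 0 w = 0%N;
  poisson_mono : forall (s t : R) w, 0 <= s -> s <= t -> (N s w <= N t w)%N;
  poisson_rcont : forall (t : R) w, 0 <= t -> \forall u \near t^'+, N u w = N t w;
  (* s < t is strict because poisson_pmf 0 k is not the Dirac mass at 0 *)
  poisson_law : forall (s t : R) k, 0 <= s -> s < t ->
    P [set w | (N t w - N s w)%N = k] = (poisson_pmf (rate * (t - s)) k)%:E;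
  poisson_indep : forall (m : nat) (t : nat -> R) (k : nat -> nat),
    0 <= t 0%N -> (forall i, t i <= t i.+1) ->
    P [set w | forall i, (i < m)%N -> (N (t i.+1) w - N (t i) w)%N = k i] =
    (\prod_(i < m) P [set w | (N (t i.+1) w - N (t i) w)%N = k i])%E
}.

(* The sequence e is i.i.d. uniform on the finite set A, and independent of
   the process N indexed by nonnegative times. *)
Record iid_uniform_indep (R : realType) (d : measure_display)
    (T : measurableType d) (P : probability T R) (X : finType) (A : {set X})
    (e : nat -> T -> X) (N : R -> T -> nat) : Prop := {
  iid_meas : forall i a, measurable [set w | e i w = a];
  iid_supp : forall i w, e i w \in A;
  iid_law : forall i a, a \in A -> P [set w | e i w = a] = (#|A|%:R^-1)%:E;
  iid_indep : forall (m l : nat) (t : nat -> R) (k : nat -> nat) (a : nat -> X),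
    (forall j, 0 <= t j) ->
    P ([set w | forall j, (j < m)%N -> N (t j) w = k j] `&`
       [set w | forall i, (i < l)%N -> e i w = a i]) =
    (P [set w | forall j, (j < m)%N -> N (t j) w = k j] *
     \prod_(i < l) P [set w | e i w = a i])%E
}.

(* Edges are picked at the jump times of a rate 1 Poisson process.  In
   {perm V} the product s * s' applies s first, so multiplying on the right by
   a transposition swaps the particles located at the two ends of the edge. *)
Definition interchange_process (R : realType) (d : measure_display)
    (T : measurableType d) (P : probability T R) (n : nat)
    (sigma : R -> T -> {perm hamming_vertex n}) : Prop :=
  exists (N : R -> T -> nat) (e : nat -> T -> {set hamming_vertex n}),
    [/\ poisson_process P 1 N,
        iid_uniform_indep P (hamming_edges n) e N &
        forall (t : R) w, 0 <= t ->
          sigma t w = (\prod_(i < N t w) edge_swap (e i w))%g].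

Definition long_cycles (R : realType) (V : finType) (s : {perm V}) (k : R) :
    {set V} :=
  [set v | k <= #|porbit s v|%:R]%SET.

(* Main.v *)
Require Import Defs.
From mathcomp Require Import all_boot all_order all_fingroup all_algebra.
From mathcomp Require Import reals sequences exp.
From mathcomp Require Import ring lra zify.
Import Order.TTheory GRing.Theory Num.Theory.
Set Implicit Arguments.
Unset Strict Implicit.
Unset Printing Implicit Defensive.

(** Conditionally on the number [M] of jumps before time [t], the permutation is a product of
    [M] independent uniform transpositions.  The orbit of a vertex [v] is followed by the
    cyclic walk, which reads the [M] transpositions periodically; given its past, the
    transposition in a slot it has not crossed yet is uniform on an explicit set of edges.
    If [2M < n^2], the number of newly visited vertices is dominated by a subcritical
    exploration, so that a long orbit is exponentially unlikely.  If [2M > n^2], an exponential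
    supermartingale shows that the walk goes on with positive probability without closing for
    the first [W] periods, where [W] is a small power of [n]; by the Efron-Stein inequality
    the number of vertices in orbits longer than [W] is concentrated.  Once it has run for [W]
    periods, the walk is spread out: up to a negligible probability it recently crossed
    two perpendicular edges, each used once, and resampling both shows that any given position
    has probability at most a small power of [n] over [n^2].  Hence the orbits which are longer
    than [W] hardly ever close before [n^(2 - eps)] periods. *)

(** * The Hamming graph *)

Section Graph.
Variable n : nat.
Local Open Scope nat_scope.
Local Open Scope set_scope.
Local Notation V := (hamming_vertex n).
Local Notation E := (hamming_edges n).
Local Notation adj := (@hamming_adj n).
Local Notation tr f := (edge_swap (f : {set V})).
Implicit Types (x y z : V) (f g : {set V}) (d : bool).

(** Each vertex is to be pictured as a circle of [M] phases, and each transposition as a bar joining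
    two circles at one phase. As long as no fresh bar leads back to a discovered vertex (a
    collision), the discovered circles form a tree and each of them is covered by a single growing
    arc; all the counting rests on this. The obstacle is the precision required: closings must be
    excluded over nearly [n^2] periods, so a position may only have probability close to [n^-2]. An
    erased bar, summed over its slot, contributes about [M / #|E|], of order [1 / n]. Hence the need
    for two bars, and for perpendicular ones: their common vertex is the corner of a rectangle and
    can be recovered from the two far ends. A single collision in a window also has probability of
    order [1 / n], up to powers of the window length, and cannot be neglected. Only two collisions
    can, so windows have a long and a short part, one of which behaves like a tree. Criticality
    enters through the mean number [2 * M / n^2] of bars at a circle. *)

Definition coord (d : bool) (x : V) : 'I_n := if d then x.1 else x.2.
Definition line (d : bool) (c : 'I_n) : {set V} := [set y | coord d y == c].

Lemma adj_sym x y : adj x y = adj y x.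
Proof. by rewrite /hamming_adj eq_sym (eq_sym x.2). Qed.

Lemma adj_neq x y : adj x y -> x != y.
Proof. by apply: contraTN => /eqP->; rewrite /hamming_adj !eqxx. Qed.

Lemma vertex_eq d x y : coord d x = coord d y -> coord (~~ d) x = coord (~~ d) y -> x = y.
Proof. by case: x y d => [a b] [c e] [] /= -> ->. Qed.

Lemma adj_coordN d x y : adj x y -> (coord (~~ d) x == coord (~~ d) y) = ~~ (coord d x == coord d y).
Proof. by rewrite /hamming_adj; case: d => /=; do 2!case: eqP. Qed.

Lemma adj_coord d x y : adj x y = (x != y) && ((coord d x == coord d y) || (coord (~~ d) x == coord (~~ d) y)).
Proof.
case: x y d => [a b] [c e]; rewrite /hamming_adj /coord /= -(inj_eq (@inj_id (_ * _)%type)) xpair_eqE.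
by case=> /=; case: (a == c); case: (b == e).
Qed.

Lemma edgeP f : reflect (exists x y, adj x y /\ f = [set x; y]) (f \in E).
Proof.
rewrite inE; apply: (iffP existsP) => [[x /existsP[y /andP[xy /eqP ->]]]|[x [y [xy ->]]]].
  by exists x, y.
by exists x; apply/existsP; exists y; rewrite xy eqxx.
Qed.

Opaque hamming_edges.

Lemma swap_pair x y : adj x y -> tr [set x; y] = tperm x y.
Proof. by move/adj_neq/edge_swapE. Qed.

Lemma pair_edge x y : adj x y -> [set x; y] \in E.
Proof. by move=> xy; apply/edgeP; exists x, y. Qed.

Lemma swap_pairL x y : adj x y -> tr [set x; y] x = y.
Proof. by move/swap_pair->; rewrite tpermL. Qed.

Lemma swap_out f x : f \in E -> x \notin f -> tr f x = x.
Proof.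
case/edgeP=> u [v [uv ->]]; rewrite !inE negb_or => /andP[xu xv].
by rewrite swap_pair // tpermD // eq_sym.
Qed.

Lemma swap_in f x : f \in E -> x \in f -> adj x (tr f x) /\ f = [set x; tr f x].
Proof.
case/edgeP=> u [v [uv ->]]; rewrite !inE swap_pair // => /orP[] /eqP ->.
  by rewrite tpermL.
by rewrite tpermR adj_sym setUC.
Qed.

Lemma swap_mem f x : f \in E -> x \in f -> tr f x \in f.
Proof.
case/edgeP=> u [v [uv ->]]; rewrite swap_pair // => /set2P[]->.
  by rewrite tpermL set22.
by rewrite tpermR set21.
Qed.

Lemma swap_neq f x : f \in E -> (tr f x != x) = (x \in f).
Proof.
move=> fE; apply/idP/idP => [|xf]; first by apply: contraR => /(swap_out fE) ->.
by rewrite eq_sym adj_neq //; case: (swap_in fE xf).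
Qed.

Lemma swap_inj f g x : f \in E -> g \in E -> tr f x = tr g x -> tr f x != x -> f = g.
Proof.
move=> fE gE e ne; have xf : x \in f by rewrite -swap_neq.
have xg : x \in g by rewrite -swap_neq // -e.
by rewrite (proj2 (swap_in fE xf)) (proj2 (swap_in gE xg)) e.
Qed.

Lemma swapK f : f \in E -> involutive (tr f).
Proof. by case/edgeP=> u [v [uv ->]] x; rewrite swap_pair // tpermK. Qed.

Lemma card_line d (c : 'I_n) : #|line d c| = n.
Proof.
case: d.
  have -> : line true c = setX [set c] [set: 'I_n].
    by apply/setP=> -[a b]; rewrite !inE /= andbT.
  by rewrite cardsX cards1 mul1n cardsT card_ord.
have -> : line false c = setX [set: 'I_n] [set c].
  by apply/setP=> -[a b]; rewrite !inE /=.
by rewrite cardsX cards1 muln1 cardsT card_ord.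
Qed.

Definition nbrs d x : {set V} := [set y in line d (coord d x) | y != x].

Lemma nbrs_adj d x y : (y \in nbrs d x) = adj x y && (coord d x == coord d y).
Proof.
rewrite !inE (adj_coord d) eq_sym (eq_sym y) andbC.
by case: (x == y) => //=; case: (coord d x == coord d y); rewrite ?andbT ?andbF.
Qed.

Lemma card_nbrs d x : #|nbrs d x| = n.-1.
Proof.
have -> : nbrs d x = line d (coord d x) :\ x by apply/setP=> y; rewrite !inE andbC.
have := cardsD1 x (line d (coord d x)); rewrite card_line inE eqxx add1n => e.
by move/(congr1 predn): e.
Qed.

Lemma adj_nbrs d x : [set y | adj x y] = nbrs d x :|: nbrs (~~ d) x.
Proof.
apply/setP=> y; rewrite inE in_setU !nbrs_adj -andb_orr.
by rewrite (adj_coord d); case: (x != y); rewrite //= andbb.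
Qed.

Lemma nbrs_disj d x : nbrs d x :&: nbrs (~~ d) x = set0.
Proof.
apply/setP=> y; rewrite in_setI !nbrs_adj inE; apply/negbTE.
by apply/negP=> /andP[/andP[xy e]]; rewrite xy (adj_coordN _ xy) e.
Qed.

Lemma card_adj x : #|[set y | adj x y]| = n.-1.*2.
Proof.
rewrite (adj_nbrs true) cardsU nbrs_disj cards0 subn0 !card_nbrs.
by rewrite addnn.
Qed.

Lemma card_edges_at x : #|[set f in E | x \in f]| = n.-1.*2.
Proof.
rewrite -(card_adj x) -(@card_in_imset _ _ (fun y => [set x; y])) ?inE; last first.
  move=> y z; rewrite !inE => xy xz e.
  have := swap_pairL xy; rewrite e swap_pairL // => ->//.
apply/esym; congr #|pred_of_set _|; apply/setP=> f; rewrite [RHS]in_set.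
apply/imsetP/andP => [[y]|[fE xf]].
  by rewrite in_set => xy ->; rewrite pair_edge // !inE eqxx.
have [a b] := swap_in fE xf.
by exists (tr f x); rewrite ?inE.
Qed.

Lemma card_edge f : f \in E -> #|f| = 2.
Proof. by case/edgeP=> u [v [uv ->]]; rewrite cards2 adj_neq. Qed.

Lemma card_edges : #|E| = n * n * n.-1.
Proof.
apply/eqP; rewrite -(eqn_pmul2r (isT : 0 < 2)); apply/eqP.
have -> : #|E| * 2 = \sum_(f in E) #|f|.
  by rewrite -sum_nat_const; apply: eq_bigr => f /card_edge.
have -> : \sum_(f in E) #|f| = \sum_(f in E) \sum_(x : V) (x \in f).
  by apply: eq_bigr => f _; rewrite -sum1_card big_mkcond /=; apply: eq_bigr => x _; case: (x \in f).
rewrite exchange_big /=.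
have -> : \sum_(x : V) \sum_(f in E) (x \in f) = \sum_(x : V) n.-1.*2.
  apply: eq_bigr => x _; rewrite -(card_edges_at x) -sum1_card [RHS]big_mkcond /= [LHS]big_mkcond /=.
  by apply: eq_bigr => f _; rewrite !inE; case: ifP => //= _; case: (x \in f).
by rewrite sum_nat_const card_prod !card_ord -muln2 mulnA.
Qed.

Lemma card_edges_avoid (U : {set V}) :
  #|E| <= #|[set f in E | [disjoint f & U]]| + n.-1.*2 * #|U|.
Proof.
rewrite -(cardsID [set f : {set V} | [disjoint f & U]] E) leq_add //.
  by rewrite subset_leq_card //; apply/subsetP=> f; rewrite !inE.
apply: leq_trans (_ : #|\bigcup_(x in U) [set f in E | x \in f]| <= _).
  apply: subset_leq_card; apply/subsetP=> f; rewrite inE => /andP[]; rewrite inE.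
  rewrite -setI_eq0 => /set0Pn[x]; rewrite inE => /andP[xf xU] fE.
  by apply/bigcupP; exists x => //; rewrite inE fE.
rewrite mulnC -sum_nat_const.
apply: (big_ind2 (fun (A : {set {set V}}) k => #|A| <= k)).
- by rewrite cards0.
- move=> A k B l Ak Bl; apply: leq_trans (leq_card_setU _ _) _.
  exact: leq_add.
- by move=> x _; rewrite card_edges_at.
Qed.

End Graph.

(** * The cyclic walk and its conditional laws *)

Section Walk.
Variables (R : realType) (n M : nat) (M_gt0 : (0 < M)%N).
Local Open Scope ring_scope.
Local Open Scope set_scope.
Local Notation V := (hamming_vertex n).
Local Notation E := (hamming_edges n).
Local Notation adj := (@hamming_adj n).
Local Notation tr f := (edge_swap (f : {set V})).
Local Notation env := {ffun 'I_M -> {set V}}.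
Implicit Types (x : nat -> V) (e : env) (s t : nat).

Definition slot (s : nat) : 'I_M := Ordinal (ltn_pmod s M_gt0).

Definition envs : {set env} := [set e : env | [forall i, e i \in E]].

(** The state of the walk is the pair of its position and its phase [s] modulo [M]; at multiples of
    [M] it follows the iterates of the permutation. *)
Fixpoint walk (v : V) (e : env) (s : nat) : V :=
  if s is s'.+1 then tr (e (slot s')) (walk v e s') else v.

Definition set_slot (e : env) (j : 'I_M) (f : {set V}) : env :=
  [ffun i => if i == j then f else e i].

(** The edges which, placed in slot [j], leave the first [t] steps of the path unchanged. A passage
    through the slot without crossing is information too: it excludes the edges at that position. *)
Definition compat (x : nat -> V) (j : 'I_M) (t : nat) : {set {set V}} :=
  [set f in E | [forall s : 'I_t, (slot s == j) ==> (tr f (x s) == x s.+1)]].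

Lemma envsP e : reflect (forall i, e i \in E) (e \in envs).
Proof. by rewrite [X in reflect _ X]in_set; apply: forallP. Qed.

Lemma compatP x j t f :
  reflect (f \in E /\ forall s, (s < t)%N -> slot s = j -> tr f (x s) = x s.+1)
          (f \in compat x j t).
Proof.
rewrite [X in reflect _ X]in_set; apply: (iffP andP) => -[fE h]; split=> //.
  move=> s st sj; have /forallP/(_ (Ordinal st))/implyP/= := h.
  by rewrite sj eqxx => /(_ isT)/eqP.
by apply/forallP=> s; apply/implyP=> /eqP sj; apply/eqP/h.
Qed.

Lemma compat_ext x x' j t : (forall s, (s <= t)%N -> x s = x' s) ->
  compat x j t = compat x' j t.
Proof.
move=> h; apply/setP=> f; apply/compatP/compatP => -[fE H]; split=> // s st sj.
  by rewrite -!h // 1?ltnW // H.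
by rewrite !h // 1?ltnW // H.
Qed.

Lemma walk_set_slot v e j f t s : f \in compat (walk v e) j t -> (s <= t)%N ->
  walk v (set_slot e j f) s = walk v e s.
Proof.
case/compatP=> fE H; elim: s => //= s IH st; rewrite IH 1?ltnW // ffunE.
by case: eqP => // sj; rewrite H.
Qed.

Lemma set_slot_envs e j f : e \in envs -> f \in E -> set_slot e j f \in envs.
Proof. by move=> /envsP eE fE; apply/envsP=> i; rewrite ffunE; case: eqP. Qed.

Lemma walk_compat v e j t : e \in envs -> e j \in compat (walk v e) j t.
Proof. by move=> /envsP eE; apply/compatP; split=> // s _ <-. Qed.

Lemma card_compat_gt0 v e j t : e \in envs -> (0 < #|compat (walk v e) j t|)%N.
Proof. by move=> eE; apply/card_gt0P; exists (e j); apply: walk_compat. Qed.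

Lemma set_slotK e j f : set_slot (set_slot e j f) j (e j) = e.
Proof. by apply/ffunP=> i; rewrite !ffunE; case: eqP => // ->. Qed.

Lemma set_slotE e j f : set_slot e j f j = f.
Proof. by rewrite ffunE eqxx. Qed.

(* Given the first t steps, slot j is uniform on the compatible edges. *)
Lemma resample v j t (F : env -> R) :
  \sum_(e in envs) F e =
  \sum_(e in envs) (#|compat (walk v e) j t|%:R^-1 *
                    \sum_(f in compat (walk v e) j t) F (set_slot e j f)).
Proof.
pose c e := #|compat (walk v e) j t|%:R^-1 : R.
pose P (p : env * {set V}) := (p.1 \in envs) && (p.2 \in compat (walk v p.1) j t).
(* Exchanging the content of the slot with the sampled edge is an involution of the pairs. It
   preserves the path up to [t], hence the set of compatible edges and the weight [c]. *)
pose h (p : env * {set V}) := (set_slot p.1 j p.2, p.1 j).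
have hK : involutive h by case=> e f; rewrite /h /= set_slotK set_slotE.
have inE_ e f : f \in compat (walk v e) j t -> f \in E by case/compatP.
have compE e f : f \in compat (walk v e) j t ->
    compat (walk v (set_slot e j f)) j t = compat (walk v e) j t.
  by move=> fA; apply: compat_ext => s st; rewrite (walk_set_slot fA).
have hP p : P p -> P (h p).
  case: p => e f /andP[/= eE fA]; rewrite /P /= set_slot_envs ?(inE_ _ _ fA) //=.
  by rewrite compE // walk_compat.
transitivity (\sum_(p | P p) (c p.1 * F (h p).1)); last first.
  rewrite -(pair_big_dep (mem envs) (fun e f => f \in compat (walk v e) j t)
    (fun e f => c e * F (set_slot e j f))) /=.
  by apply: eq_bigr => e eE; rewrite -mulr_sumr.
rewrite (reindex_inj (inv_inj hK)) /=.
transitivity (\sum_(p | P p) (c p.1 * F p.1)).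
  rewrite -(pair_big_dep (mem envs) (fun e f => f \in compat (walk v e) j t)
    (fun e f => c e * F e)) /=.
  apply: eq_bigr => e eE; rewrite sumr_const -mulr_natl mulrA /c mulfV ?mul1r //.
  by rewrite pnatr_eq0 -lt0n card_compat_gt0.
apply: eq_big => [p|[e f] /andP[/= eE fA]].
  by apply/idP/idP => [/hP//|/hP]; rewrite hK.
by rewrite set_slotK /c compE.
Qed.

Definition adapted (T : Type) (t : nat) (F : (nat -> V) -> T) :=
  forall x x', (forall s, (s <= t)%N -> x s = x' s) -> F x = F x'.

Definition extend (x : nat -> V) (t : nat) (y : V) : nat -> V :=
  fun s => if (s <= t)%N then x s else y.

Lemma extendE x t y : extend x t y t.+1 = y.
Proof. by rewrite /extend ltnn. Qed.

Lemma extend_le x t y s : (s <= t)%N -> extend x t y s = x s.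
Proof. by rewrite /extend => ->. Qed.

Lemma adaptedW (T : Type) t t' (F : (nat -> V) -> T) :
  (t <= t')%N -> adapted t F -> adapted t' F.
Proof. by move=> tt' aF x x' h; apply: aF => s st; apply: h; apply: leq_trans tt'. Qed.

Definition moves (x : nat -> V) (t : nat) : {set {set V}} := compat x (slot t) t.

Lemma one_step v t (F : (nat -> V) -> R) : adapted t.+1 F ->
  \sum_(e in envs) F (walk v e) =
  \sum_(e in envs) (#|moves (walk v e) t|%:R^-1 *
     \sum_(f in moves (walk v e) t) F (extend (walk v e) t (tr f (walk v e t)))).
Proof.
move=> aF; rewrite (resample v (slot t) t); apply: eq_bigr => e eE; congr (_ * _).
apply: eq_bigr => f fA; apply: aF => s; rewrite leq_eqVlt => /orP[/eqP->|st].
  by rewrite extendE /= (walk_set_slot fA) // set_slotE.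
by rewrite extend_le // (walk_set_slot fA).
Qed.

Lemma one_step_le v t (F G : (nat -> V) -> R) : adapted t.+1 F ->
  (forall e, e \in envs -> let x := walk v e in
     \sum_(f in moves x t) F (extend x t (tr f (x t))) <= #|moves x t|%:R * G x) ->
  \sum_(e in envs) F (walk v e) <= \sum_(e in envs) G (walk v e).
Proof.
move=> aF h; rewrite (one_step _ aF); apply: ler_sum => e eE.
by rewrite ler_pdivrMl; [exact: h | rewrite ltr0n; exact: card_compat_gt0].
Qed.

End Walk.

(** * Phases: how the walk explores the circle of a vertex *)

Section Arcs.
Variables (n M : nat) (M_gt0 : (0 < M)%N).
Local Open Scope nat_scope.
Local Open Scope set_scope.
Local Notation V := (hamming_vertex n).
Local Notation E := (hamming_edges n).
Local Notation env := {ffun 'I_M -> {set V}}.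
Implicit Types (x : nat -> V) (e : env) (s t r : nat) (y : V).

Definition crossed x s := x s.+1 != x s.
(** A slot crossed before has its edge revealed, so the next step is deterministic. A slot passed
    without moving is not known: its edge is merely constrained. *)
Definition known x t := [exists s : 'I_t, (s == t %[mod M]) && crossed x s].
Definition earlier x t : {set V} := [set x s | s : 'I_t & s == t %[mod M]].
(** No pair of position and phase repeats before [t]. For a walk the motion of pairs is reversible,
    so the first pair to repeat would be the initial one: the orbit has not closed. *)
Definition noret x t :=
  [forall s : 'I_t, forall r : 'I_t, (r < s) && (r == s %[mod M]) ==> (x r != x s)].
Definition fresh x s := crossed x s && ~~ known x s.
Definition visits x t y := \sum_(s < t) (x s == y).
Definition first x t := [forall s : 'I_t, x s != x t].

Lemma knownP x t :
  reflect (exists s, [/\ s < t, s = t %[mod M] & crossed x s]) (known x t).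
Proof.
apply: (iffP existsP) => [[s /andP[/eqP st cs]]|[s [st e cs]]].
  by exists s; split.
by exists (Ordinal st); rewrite /= e eqxx.
Qed.

Lemma noretP x t :
  reflect (forall r s, r < s -> s < t -> r = s %[mod M] -> x r != x s) (noret x t).
Proof.
apply: (iffP forallP) => [h r s rs st e|h s].
  have /forallP/(_ (Ordinal (ltn_trans rs st)))/implyP/= := h (Ordinal st).
  by rewrite rs e eqxx => /(_ isT).
by apply/forallP=> r; apply/implyP=> /andP[rs /eqP e]; apply: h.
Qed.

Lemma noretW x t t' : t <= t' -> noret x t' -> noret x t.
Proof.
move=> tt' /noretP h; apply/noretP=> r s rs st; apply: h => //.
exact: leq_trans tt'.
Qed.

Lemma noret_neq x t r s : noret x t -> r < t -> s < t -> r <> s -> r = s %[mod M] ->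
  x r != x s.
Proof.
move=> /noretP h rt st; case: (ltngtP r s) => // rs _ e; first exact: h.
by rewrite eq_sym; apply: h.
Qed.

Lemma firstP x t : reflect (forall s, s < t -> x s != x t) (first x t).
Proof.
apply: (iffP forallP) => [h s st|h s]; first exact: h (Ordinal st).
exact: h.
Qed.

Lemma visits0 x y : visits x 0 y = 0.
Proof. by rewrite /visits big_ord0. Qed.

Lemma visitsS x t y : visits x t.+1 y = visits x t y + (x t == y).
Proof. by rewrite /visits big_ord_recr. Qed.

Lemma leq_visits x y t t' : t <= t' -> visits x t y <= visits x t' y.
Proof.
move=> /subnK <-; elim: (t' - t) => // k IH.
by rewrite addSn visitsS; apply: leq_trans IH (leq_addr _ _).
Qed.

Lemma visits_idle x y t t' : t <= t' -> (forall s, t <= s -> s < t' -> x s != y) ->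
  visits x t' y = visits x t y.
Proof.
move=> /subnK <-; elim: (t' - t) => // k IH h.
rewrite addSn visitsS IH ?(negbTE (h _ _ _)) ?addn0 ?leq_addl //.
  by move=> s ts sk; apply: h => //; rewrite addSn ltnS ltnW.

Qed.

Lemma visits_first x t : first x t -> visits x t (x t) = 0.
Proof.
move=> /firstP h; rewrite -(visits0 x (x t)); apply: visits_idle => // s _; exact: h.
Qed.

Lemma modnSm (a b : nat) : a.+1 = b.+1 %[mod M] <-> a = b %[mod M].
Proof.
split=> e; last by rewrite -addn1 -(addn1 b) -modnDml e modnDml.
apply/eqP; rewrite -(eqn_modDr 1) !addn1; exact/eqP.
Qed.

Lemma visits_le x t y : noret x t -> visits x t y <= M.
Proof.
move=> /noretP h.
have -> : visits x t y = #|[set s : 'I_t | x s == y]|.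
  rewrite /visits -sum1_card [RHS]big_mkcond /=; apply: eq_bigr => s _.
  by rewrite inE; case: eqP.
rewrite -[X in _ <= X]card_ord -(@card_in_imset _ _ (fun s : 'I_t => slot M_gt0 s)).
  exact: max_card.
move=> s r; rewrite !inE => /eqP xs /eqP xr /(congr1 val)/= e.
apply/val_inj => /=; case: (ltngtP s r) => // sr.
  by have := h _ _ sr (ltn_ord r) e; rewrite xs xr eqxx.
by have := h _ _ sr (ltn_ord s) (esym e); rewrite xs xr eqxx.
Qed.

Section Traj.
Variables (v : V) (e : env) (e_in : e \in envs n M).
Let x := walk M_gt0 v e.

Lemma walk_swap s : exists2 f, f \in E &
  forall r, r = s %[mod M] -> x r.+1 = edge_swap f (x r).
Proof.
exists (e (slot M_gt0 s)); first by move/envsP: e_in.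
by move=> r rs; rewrite /x /=; congr (edge_swap (e _) _); apply: val_inj.
Qed.

(** A slot holds a single edge, so two crossings from different ends run in opposite directions. *)
Lemma cross_back s r : s = r %[mod M] -> crossed x s -> crossed x r -> x s != x r ->
  x r = x s.+1 /\ x r.+1 = x s.
Proof.
case: (walk_swap r) => f fE h sr; rewrite /crossed (h s sr) (h r erefl) => cs cr ne.
have [_ fs] := @swap_in _ f (x s) fE ltac:(by rewrite -swap_neq).
have xr : x r = edge_swap f (x s).
  rewrite swap_neq // fs in cr; case/set2P: cr => // e1.
  by rewrite e1 eqxx in ne.
by rewrite xr swapK.
Qed.

Lemma crossed_adj s : crossed x s -> hamming_adj (x s) (x s.+1).
Proof.
case: (walk_swap s) => f fE h; rewrite /crossed (h s erefl) swap_neq // => xf.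
by case: (swap_in fE xf).
Qed.

(* Between the times theta and t1 the walk discovers some new vertices; up to
   time t it never jumps on one of them through a new bar, except to discover it. *)
Variables (theta t1 t : nat).
Hypothesis x_noret : noret x t.
Hypothesis no_collision : forall s r, s < t -> fresh x s -> theta <= r -> r <= t1 ->
  first x r -> x r = x s.+1 -> r = s.+1.

(** The phases spent at a discovered vertex form one contiguous arc starting at the phase of
    discovery. Without collisions a re-entry uses a known edge, namely the one by which the vertex
    was last left, so the walk comes back at the phase where it left and the arc goes on. *)
Lemma arc s r : theta <= r -> r <= t1 -> first x r -> s <= t -> x s = x r ->
  s = r + visits x s (x r) %[mod M].
Proof.
move=> tr rt1 fr; elim/ltn_ind: s => s IH st xs.
have rs : r <= s by rewrite leqNgt; apply/negP=> /(firstP _ _ fr); rewrite xs eqxx.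
move: rs; rewrite leq_eqVlt => /orP[/eqP <-|]; first by rewrite visits_first ?addn0.
case: s IH st xs => // u IH ut xu; rewrite ltnS => ru.
have [xu'|nxu] := eqVneq (x u) (x r).
  rewrite visitsS xu' eqxx addn1 addnS; apply/modnSm; apply: IH => //; exact: ltnW.
have cu : crossed x u by rewrite /crossed xu eq_sym.
have /knownP[q [qu eq_ cq]] : known x u.
  apply: contraT => nk.
  have : fresh x u by rewrite /fresh cu nk.
  by move=> /(no_collision ut)/(_ tr rt1 fr (esym xu)) e1; rewrite e1 ltnn in ru.
have nqu : x q != x u by apply: (noret_neq x_noret); rewrite // 1?(ltn_trans qu) //; move: qu => /[swap] ->; rewrite ltnn.
have [xu1 xu2] := cross_back eq_ cq cu nqu; rewrite xu in xu2.
(* The vertex is not visited between the exit [q] and the re-entry [u.+1]: an earlier re-entry at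
   [p.+1] would by induction have [p] in phase with [q], so it would cross the same edge, and [p]
   would repeat the position and phase of [u]. *)
have idle : forall p, q < p -> p <= u -> x p != x r.
  elim/ltn_ind=> p IHp qp pu; apply/negP=> /eqP xp.
  case: p IHp qp pu xp => // p IHp; rewrite ltnS leq_eqVlt => /orP[/eqP<-|qp] pu xp.
    by move: nxu; rewrite xu1 xp eqxx.
  have nxp : x p != x r by apply: IHp => //; exact: ltnW.
  have cp : crossed x p by rewrite /crossed xp eq_sym.
  have vp : visits x p.+1 (x r) = (visits x q (x r)).+1.
    rewrite visitsS (negbTE nxp) addn0 (@visits_idle _ _ q.+1) // ?visitsS -?xu2 ?eqxx ?addn1 //.
    by move=> s qs sp; apply: IHp => //; [exact: ltnW | exact: leq_trans (ltnW sp) (ltnW pu)].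
  have e1 : p.+1 = r + visits x p.+1 (x r) %[mod M].
    by apply: IH => //; exact: ltn_trans pu ut.
  have e2 : q = r + visits x q (x r) %[mod M].
    by apply: IH => //; rewrite ?ltnS ltnW // (ltn_trans qu).
  have pq : q = p %[mod M].
    by apply/modnSm; rewrite e1 vp addnS; apply/modnSm.
  have nqp : x q != x p by rewrite -xu2 eq_sym.
  have [xp1 _] := cross_back pq cq cp nqp.
  have : x p != x u.
    apply: (noret_neq x_noret) => //; last by rewrite -pq.
      exact: leq_ltn_trans (ltnW pu) ut.
    by move: pu => /[swap] ->; rewrite ltnn.
  by rewrite xp1 -xu1 eqxx.
rewrite (@visits_idle _ _ q.+1); first 1 last.
- by rewrite ltnS ltnW.
- by move=> s qs; rewrite ltnS; exact: idle.
rewrite visitsS -xu2 eqxx addn1 addnS; apply/modnSm; rewrite -eq_.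
by apply: IH => //; rewrite ?ltnS ltnW // (ltn_trans qu).
Qed.

Lemma modn_visits0 c : c <= M -> 0 < c -> c = 0 %[mod M] -> c = M.
Proof.
rewrite leq_eqVlt => /orP[/eqP->//|cM] c0; rewrite mod0n modn_small // => e0.
by rewrite e0 in c0.
Qed.

(** A second crossing of the discovery edge leaves the vertex at the phase just before that of its
    discovery; by [arc] the whole circle has then been explored. *)
Lemma landing_once r s : theta <= r.+1 -> r.+1 <= t1 -> first x r.+1 -> r < t ->
  visits x t (x r.+1) < M -> s < t -> s = r %[mod M] -> s <> r -> ~~ crossed x s.
Proof.
move=> tr rt1 fr rt vM st sr nsr; apply/negP=> cs.
have cr : crossed x r by rewrite /crossed eq_sym (firstP _ _ fr).
have nrs : x r != x s by apply: (noret_neq x_noret) => //; exact: nesym.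
have [xs _] := cross_back (esym sr) cr cs nrs.
have a := arc tr rt1 fr (ltnW st) xs.
have v1 : visits x s.+1 (x r.+1) = (visits x s (x r.+1)).+1.
  by rewrite visitsS xs eqxx addn1.
have : (visits x s (x r.+1)).+1 = M.
  apply: modn_visits0 => //.
    by rewrite -v1 visits_le // (noretW st).
  apply/eqP; rewrite -(eqn_modDl r.+1) addn0 addnS; apply/eqP.
  by rewrite -(proj2 (modnSm _ _) a); apply/modnSm.
by rewrite -v1 => e1; have := leq_visits x (x r.+1) st; rewrite e1 leqNgt vM.
Qed.

(** Under [noret] an edge is crossed at most once in each direction, so a known edge by which the
    vertex is left was first crossed into it. Without collisions that crossing was the discovery,
    and [arc] places the departure at the last phase of the circle. *)
Lemma leave_known s r : theta <= r.+1 -> r.+1 <= t1 -> first x r.+1 ->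
  x s = x r.+1 -> s < t -> known x s -> crossed x s -> (visits x s (x r.+1)).+1 = M.
Proof.
move=> tr rt1 fr xs st /knownP[q [qs e_ cq]] cs.
have nqs : x q != x s.
  by apply: (noret_neq x_noret) => //; [exact: ltn_trans st|move=> e1; rewrite e1 ltnn in qs].
have [xs1 _] := cross_back e_ cq cs nqs.
have rq : q = r.
  have [//|nrq] := eqVneq q r.
  have kq : known x q.
    apply: contraT => nk; case/eqP: nrq; apply/succn_inj/esym.
    by apply: (no_collision (s := q)); rewrite -?xs1 // ?(ltn_trans qs) // /fresh cq nk.
  have [p [pq ep cp]] := knownP _ _ kq.
  have npq : x p != x q.
    apply: (noret_neq x_noret) => //; last by move=> e1; rewrite e1 ltnn in pq.
      by rewrite (ltn_trans pq) // (ltn_trans qs).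
    exact: ltn_trans qs st.
  have [_ xq1] := cross_back ep cp cq npq.
  suff : x p != x s by rewrite -xq1 xs1 eqxx.
  apply: (noret_neq x_noret) => //; [|by move=> e1; have := ltn_trans pq qs; rewrite e1 ltnn|by rewrite ep].
  by rewrite (ltn_trans pq) // (ltn_trans qs).
have a := arc tr rt1 fr (ltnW st) xs.
have v1 : visits x s.+1 (x r.+1) = (visits x s (x r.+1)).+1.
  by rewrite visitsS xs eqxx addn1.
apply: modn_visits0 => //; first by rewrite -v1 visits_le // (noretW st).
apply/eqP; rewrite -(eqn_modDl r.+1) addn0 addnS; apply/eqP.
by rewrite -(proj2 (modnSm _ _) a); apply/modnSm; rewrite -e_ rq.
Qed.

(** A return to [x p] would resume its arc at the phase of [r], hence come back through the edge
    that discovered [x r.+1], which [landing_once] forbids. *)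
Lemma no_return p r q : theta <= p -> p <= t1 -> first x p -> x r = x p ->
  theta <= r.+1 -> r.+1 <= t1 -> first x r.+1 -> visits x t (x r.+1) < M ->
  r < q -> q <= t -> x q != x p.
Proof.
move=> tp pt1 fp xr tr rt1 fr vM; elim/ltn_ind: q => q IH rq qt; apply/negP=> /eqP xq.
case: q IH rq qt xq => // q IH; rewrite ltnS leq_eqVlt => /orP[/eqP<-|rq] qt xq.
  by have := firstP _ _ fr r (ltnSn r); rewrite xr xq eqxx.
have nq : x q != x p by apply: IH => //; exact: ltnW.
have cq : crossed x q by rewrite /crossed xq eq_sym.
have idle s : r.+1 <= s -> s < q.+1 -> x s != x p.
  by move=> rs sq; apply: IH => //; apply: ltnW; exact: leq_trans sq qt.
have a := arc tp pt1 fp qt xq.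
have b : r = p + visits x r (x p) %[mod M].
  by apply: arc => //; apply: ltnW; apply: leq_trans qt; rewrite ltnS ltnW.
have vq : visits x q.+1 (x p) = (visits x r (x p)).+1.
  by rewrite (visits_idle _ idle) ?visitsS ?xr ?eqxx ?addn1 // ltnS ltnW.
have qr : q = r %[mod M].
  by apply/modnSm; rewrite a vq addnS; apply/modnSm.
have rt : r < t by apply: leq_trans qt; rewrite ltnS ltnW.
have nqr : q <> r by move=> e1; rewrite e1 ltnn in rq.
by have := landing_once tr rt1 fr rt vM qt qr nqr; rewrite cq.
Qed.

(** By [no_return] the parent is not visited after [r]. If it were complete, [r] would be at its
    last phase, and the crossing at [r] would lead back through the parent's own discovery edge to
    an old vertex instead of a new one. *)
Lemma parent_incomplete p r : theta <= p.+1 -> p.+1 <= t1 -> first x p.+1 ->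
  x r = x p.+1 -> theta <= r.+1 -> r.+1 <= t1 -> first x r.+1 -> r < t ->
  visits x t (x r.+1) < M -> visits x t (x p.+1) < M.
Proof.
move=> tp pt1 fp xr tr rt1 fr rt vM.
have pr : p.+1 <= r.
  by rewrite leqNgt; apply/negP=> /(firstP _ _ fp); rewrite xr eqxx.
have idle s : r.+1 <= s -> s < t -> x s != x p.+1.
  by move=> rs st; apply: (no_return tp pt1 fp xr tr rt1 fr vM rs); exact: ltnW.
rewrite (visits_idle _ idle) // ltnNge; apply/negP=> Mv.
have e1 : visits x r.+1 (x p.+1) = M.
  by apply/eqP; rewrite eqn_leq Mv andbT visits_le // (noretW rt).
have e2 : (visits x r (x p.+1)).+1 = M by rewrite -e1 visitsS xr eqxx addn1.
have a := arc tp pt1 fp (ltnW rt) xr.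
have e3 : p = r %[mod M].
  by have := proj2 (modnSm _ _) a; rewrite -addnS e2 modnDr => /modnSm.
have cp : crossed x p by rewrite /crossed eq_sym (firstP _ _ fp).
have cr : crossed x r by rewrite /crossed eq_sym (firstP _ _ fr).
have npr : x p != x r by rewrite xr (firstP _ _ fp).
have [_ e4] := cross_back e3 cp cr npr.
by have := firstP _ _ fr p (ltnW pr); rewrite e4 eqxx.
Qed.

(** Strong induction on the time of discovery: an incomplete vertex would have an incomplete parent,
    and if the parent is the root, [no_return] contradicts the closing. *)
Lemma closing_complete r : theta = 0 -> 0 < t -> t <= t1 -> x t = x 0 ->
  t = 0 %[mod M] -> r < t -> first x r -> visits x t (x r) = M.
Proof.
move=> t0 tpos tt1 xt0 tM; elim/ltn_ind: r => r IH rt fr.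
have f0 : first x 0 by apply/firstP.
have t0le s : theta <= s by rewrite t0.
case: r IH rt fr => [|r] IH rt fr.
  apply: modn_visits0; first exact: visits_le.
    by apply: leq_trans (leq_visits _ _ tpos); rewrite visitsS eqxx addn1.
  by rewrite -tM -[visits _ _ _]add0n; apply/esym/arc.
apply/eqP; rewrite eqn_leq visits_le //= leqNgt; apply/negP=> vM.
have rt' : r < t by exact: ltnW.
have rt1 : r.+1 <= t1 by apply: leq_trans tt1; exact: ltnW.
have [p [pr fp xp]] : exists p, [/\ p <= r, first x p & x p = x r].
  have ex : exists p, x p == x r by exists r.
  case: (ex_minnP ex) => p /eqP xp pmin; exists p; split=> //; first exact: pmin.
  by apply/firstP=> s sp; apply/negP=> /eqP xs; move: (pmin s); rewrite xs xp eqxx => /(_ isT); rewrite leqNgt sp.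
case: p pr fp xp => [|p] pr fp xp.
  have := no_return (t0le 0) (leq0n _) f0 (esym xp) (t0le _) rt1 fr vM rt' (leqnn t).
  by rewrite xt0 eqxx.
have pt1 : p.+1 <= t1 by apply: leq_trans rt1; exact: ltnW.
have := parent_incomplete (t0le _) pt1 fp (esym xp) (t0le _) rt1 fr rt' vM.
by rewrite IH ?ltnn // ?ltnS // (leq_ltn_trans pr).
Qed.

End Traj.
End Arcs.

(** * One-step laws and exponential moments *)

Section Steps.
Variables (R : realType) (n M : nat) (M_gt0 : (0 < M)%N).
Local Open Scope ring_scope.
Local Open Scope set_scope.
Local Notation V := (hamming_vertex n).
Local Notation E := (hamming_edges n).
Local Notation adj := (@hamming_adj n).
Local Notation env := {ffun 'I_M -> {set V}}.
Local Notation known := (@known n M).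
Local Notation earlier := (@earlier n M).
Local Notation noret := (@noret n M).
Local Notation fresh := (@fresh n M).
Local Notation moves := (@moves n M M_gt0).
Local Notation envs := (envs n M).
Implicit Types (x : nat -> V) (e : env) (s t r : nat) (y : V).

Lemma adapted_known t : adapted t (known^~ t).
Proof.
move=> x x' h; apply: eq_existsb => s; rewrite /crossed !h //.
exact: ltnW.
Qed.

Lemma adapted_noret t : adapted t (noret^~ t.+1).
Proof.
move=> x x' h; apply: eq_forallb => s; apply: eq_forallb => r.
by rewrite !h // -ltnS.
Qed.

Lemma known_extend x t y : known (extend x t y) t = known x t.
Proof. by apply: adapted_known => s st; rewrite extend_le. Qed.

Lemma crossed_extend x t y : crossed (extend x t y) t = (y != x t).
Proof. by rewrite /crossed extendE extend_le. Qed.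

Lemma earlierP x t y :
  reflect (exists s, [/\ (s < t)%N, s = t %[mod M] & y = x s]) (y \in earlier x t).
Proof.
apply: (iffP imsetP) => [[s]|[s [st e ->]]].
  by rewrite inE => /eqP e ->; exists s; split.
by exists (Ordinal st); rewrite // inE /= e.
Qed.

Lemma noret_earlier x t : noret x t.+1 -> x t \notin earlier x t.
Proof.
move=> nr; apply/negP=> /earlierP[s [st e xs]].
have := @noret_neq _ _ _ _ s t nr; rewrite -xs eqxx => H.
suff : false by []; apply: H => //; first exact: ltnW.
by move=> e1; rewrite e1 ltnn in st.
Qed.

Lemma ltn_div_mod s t : (s < t)%N -> s = t %[mod M] -> (s %/ M < t %/ M)%N.
Proof.
move=> st e; rewrite ltnNge; apply/negP=> le; move: st; rewrite ltnNge => /negP; apply.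
by rewrite (divn_eq t M) [X in (_ <= X)%N](divn_eq s M) e leq_add2r leq_mul2r le orbT.
Qed.

Lemma card_earlier x t : (#|earlier x t| <= t %/ M)%N.
Proof.
pose A := [set s : 'I_t | s == t %[mod M]].
apply: leq_trans (leq_imset_card _ _) _.
have divlt (s : 'I_t) : s \in A -> (s %/ M < t %/ M)%N.
  by rewrite inE => /eqP; apply: ltn_div_mod.
have [t0|t0] := posnP (t %/ M).
  rewrite t0 leqn0 cards_eq0; apply/eqP/setP=> s; rewrite [RHS]inE.
  by apply/negbTE/negP=> /divlt; rewrite t0.
rewrite -[X in (_ <= X)%N]card_ord -(prednK t0).
rewrite -(@card_in_imset _ _ (fun s : 'I_t => inord (s %/ M) : 'I_((t %/ M).-1.+1))).
  exact: max_card.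
move=> s r sA rA /(congr1 val) /=; rewrite !inordK ?prednK ?divlt // => e.
move: sA rA; rewrite !inE => /eqP se /eqP re.
by apply/val_inj => /=; rewrite [LHS](divn_eq _ M) [RHS](divn_eq _ M) e se re.
Qed.

Variable v : V.
Section Env.
Variables (e : env) (e_in : e \in envs).
Let x := walk M_gt0 v e.

Lemma moves_known t f : known x t -> f \in moves x t -> edge_swap f (x t) = x t.+1.
Proof.
case/knownP=> s [st es cs] /compatP[fE H].
have ss : slot M_gt0 s = slot M_gt0 t by apply: val_inj.
have eE : e (slot M_gt0 t) \in E by move/envsP: e_in.
rewrite [RHS]/=; congr (edge_swap _ _).
have ts := H s st ss; apply: (swap_inj fE eE (x := x s)); rewrite ts //.
by rewrite [LHS]/= -ss.
Qed.

Definition targets t : {set V} := [set y | adj (x t) y & y \notin earlier x t].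

(** An unknown slot was passed at each of its earlier positions without moving. Its edge avoids all
    of them, and this is the only constraint. *)
Lemma moves_unknown t : ~~ known x t -> moves x t = [set f in E | [disjoint f & earlier x t]].
Proof.
move=> nk; apply/setP=> f; rewrite [RHS]inE; apply/compatP/andP=> -[fE h]; split=> //.
  rewrite disjoint_subset; apply/subsetP=> y yf; rewrite inE; apply/negP=> /earlierP[s [st es ys]].
  have ss : slot M_gt0 s = slot M_gt0 t by apply: val_inj.
  have : crossed x s by rewrite /crossed -(h s st ss) swap_neq // -ys.
  by move=> cs; case/negP: nk; apply/knownP; exists s.
move=> s st ss; have es : s = t %[mod M] by move/(congr1 val): ss.
have -> : x s.+1 = x s.
  by apply/eqP; apply: contraNT nk => cs; apply/knownP; exists s.
apply: swap_out => //; apply/negP=> xf; move/disjoint_setI0/setP/(_ (x s)): h.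
by rewrite inE xf inE /= => /earlierP; apply; exists s.
Qed.

Lemma card_moves t : ~~ known x t -> (#|E| <= #|moves x t| + n.-1.*2 * (t %/ M))%N.
Proof.
move=> nk; rewrite moves_unknown //; apply: leq_trans (card_edges_avoid (earlier x t)) _.
by rewrite leq_add2l leq_mul2l card_earlier orbT.
Qed.

(** Each target is reached through exactly one compatible edge, and all the other compatible edges
    leave the walk in place. By [noret] the current position is not an earlier one, so edges at this
    position are allowed at all. *)
Lemma sum_moves_unknown t (h : V -> R) : ~~ known x t -> noret x t.+1 ->
  \sum_(f in moves x t) h (edge_swap f (x t)) =
  (#|moves x t|%:R - #|targets t|%:R) * h (x t) + \sum_(y in targets t) h y.
Proof.
move=> nk nr; have xnU := noret_earlier nr.
have mE f : f \in moves x t -> f \in E by case/compatP.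
have im : [set f in moves x t | x t \in f] = [set [set x t; y] | y in targets t].
  apply/setP=> f; rewrite [LHS]inE moves_unknown // [X in X && _]inE.
  apply/andP/imsetP => [[/andP[fE dis] xf]|[y]].
    have [axy fxy] := swap_in fE xf; exists (edge_swap f (x t)) => //.
    rewrite inE axy /=; apply/negP=> yU; move/disjoint_setI0/setP/(_ (edge_swap f (x t))): dis.
    have yf : edge_swap f (x t) \in f by exact: swap_mem.
    by rewrite inE yf yU inE.
  rewrite inE => /andP[axy yU] ->; rewrite pair_edge // !inE eqxx; split=> //=.
  rewrite disjoint_subset; apply/subsetP=> z; rewrite !inE => /orP[]/eqP-> //.
have inj : {in targets t &, injective (fun y => [set x t; y])}.
  move=> y z; rewrite !inE => /andP[ay _] /andP[az _] eq_.
  by rewrite -(swap_pairL ay) -(swap_pairL az) eq_.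
rewrite (bigID (fun f : {set V} => x t \in f)) /= addrC; congr (_ + _); last first.
  transitivity (\sum_(f in [set [set x t; y] | y in targets t]) h (edge_swap f (x t))).
    by rewrite -im; apply: eq_bigl => f; rewrite [RHS]in_set.
  rewrite big_imset //=; apply: eq_bigr => y; rewrite inE => /andP[ay _].
  by rewrite swap_pairL.
rewrite -(card_in_imset inj) -im.
transitivity (\sum_(f in moves x t :\: [set f in moves x t | x t \in f]) h (x t)).
  apply: eq_big => [f|f /andP[/mE fE xf]]; last by rewrite swap_out.
  rewrite [RHS]in_setD [X in _ = ~~ X && _]in_set.
  by case: (f \in moves x t); rewrite ?andbT ?andbF.
have sub : [set f in moves x t | x t \in f] \subset moves x t.
  by apply/subsetP=> f /setIdP[].
by rewrite sumr_const cardsD (setIidPr sub) -[LHS]mulr_natl natrB // subset_leq_card.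
Qed.

Lemma sum_marks t (mark : (nat -> V) -> bool) (B : {set V}) :
  (forall y, mark (extend x t y) ->
     [/\ fresh (extend x t y) t, noret x t.+1, adj (x t) y & y \in B]) ->
  \sum_(f in moves x t) (mark (extend x t (edge_swap f (x t))))%:R
    <= #|[set y in B | adj (x t) y]|%:R :> R.
Proof.
move=> h.
have [kn|nk] := boolP (known x t).
  rewrite big1 // => f _; case: (boolP (mark _)) => // /h[].
  by rewrite /fresh known_extend kn andbF.
have [nr|nr] := boolP (noret x t.+1); last first.
  by rewrite big1 // => f _; case: (boolP (mark _)) => // /h[_ nr' _ _]; rewrite nr' in nr.
rewrite (sum_moves_unknown (fun y => (mark (extend x t y))%:R)) //.
case: (boolP (mark (extend x t (x t)))) => [/h[]|_].
  by rewrite /fresh crossed_extend eqxx.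
rewrite mulr0 add0r -natr_sum ler_nat -sum1_card.
rewrite [X in (X <= _)%N]big_mkcond [X in (_ <= X)%N]big_mkcond /=.
apply: leq_sum => y _; case: ifP => // _.
by case: (boolP (mark _)) => // /h[_ _ ay yB]; rewrite inE yB ay.
Qed.

End Env.

Definition nmarks (mark : nat -> (nat -> V) -> bool) t0 t x := (\sum_(t0 <= s < t) mark s x)%N.

Lemma adapted_nmarks (mark : nat -> (nat -> V) -> bool) t0 t : (forall s, adapted s.+1 (mark s)) ->
  adapted t (nmarks mark t0 t).
Proof.
move=> am x x' h; apply: eq_big_nat => s /andP[_ st]; rewrite (am s x x') // => r rs.
by apply: h; apply: leq_trans rs st.
Qed.

(** Each step multiplies the exponential moment by at most [1 + (z - 1) * r], where [r] bounds the
    conditional probability of a mark. The weight [G], a function of the path up to [t0], stands for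
    conditioning on the past, here and in the later estimates. *)
Lemma chernoff (mark : nat -> (nat -> V) -> bool) t0 t (G : (nat -> V) -> R) (z r : R) : (t0 <= t)%N ->
  (forall s, adapted s.+1 (mark s)) -> adapted t0 G -> (forall x, 0 <= G x) -> 1 <= z ->
  0 <= r ->
  (forall e s, e \in envs -> (t0 <= s)%N -> (s < t)%N -> let x := walk M_gt0 v e in
     \sum_(f in moves x s) (mark s (extend x s (edge_swap f (x s))))%:R
       <= r * #|moves x s|%:R) ->
  \sum_(e in envs) G (walk M_gt0 v e) * z ^+ nmarks mark t0 t (walk M_gt0 v e) <=
  (1 + (z - 1) * r) ^+ (t - t0) * \sum_(e in envs) G (walk M_gt0 v e).
Proof.
move=> t0t am aG G0 z1 r0; elim: t t0t => [|t IH].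
  rewrite leqn0 => /eqP-> h; rewrite expr0 mul1r; apply: ler_sum => e _.
  by rewrite /nmarks big_geq // expr0 mulr1.
rewrite leq_eqVlt => /orP[/eqP-> h|t0t h].
  rewrite subnn expr0 mul1r; apply: ler_sum => e _.
  by rewrite /nmarks big_geq // expr0 mulr1.
have {}IH := IH t0t (fun e s eE t0s st => h e s eE t0s (ltnW st)).
rewrite subSn // exprS -mulrA.
apply: le_trans (_ : (1 + (z - 1) * r) * \sum_(e in envs) G (walk M_gt0 v e) *
   z ^+ nmarks mark t0 t (walk M_gt0 v e) <= _); last first.
  by rewrite ler_wpM2l // addr_ge0 // mulr_ge0 // subr_ge0.
rewrite mulr_sumr.
apply: (@one_step_le _ _ _ M_gt0 v t (fun x => G x * z ^+ nmarks mark t0 t.+1 x)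
  (fun x => (1 + (z - 1) * r) * (G x * z ^+ nmarks mark t0 t x))).
  move=> x x' hx; congr (_ * _ ^+ _); last exact: adapted_nmarks.
  by apply: aG => s st; apply: hx; apply: leq_trans st _; exact: leqW.
move=> e eE; cbv zeta; set x := walk M_gt0 v e.
have -> : \sum_(f in moves x t) G (extend x t (edge_swap f (x t))) *
    z ^+ nmarks mark t0 t.+1 (extend x t (edge_swap f (x t))) =
  G x * z ^+ nmarks mark t0 t x * \sum_(f in moves x t)
    (1 + (z - 1) * (mark t (extend x t (edge_swap f (x t))))%:R).
  rewrite mulr_sumr; apply: eq_bigr => f _.
  have -> : G (extend x t (edge_swap f (x t))) = G x.
    by apply: aG => s st; rewrite extend_le // (leq_trans st).
  rewrite -mulrA; congr (_ * _).
  rewrite /nmarks big_nat_recr //= exprD; congr (_ * _).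
    congr (_ ^+ _); apply: adapted_nmarks => // s st; exact: extend_le.
  by case: (mark t _); rewrite ?expr1 ?expr0 ?mulr1 ?mulr0 ?addr0 // addrC subrK.
have hs := h e t eE t0t (ltnSn t).
rewrite big_split /= sumr_const -mulr_sumr.
set A : R := #|moves x t|%:R; set c := G x * _.
have c0 : 0 <= c by rewrite mulr_ge0 // exprn_ge0 // (le_trans _ z1).
have -> : A * ((1 + (z - 1) * r) * c) = c * (A + (z - 1) * (r * A)) by ring.
by rewrite ler_wpM2l // lerD2l ler_wpM2l // subr_ge0.
Qed.

End Steps.

(** * Straight and bent discoveries *)

Section Labels.
Variables (n M : nat).
Local Open Scope nat_scope.
Local Open Scope set_scope.
Local Notation V := (hamming_vertex n).
Local Notation fresh := (@fresh n M).
Implicit Types (x : nat -> V) (s t r k : nat) (y : V) (d : bool).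

Definition before x t : {set V} := [set x s | s : 'I_t].
Definition discovered x theta t : {set V} := before x t.+1 :\: before x theta.
Definition collides theta s x := fresh x s && (x s.+1 \in discovered x theta s).

Lemma beforeP x t y : reflect (exists2 s, s < t & y = x s) (y \in before x t).
Proof.
apply: (iffP imsetP) => [[s _ ->]|[s st ->]]; first by exists s.
by exists (Ordinal st).
Qed.

Lemma before_mono x s t : s <= t -> before x s \subset before x t.
Proof.
move=> st; apply/subsetP=> y /beforeP[r rs ->]; apply/beforeP; exists r => //.
exact: leq_trans st.
Qed.

Lemma adapted_before t : adapted t ((@before)^~ t.+1).
Proof. by move=> x x' h; apply: eq_in_imset => s _; rewrite h // -ltnS. Qed.

Lemma before_ext x x' t : (forall s, s < t -> x s = x' s) -> before x t = before x' t.
Proof. by move=> h; apply: eq_in_imset => s _; rewrite h. Qed.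

Lemma first_unseen x t : (x t \notin before x t) = first x t.
Proof.
apply/idP/firstP => [h s st|h]; first by apply: contraNneq h => <-; apply/beforeP; exists s.
by apply/beforeP=> -[s /h /eqP]; congruence.
Qed.

Lemma first_touch x t y : y \in before x t -> exists r, [/\ r < t, first x r & x r = y].
Proof.
case/beforeP=> s st ->; have ex : exists p, x p == x s by exists s.
case: (ex_minnP ex) => p /eqP xp pmin; exists p; split=> //.
  by apply: leq_ltn_trans st; apply: pmin.
apply/firstP=> q qp; apply/negP=> /eqP xq; move: (pmin q).
by rewrite xq xp eqxx => /(_ isT); rewrite leqNgt qp.
Qed.

Lemma discoveredP x theta t y :
  reflect (exists r, [/\ theta <= r, r <= t, first x r & x r = y]) (y \in discovered x theta t).
Proof.
apply: (iffP setDP) => [[/first_touch[r [rt fr xr]] nb]|[r [tr rt fr <-]]].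
  exists r; split=> //; rewrite leqNgt; apply: contra nb => rth.
  by apply/beforeP; exists r.
split; first by apply/beforeP; exists r.
by apply/beforeP=> -[s sth /eqP]; rewrite eq_sym (negbTE (firstP _ _ fr s (leq_trans sth tr))).
Qed.

Lemma discovered_mono x theta s t : s <= t -> discovered x theta s \subset discovered x theta t.
Proof. by move=> st; apply: setSD; apply: before_mono. Qed.

(* A newly discovered vertex is labelled by the direction of its discovery, until the
   direction changes; from then on the descendants are bent. *)
Record labelling := Labelling { straight1 : {set V}; straight2 : {set V}; bent : {set V} }.

Definition straight (L : labelling) d := if d then straight1 L else straight2 L.

Arguments straight : simpl never.

Definition relabel (L : labelling) (u y : V) : labelling :=
  let d := coord true u == coord true y in
  if (u \in bent L) || (u \in straight L (~~ d))
  then Labelling (straight1 L) (straight2 L) (y |: bent L)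
  else if d then Labelling (y |: straight1 L) (straight2 L) (bent L)
  else Labelling (straight1 L) (y |: straight2 L) (bent L).

(** Vertices visited before [theta] carry no label, and a discovery made from one of them is
    straight whatever its direction. What is already discovered at [t0] starts as bent: nothing if
    [theta = t0.+1], the starting vertex alone if both are 0. *)
Fixpoint labels x theta t0 k : labelling :=
  if k is k'.+1 then
    let L := labels x theta t0 k' in
    if x (t0 + k) \in before x (t0 + k) then L else relabel L (x (t0 + k')) (x (t0 + k))
  else Labelling set0 set0 (discovered x theta t0).

Lemma labels_ext x x' theta t0 k : theta <= t0.+1 -> (forall s, s <= t0 + k -> x s = x' s) ->
  labels x theta t0 k = labels x' theta t0 k.
Proof.
move=> th; elim: k => [|k IH] h /=.
  have h' s : s < t0.+1 -> x s = x' s by rewrite ltnS => st; apply: h; rewrite addn0.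
  by rewrite /discovered (before_ext h') (before_ext (fun s st => h' s (leq_trans st th))).
rewrite IH => [|s st]; last by apply: h; rewrite addnS ltnW.
rewrite (before_ext (x' := x')) => [|s /ltnW]; last exact: h.
by rewrite !h // addnS.
Qed.

Lemma relabel_bent L u y z :
  (z \in bent (relabel L u y)) = (z \in bent L) || (z == y) &&
    ((u \in bent L) || (u \in straight L (coord true u != coord true y))).
Proof.
rewrite /relabel; case: ifP => _ /=; first by rewrite !inE andbT orbC.
by case: ifP => _ /=; rewrite andbF orbF.
Qed.

Lemma relabel_straight L u y z d :
  (z \in straight (relabel L u y) d) = (z \in straight L d) || [&& z == y,
    d == (coord true u == coord true y), u \notin bent L & u \notin straight L (~~ d)].
Proof.
set dd := coord true u == coord true y; rewrite /relabel -/dd.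
case: ifP => h.
  have -> : [&& z == y, d == dd, u \notin bent L & u \notin straight L (~~ d)] = false.
    apply/negbTE/negP=> /and4P[_ /eqP-> h1 h2].
    by rewrite (negbTE h1) (negbTE h2) in h.
  by rewrite orbF; case: d.
have [h1 h2] : u \notin bent L /\ u \notin straight L (~~ dd).
  by move/negbT: h; rewrite negb_or => /andP.
have -> : [&& z == y, d == dd, u \notin bent L & u \notin straight L (~~ d)] = (z == y) && (d == dd).
  by case: (d =P dd) => [->|_]; rewrite ?h1 ?h2 ?andbT ?andbF.
case: dd {h h2}; case: d; rewrite /straight /= ?inE ?andbT ?andbF ?orbF //; by rewrite orbC.
Qed.

Section Invariants.
Variables (x : nat -> V) (theta t0 : nat).
Hypothesis theta_le : theta <= t0.+1.
Local Notation L := (labels x theta t0).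

Lemma labels_discovered k y : (y \in discovered x theta (t0 + k)) =
  [|| y \in bent (L k), y \in straight (L k) true | y \in straight (L k) false].
Proof.
elim: k => [|k IH] /=; first by rewrite addn0 /= !inE !orbF.
have thk : theta <= t0 + k.+1 by rewrite addnS (leq_trans theta_le) // ltnS leq_addr.
have -> : (y \in discovered x theta (t0 + k.+1)) =
    (y \in discovered x theta (t0 + k)) || (y == x (t0 + k.+1)) && (x (t0 + k.+1) \notin before x (t0 + k.+1)).
  apply/idP/idP => [/discoveredP[r [tr rt fr xr]]|/orP[|/andP[/eqP-> nb]]].
  - move: rt; rewrite leq_eqVlt => /orP[/eqP e|rt].
      by apply/orP; right; rewrite -xr -e eqxx first_unseen.
    by apply/orP; left; apply/discoveredP; exists r; split=> //; rewrite -ltnS -addnS.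
  - by apply/subsetP/discovered_mono; rewrite addnS.
  - by apply/discoveredP; exists (t0 + k.+1); split; rewrite -?first_unseen.
rewrite IH; case: ifP => h /=; first by rewrite andbF orbF.
rewrite andbT relabel_bent !relabel_straight.
set u := x (t0 + k); set z := x (t0 + k.+1).
case: (y == z) => /=; last by rewrite !orbF.
rewrite orbT /=; apply/esym.
case: (coord true u == coord true z) => /=; case: (u \in bent _); case: (u \in _); rewrite ?orbT //=.
Qed.

Lemma labels_bent_mono k y : y \in bent (L k) -> y \in bent (L k.+1).
Proof. by move=> h /=; case: ifP => // _; rewrite relabel_bent h. Qed.

Lemma labels_disjoint k y d : y \in straight (L k) d -> y \notin bent (L k).
Proof.
elim: k => [|k IH] /=; first by case: d; rewrite inE.
case: ifP => // h; rewrite relabel_straight relabel_bent.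
have nd d' : x (t0 + k.+1) \notin straight (L k) d'.
  apply: contraFN h => h; have : x (t0 + k.+1) \in discovered x theta (t0 + k).
    by rewrite labels_discovered; case: d' h => ->; rewrite ?orbT.
  by case/setDP; rewrite addnS.
have nb : x (t0 + k.+1) \notin bent (L k).
  apply: contraFN h => h; have : x (t0 + k.+1) \in discovered x theta (t0 + k).
    by rewrite labels_discovered h.
  by case/setDP; rewrite addnS.
case/orP=> [ys|/and4P[/eqP-> /eqP-> b1 b2]].
  by rewrite negb_or IH //= negb_and; apply/orP; left; apply: contraTneq ys => ->.
by rewrite negb_or nb /= eqxx /= negb_or b1.
Qed.

Lemma straight_first k y d : y \in straight (L k) d ->
  exists r, [/\ t0 <= r, r < t0 + k, first x r.+1, x r.+1 = y &
    (coord true (x r) == coord true y) = d].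
Proof.
elim: k => [|k IH] /=; first by case: d; rewrite inE.
have IH' : y \in straight (L k) d -> exists r, [/\ t0 <= r, r < t0 + k.+1, first x r.+1, x r.+1 = y &
    (coord true (x r) == coord true y) = d].
  by case/IH=> r [a b c e f]; exists r; split=> //; rewrite addnS ltnS ltnW.
case: ifP => // h; rewrite relabel_straight => /orP[//|/and4P[/eqP-> /eqP-> _ _]].
exists (t0 + k); split; rewrite ?leq_addr -?addnS // ?addnS //.
by rewrite -first_unseen -addnS h.
Qed.

Lemma bent_first k y : y \in bent (L k) -> y \notin discovered x theta t0 ->
  exists r, [/\ t0 <= r, r < t0 + k, first x r.+1, x r.+1 = y &
    (x r \in bent (L (r - t0))) \/
    (x r \in straight (L (r - t0)) (coord true (x r) != coord true y))].
Proof.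
elim: k => [|k IH] /=; first by move=> ->.
have IH' : y \in bent (L k) -> y \notin discovered x theta t0 -> exists r,
    [/\ t0 <= r, r < t0 + k.+1, first x r.+1, x r.+1 = y &
    (x r \in bent (L (r - t0))) \/
    (x r \in straight (L (r - t0)) (coord true (x r) != coord true y))].
  by move=> a /(IH a)[r [b c e f g]]; exists r; split=> //; rewrite addnS ltnS ltnW.
case: ifP => // h; rewrite relabel_bent => /orP[//|/andP[/eqP-> h1] _].
exists (t0 + k); split; rewrite ?leq_addr -?addnS // ?addnS //.
  by rewrite -first_unseen -addnS h.
by rewrite addKn -addnS; case/orP: h1; [left|right].
Qed.

End Invariants.
End Labels.

(** * Perpendicular pairs of edges and their first moment *)

Section Bends.
Variables (R : realType) (n M : nat) (M_gt0 : (0 < M)%N).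
Local Open Scope ring_scope.
Local Open Scope set_scope.
Local Notation V := (hamming_vertex n).
Local Notation E := (hamming_edges n).
Local Notation env := {ffun 'I_M -> {set V}}.
Local Notation noret := (@noret n M).
Local Notation known := (@known n M).
Local Notation earlier := (@earlier n M).
Local Notation fresh := (@fresh n M).
Local Notation collides := (@collides n M).
Local Notation compat := (@compat n M M_gt0).
Local Notation slot := (slot M_gt0).
Local Notation walk := (@walk n M M_gt0).
Local Notation envs := (envs n M).
Implicit Types (x : nat -> V) (e : env) (s t r : nat) (y : V).

(** The other passages through the slot do not move, so its edge acts on the path up to [t] at a
    single step and can be erased there. *)
Definition once x t s :=
  crossed x s && [forall r : 'I_t, (r == s %[mod M]) ==> ((r : nat) == s) || ~~ crossed x r].

Lemma onceP x t s : reflect (crossed x s /\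
    forall r, (r < t)%N -> r = s %[mod M] -> r <> s -> ~~ crossed x r) (once x t s).
Proof.
apply: (iffP andP) => -[cs h]; split=> //.
  move=> r rt e ne; have /forallP/(_ (Ordinal rt))/implyP/= := h.
  by rewrite e eqxx => /(_ isT)/orP[/eqP|].
apply/forallP=> r; apply/implyP=> /eqP e; have [->//|ne] := eqVneq (r : nat) s.
by rewrite orFb h //; apply/eqP.
Qed.

Definition level x s := coord true (x s) == coord true (x s.+1).

Definition bend x t s r :=
  [&& (s < r)%N, (r < t)%N, x s.+1 == x r, level x s != level x r, once x t s & once x t r].

Section Traj.
Variables (v : V) (e : env) (e_in : e \in envs).
Let x := walk v e.

(** The ancestors of an incomplete vertex are incomplete by [parent_incomplete]. Climbing from a
    bent one leads to a bent vertex whose parent is straight in the other direction; the discovery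
    edges of these two are perpendicular, and each is crossed once by [landing_once]. *)
Lemma bent_bend t0 k t y : noret x t -> (t0 + k <= t)%N ->
  (forall s r, (s < t)%N -> fresh x s -> (t0 < r)%N -> (r <= t0 + k)%N ->
     first x r -> x r = x s.+1 -> r = s.+1) ->
  y \in bent (labels x t0.+1 t0 k) -> (visits x t y < M)%N ->
  exists s r, [/\ (t0 <= s)%N, (s < t)%N & bend x t s r].
Proof.
move=> nr kt nc.
suff H r : (t0 <= r)%N -> (r < t0 + k)%N -> first x r.+1 -> x r.+1 \in bent (labels x t0.+1 t0 k) ->
    (visits x t (x r.+1) < M)%N -> exists s r, [/\ (t0 <= s)%N, (s < t)%N & bend x t s r].
  move=> yb yM; have nd : y \notin discovered x t0.+1 t0 by rewrite /discovered setDv inE.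
  have [r [a b c d _]] := bent_first yb nd; rewrite -d in yb yM.
  exact: H a b c yb yM.
elim/ltn_ind: r => r IH tr rk fr yb yM.
have nd : x r.+1 \notin discovered x t0.+1 t0 by rewrite /discovered setDv inE.
have [q [tq qk fq xq hq]] := bent_first yb nd.
have eq_ : q = r.
  apply/eqP; rewrite -eqSS eqn_leq; apply/andP; split; rewrite leqNgt; apply/negP.
    by move=> /(firstP _ _ fq); rewrite xq eqxx.
  by move=> /(firstP _ _ fr); rewrite xq eqxx.
rewrite eq_ in hq; have rt : (r < t)%N by apply: leq_trans kt.
have par p : (t0 <= p)%N -> first x p.+1 -> x p.+1 = x r -> (p < r)%N -> (visits x t (x p.+1) < M)%N.
  move=> tp fp xp pr; apply: (parent_incomplete e_in nr nc _ _ fp (esym xp) _ _ fr) => //.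
  by apply: leq_trans rk; exact: ltnW.
case: hq => [ub|us].
  have : x r \in discovered x t0.+1 (t0 + (r - t0)).
    by rewrite labels_discovered // ub.
  rewrite subnKC // => /discoveredP[p [tp pr fp xp]].
  case: p tp pr fp xp => // p; rewrite ltnS => tp pr fp xp.
  apply: (IH p pr tp (ltn_trans pr rk) fp); last exact: par.
  rewrite xp; have -> : k = ((k - (r - t0)) + (r - t0))%N.
    by rewrite subnK // leq_subLR ltnW.
  by elim: (k - (r - t0))%N => // m; rewrite addSn; apply: labels_bent_mono.
have [p [tp]] := straight_first us; rewrite subnKC // => pr fp xp dir.
exists p, r; split=> //; first exact: ltn_trans rt.
have pM := par p tp fp xp pr.
have cr : crossed x r by rewrite /crossed eq_sym (firstP _ _ fr).
have cp : crossed x p by rewrite /crossed eq_sym (firstP _ _ fp).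
rewrite /bend pr rt xp eqxx /=; apply/and3P; split.
- by rewrite /level xp dir; case: (coord true (x r) == _).
- apply/onceP; split=> // s st sp nsp; apply: (landing_once e_in nr nc _ _ fp _ pM st sp nsp) => //.
    by apply: leq_trans (ltnW rk).
  exact: ltn_trans rt.
- by apply/onceP; split=> // s st sp nsp; apply: (landing_once e_in nr nc _ _ fr rt yM st sp nsp).
Qed.

Lemma card_compat s t : (t <= s)%N -> (forall r, (r < t)%N -> r = s %[mod M] -> ~~ crossed x r) ->
  (#|E| <= #|compat x (slot s) t| + n.-1.*2 * (s %/ M))%N.
Proof.
move=> ts h; apply: leq_trans (card_edges_avoid (earlier x s)) _; apply: leq_add; last first.
  by rewrite leq_mul2l card_earlier // orbT.
apply: subset_leq_card; apply/subsetP=> f /setIdP[fE dis]; apply/compatP; split=> // r rt rs.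
have es : r = s %[mod M] by move/(congr1 val): rs.
have /eqP -> : x r.+1 == x r by have := h r rt es; rewrite negbK.
apply: swap_out => //; apply/negP=> xf; move/disjoint_setI0/setP/(_ (x r)): dis.
rewrite [LHS]in_setI xf [RHS]in_set0 /= => /earlierP; apply; exists r; split=> //.
exact: leq_trans ts.
Qed.

End Traj.

(** The two differing slots act only at [s] and [r], so the paths agree up to [s], followed forwards
    from [v], and after [r], followed backwards from the common endpoint. The vertex in between
    shares one coordinate with [x s] and the other with [x r.+1], and [b] says which. *)
Lemma bend_inj v e e' t s r b : e \in envs -> e' \in envs ->
  (forall i, i != slot s -> i != slot r -> e i = e' i) ->
  bend (walk v e) t s r -> bend (walk v e') t s r ->
  level (walk v e) s = b -> level (walk v e') s = b ->
  walk v e t = walk v e' t -> e = e'.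
Proof.
move=> eE eE' h /and5P[sr rt /eqP ec lev /andP[o1 o2]] /and5P[_ _ /eqP ec' lev' /andP[o1' o2']] lb lb' et.
have [cs os] := onceP _ _ _ o1; have [cs' os'] := onceP _ _ _ o1'.
have [cr or] := onceP _ _ _ o2; have [cr' or'] := onceP _ _ _ o2'.
set x := walk v e in ec lev lb et cs os cr or *; set x' := walk v e' in ec' lev' lb' et cs' os' cr' or' *.
have idle q : (q < t)%N -> q <> s -> q <> r ->
    (x q.+1 = edge_swap (e (slot q)) (x q)) /\ (x' q.+1 = edge_swap (e (slot q)) (x' q)) \/
    x q.+1 = x q /\ x' q.+1 = x' q.
  move=> qt qs qr; have [es|ns] := eqVneq (slot q) (slot s).
    have {}es : q = s %[mod M] by move/(congr1 val): es.
    right; have := os q qt es qs; have := os' q qt es qs.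
    by rewrite /crossed !negbK => /eqP-> /eqP->.
  have [es|nr] := eqVneq (slot q) (slot r).
    have {}es : q = r %[mod M] by move/(congr1 val): es.
    right; have := or q qt es qr; have := or' q qt es qr.
    by rewrite /crossed !negbK => /eqP-> /eqP->.
  by left; rewrite [in X in _ /\ X]h.
have fwd q : (q <= s)%N -> x q = x' q.
  elim: q => // q IH qs; have xq := IH (ltnW qs).
  have qt : (q < t)%N by exact: ltn_trans (ltn_trans qs sr) rt.
  have qns : q <> s by move=> e1; rewrite e1 ltnn in qs.
  have qnr : q <> r by move=> e1; have := ltn_trans qs sr; rewrite e1 ltnn.
  by case: (idle q qt qns qnr) => -[-> ->]; rewrite xq.
have bwd q : (r < q)%N -> (q <= t)%N -> x q = x' q.
  move=> rq qt; have -> : q = (t - (t - q))%N by rewrite subKn.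
  have : (t - q < t - r)%N by rewrite ltn_sub2l // (leq_trans rq).
  elim: (t - q)%N => [|m IH] mt; first by rewrite subn0.
  have {}IH := IH (ltnW mt).
  have mt' : (m < t)%N by apply: leq_trans (ltnW mt) (leq_subr _ _).
  have e1 : (t - m = (t - m.+1).+1)%N by rewrite -subSn // subSS.
  rewrite e1 in IH.
  have lt : (r < t - m.+1)%N by rewrite ltn_subRL addnC -ltn_subRL.
  have mt1 : (t - m.+1 < t)%N by rewrite -e1 leq_subr.
  have qns : (t - m.+1)%N <> s by move=> e2; have := ltn_trans sr lt; rewrite e2 ltnn.
  have qnr : (t - m.+1)%N <> r by move=> e2; rewrite e2 ltnn in lt.
  case: (idle _ mt1 qns qnr) => -[ex ex'].
  - move: IH; rewrite ex ex'; have fE : e (slot (t - m.+1)) \in E by move/envsP: eE.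
    by move/(congr1 (edge_swap (e (slot (t - m.+1))))); rewrite !swapK.
  - by move: IH; rewrite ex ex'.
have xs : x s = x' s by apply: fwd.
have xr1 : x r.+1 = x' r.+1 by apply: bwd.
have as_ := crossed_adj eE cs; have as' := crossed_adj eE' cs'.
have ar := crossed_adj eE cr; have ar' := crossed_adj eE' cr'.
have mid : x s.+1 = x' s.+1.
  rewrite -/x -/x' in as_ as' ar ar'.
  have lr : level x r = ~~ b by move: lev; rewrite lb; case: (b); case: (level x r).
  have lr' : level x' r = ~~ b by move: lev'; rewrite lb'; case: (b); case: (level x' r).
  have c1 d z w : hamming_adj z w -> (coord true z == coord true w) = d -> coord d z = coord d w.
    by move=> zw; case: d => /eqP // /eqP; rewrite -(adj_coordN true zw) => /eqP.
  apply: (@vertex_eq _ b).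
    by rewrite -(c1 _ _ _ _ as_ lb) -(c1 _ _ _ _ as' lb') xs.
  by rewrite ec ec' (c1 _ _ _ _ ar lr) (c1 _ _ _ _ ar' lr') xr1.
have es : e (slot s) = e' (slot s).
  apply: (swap_inj (x := x s)); [by move/envsP: eE|by move/envsP: eE'| |exact: cs].
  by rewrite -[LHS]/(x s.+1) mid xs.
have er : e (slot r) = e' (slot r).
  apply: (swap_inj (x := x r)); [by move/envsP: eE|by move/envsP: eE'| |exact: cr].
  by rewrite -[LHS]/(x r.+1) xr1 -ec mid ec'.
apply/ffunP=> i; have [->//|ns] := eqVneq i (slot s).
by have [->//|nr] := eqVneq i (slot r); apply: h.
Qed.

(* First moment: once the two bars of a bend are erased, there is one way to put
   them back. *)
Lemma bend_sum v t0 t s r b z (G : (nat -> V) -> R) (a : R) : (t0 <= s)%N -> adapted t0 G ->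
  (forall x, 0 <= G x) -> 0 < a -> a <= #|E|%:R - (n.-1.*2 * (t %/ M))%:R ->
  \sum_(e in envs) G (walk v e) *
     [&& bend (walk v e) t s r, level (walk v e) s == b & walk v e t == z]%:R
  <= a ^- 2 * \sum_(e in envs) G (walk v e).
Proof.
move=> t0s aG G0 a0 aE.
pose Q e := [&& bend (walk v e) t s r, level (walk v e) s == b & walk v e t == z].
pose F1 e := #|compat (walk v e) (slot s) t0|%:R^-1 *
  \sum_(g in compat (walk v e) (slot s) t0)
    (G (walk v (set_slot e (slot s) g)) * (Q (set_slot e (slot s) g))%:R) : R.
rewrite -/(Q _) (resample M_gt0 v (slot s) t0 (fun e => G (walk v e) * (Q e)%:R)).
rewrite -/(F1 _) (resample M_gt0 v (slot r) t0 F1) mulr_sumr.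
apply: ler_sum => e eE.
pose e2 f g := set_slot (set_slot e (slot r) f) (slot s) g.
have inE_ x j f : f \in compat x j t0 -> f \in E by case/compatP.
have w1 f q : f \in compat (walk v e) (slot r) t0 -> (q <= t0)%N ->
    walk v (set_slot e (slot r) f) q = walk v e q.
  by move=> fA qt; rewrite (walk_set_slot fA).
have compE f : f \in compat (walk v e) (slot r) t0 ->
    compat (walk v (set_slot e (slot r) f)) (slot s) t0 = compat (walk v e) (slot s) t0.
  by move=> fA; apply: compat_ext => q; apply: w1.
set Ar := compat (walk v e) (slot r) t0; set As := compat (walk v e) (slot s) t0.
have w2 f g q : f \in Ar -> g \in As -> (q <= t0)%N -> walk v (e2 f g) q = walk v e q.
  by move=> fA gA qt; rewrite (walk_set_slot (t := t0)) ?compE // w1.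
have e2E f g : f \in Ar -> g \in As -> e2 f g \in envs.
  by move=> fA gA; rewrite !set_slot_envs // (inE_ _ _ _ fA, inE_ _ _ _ gA).
have E1 : \sum_(f in Ar) (#|compat (walk v (set_slot e (slot r) f)) (slot s) t0|%:R^-1 *
     \sum_(g in compat (walk v (set_slot e (slot r) f)) (slot s) t0)
        (G (walk v (e2 f g)) * (Q (e2 f g))%:R)) =
   G (walk v e) * #|As|%:R^-1 * \sum_(f in Ar) \sum_(g in As) (Q (e2 f g))%:R.
  rewrite mulr_sumr; apply: eq_bigr => f fA; rewrite compE // -/As.
  rewrite [in RHS](mulrC (G _)) -mulrA; congr (_ * _); rewrite mulr_sumr.
  by apply: eq_bigr => g gA; congr (_ * _); apply: aG => q qt; apply: w2.
apply: le_trans (_ : #|Ar|%:R^-1 *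
    (G (walk v e) * #|As|%:R^-1 * \sum_(f in Ar) \sum_(g in As) (Q (e2 f g))%:R) <= _).
  by rewrite -E1.
have Gp : 0 <= a ^- 2 * G (walk v e) by rewrite mulr_ge0 // invr_ge0 exprn_ge0 // ltW.
have [/existsP[f /existsP[g /and3P[fA gA Qfg]]]|/existsPn h] :=
    boolP [exists f, exists g, [&& f \in Ar, g \in As & Q (e2 f g)]]; last first.
  rewrite big1 ?mulr0 // => f fA; rewrite big1 // => g gA.
  by case Qfg: (Q _) => //; have /existsPn/(_ g) := h f; rewrite fA gA Qfg.
have [Bfg /andP[/eqP lfg /eqP zfg]] := andP Qfg.
have [sr rt _ _ /andP[os or]] := and5P Bfg.
have [cs hs] := onceP _ _ _ os; have [cr hr] := onceP _ _ _ or.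
have nsr : slot s != slot r.
  apply/negP=> /eqP/(congr1 val)/= esr; have := hs r rt (esym esr).
  by rewrite cr => h; have : r <> s by [move=> e1; rewrite e1 ltnn in sr]; move/h.
have uniq_ f' g' : f' \in Ar -> g' \in As -> Q (e2 f' g') -> f' = f /\ g' = g.
  move=> fA' gA' /and3P[B' /eqP l' /eqP z'].
  have ee : e2 f' g' = e2 f g.
    apply: (bend_inj (e2E _ _ fA' gA') (e2E _ _ fA gA) _ B' Bfg l' lfg); last by rewrite z' zfg.
    by move=> i ns nr; rewrite !ffunE (negbTE ns) (negbTE nr).
  have := congr1 (fun h : env => h (slot s)) ee; have := congr1 (fun h : env => h (slot r)) ee.
  by rewrite !ffunE eqxx eq_sym (negbTE nsr) eqxx => -> ->.
have st : (s < t)%N by exact: ltn_trans rt.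
(* A slot crossed only once, and not before [t0], is still unknown at [t0]: nearly all edges are
   compatible with it. *)
have low j q : (t0 <= q)%N -> (q <= t)%N -> j = slot q ->
    (forall p, (p < t0)%N -> p = q %[mod M] -> ~~ crossed (walk v (e2 f g)) p) ->
    a <= #|compat (walk v e) j t0|%:R.
  move=> tq qt -> nc; apply: le_trans aE _; rewrite lerBlDr -natrD ler_nat.
  rewrite -(@compat_ext _ _ M_gt0 (walk v (e2 f g))) => [|p pt]; last exact: w2.
  apply: leq_trans (card_compat tq nc) _.
  by rewrite leq_add2l leq_mul2l leq_div2r ?orbT.
have aAs : a <= #|As|%:R.
  apply: (low _ s) => //; first exact: ltnW.
  move=> p pt0 ps; apply: hs => //; first by apply: ltn_trans st; apply: leq_trans t0s.
  by move=> e1; rewrite e1 ltnNge t0s in pt0.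
have aAr : a <= #|Ar|%:R.
  have t0r : (t0 <= r)%N by apply: leq_trans t0s (ltnW sr).
  apply: (low _ r) => //; first exact: ltnW.
  move=> p pt0 ps; apply: hr => //; first by apply: ltn_trans rt; apply: leq_trans t0r.
  by move=> e1; rewrite e1 ltnNge t0r in pt0.
have -> : \sum_(f0 in Ar) \sum_(g0 in As) (Q (e2 f0 g0))%:R = 1 :> R.
  rewrite (bigD1 f) //= (bigD1 g) //= Qfg big1 ?addr0 => [|g' /andP[gA' ng]].
    rewrite big1 ?addr0 // => f' /andP[fA' nf]; rewrite big1 // => g' gA'.
    by case Q': (Q _) => //; have [e1 _] := uniq_ _ _ fA' gA' Q'; rewrite e1 eqxx in nf.
  by case Q': (Q _) => //; have [_ e1] := uniq_ _ _ fA gA' Q'; rewrite e1 eqxx in ng.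
have pA (B : {set {set V}}) : a <= #|B|%:R -> #|B|%:R^-1 <= a^-1 :> R.
  by move=> h; rewrite lef_pV2 // posrE // (lt_le_trans a0).
rewrite mulr1 mulrCA mulrC expr2 invfM; apply: ler_wpM2r => //.
by apply: ler_pM; rewrite ?invr_ge0 ?ler0n //; exact: pA.
Qed.

End Bends.

(** * The exponential supermartingale *)

Lemma half_large (a c m : nat) : (c * 2 <= m -> m <= a + c -> m <= 2 * a)%N.
Proof. lia. Qed.

Section Potential.
Variables (R : realType) (n M : nat) (M_gt0 : (0 < M)%N).
Local Open Scope ring_scope.
Local Open Scope set_scope.
Local Notation V := (hamming_vertex n).
Local Notation E := (hamming_edges n).
Local Notation env := {ffun 'I_M -> {set V}}.
Local Notation noret := (@noret n M).
Local Notation known := (@known n M).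
Local Notation earlier := (@earlier n M).
Local Notation fresh := (@fresh n M).
Local Notation collides := (@collides n M).
Local Notation walk := (@walk n M M_gt0).
Local Notation moves := (@moves n M M_gt0).
Local Notation envs := (envs n M).
Implicit Types (x : nat -> V) (e : env) (s t r : nat) (y : V) (d : bool).

Variables (gamma phi delta b S : R) (h : nat) (theta t0 : nat).
Hypothesis start : theta = t0.+1 \/ theta = 0%N /\ t0 = 0%N.
Hypotheses (phi_gt0 : 0 < phi) (phi_lt1 : phi < 1) (gamma_gt0 : 0 < gamma)
  (delta_gt0 : 0 < delta) (b_gt0 : 0 < b) (S_ge0 : 0 <= S).
Hypothesis bE : b * #|E|%:R <= M%:R * (n.-1%:R - h%:R).
Hypothesis SE : 4 * h%:R * M%:R <= S * #|E|%:R.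
(** The weight of an unexplored bent vertex. Its discoveries are roughly Poisson with mean at least
    [b] in each direction, and [bent_cond] makes [q] a strict supersolution of the extinction
    equation, [expR (2 * b * (q - 1)) < q], with a slack [delta] that feeds [gain]. The next two
    conditions secure the same slack at unlabelled and at straight vertices; [known_cond] handles
    the steps that cannot discover anything. *)
Let q := expR (- gamma).
Hypothesis bent_cond : delta + gamma <= 2 * b * (1 - q).
Hypothesis old_cond : delta <= 2 * b * phi.
Hypothesis straight_cond : phi + delta + S * phi <= b * (1 - phi - q).
Hypothesis known_cond : phi <= (1 - phi) * gamma.

(** Leaves at least [n.-1 - h] unvisited neighbours in each direction. *)
Definition thin x t := [forall d, forall c, #|before x t.+1 :&: line d c| <= h]%N.
Definition clear x t := [&& noret x t, thin x t &
  [forall s : 'I_t, (t0 <= s)%N ==> ~~ collides theta s x]].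
Let lab x t := labels x theta t0 (t - t0).
(** The number of phases still unexplored on the circles of the bent vertices. *)
Definition remaining x t : R := \sum_(y in bent (lab x t)) (M%:R - (visits x t y)%:R).
(** A straight vertex matters only while the walk sits on it: its unexplored fraction then lowers
    the potential by a factor no smaller than [1 - phi]. Once left it is forgotten, since it need
    not produce any bend. *)
Definition shade x t : R :=
  if (x t \in straight (lab x t) true) || (x t \in straight (lab x t) false)
  then 1 - phi * (M%:R - (visits x t (x t))%:R) / M%:R else 1.
(** An unknown step earns the drift [delta]. On a known step nothing can be discovered while
    [remaining] may drop by one; the loss [gamma] makes up for that. *)
Definition gain x t : R := \sum_(t0 <= s < t) (if known x s then - gamma / M%:R else delta / M%:R).
Definition potential x t : R :=
  if clear x t then expR (gain x t - gamma / M%:R * remaining x t) * shade x t else 0.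

Let theta_le : (theta <= t0.+1)%N.
Proof. by case: start => [->|[-> ->]]. Qed.

(** Only landings on vertices discovered up to [t1] are excluded, and [t1] may precede [t]: a window
    with a collision on a later vertex is still usable. *)
Lemma no_collisions x t t1 :
  (forall s, (t0 <= s)%N -> (s < t)%N -> fresh x s -> x s.+1 \notin discovered x theta (minn s t1)) ->
  forall s r, (s < t)%N -> fresh x s -> (theta <= r)%N -> (r <= t1)%N ->
     first x r -> x r = x s.+1 -> r = s.+1.
Proof.
move=> H s r st fs tr rt1 fr xr.
have nlt : (s.+1 < r)%N -> False by move/(firstP _ _ fr); rewrite xr eqxx.
have [t0s|st0] := leqP t0 s.
  case: (ltngtP r s.+1) => [rs|/nlt//|//].
  have /negP[] := H s t0s st fs; rewrite -xr; apply/discoveredP; exists r; split=> //.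
  by rewrite leq_min -ltnS rs.
case: start => [e|[_ e]]; last by rewrite e in st0.
by case: nlt; apply: leq_trans tr; rewrite e.
Qed.

Lemma clear_no_collisions x t : clear x t -> forall s r, (s < t)%N -> fresh x s ->
  (theta <= r)%N -> (r <= t)%N -> first x r -> x r = x s.+1 -> r = s.+1.
Proof.
case/and3P=> _ _ /forallP H; apply: no_collisions => s t0s st fs.
rewrite (minn_idPl (ltnW st)); apply/negP=> xd.
by have := H (Ordinal st); rewrite /= t0s /collides fs xd.
Qed.

Lemma adapted_discovered t : adapted t (fun x => discovered x theta t) \/ (t < t0)%N.
Proof.
have [t0t|] := leqP t0 t; [left|by right].
move=> x x' hx; rewrite /discovered; congr (_ :\: _); apply: before_ext => s st; apply: hx.
  by rewrite -ltnS.
by rewrite -ltnS (leq_trans st) // (leq_trans theta_le).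
Qed.

Lemma adapted_clear t : adapted t (clear^~ t).
Proof.
move=> x x' hx; rewrite /clear.
have -> : noret x t = noret x' t.
  by case: t hx => [|t] hx; [apply: eq_forallb => -[]|apply: adapted_noret => s /leqW/hx].
have -> : thin x t = thin x' t.
  by apply: eq_forallb => d; apply: eq_forallb => c; rewrite (adapted_before hx).
congr [&& _, _ & _]; apply: eq_forallb => s; case: (leqP t0 s) => //= t0s; congr (~~ _).
have hs r : (r <= s.+1)%N -> x r = x' r by move=> rs; apply: hx; apply: leq_trans rs _.
rewrite /collides /fresh /crossed !hs //; congr (_ && _ && _).
  by congr (~~ _); apply: adapted_known => r /leqW/hs.
congr (_ \in pred_of_set _).
case: (adapted_discovered s) => [H|]; last by rewrite ltnNge t0s.
by apply: H => r /leqW/hs.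
Qed.

Lemma visits_ext x x' t y : (forall s, (s < t)%N -> x s = x' s) -> visits x t y = visits x' t y.
Proof. by move=> hx; apply: eq_bigr => s _; rewrite hx. Qed.

Lemma lab_ext x x' t : (t0 <= t)%N -> (forall s, (s <= t)%N -> x s = x' s) -> lab x t = lab x' t.
Proof. by move=> t0t hx; apply: labels_ext => // s; rewrite subnKC //; apply: hx. Qed.

Lemma adapted_potential t : (t0 <= t)%N -> adapted t (potential^~ t).
Proof.
move=> t0t x x' hx; rewrite /potential (adapted_clear hx); case: ifP => // _.
have hl s : (s < t)%N -> x s = x' s by move/ltnW/hx.
have -> : gain x t = gain x' t.
  apply: eq_big_nat => s /andP[_ st]; rewrite (@adapted_known _ _ s x x') // => r rs.
  by apply: hx; apply: leq_trans rs (ltnW st).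
have -> : remaining x t = remaining x' t.
  by rewrite /remaining (lab_ext t0t hx); apply: eq_bigr => y _; rewrite (visits_ext _ hl).
have -> : shade x t = shade x' t by rewrite /shade (lab_ext t0t hx) hx // (visits_ext _ hl).
by [].
Qed.

(** From [1 - c <= expR (- c)]: a loss [w] of at least [c * A] pays for the factor [expR c]. *)
Lemma expR_compensate (c A w : R) : 0 < A -> c * A <= w -> expR c * (A - w) <= A.
Proof.
move=> A0 cw; apply: le_trans (_ : expR c * (A * expR (- c)) <= _); last first.
  by rewrite mulrCA -expRD addrN expR0 mulr1.
rewrite ler_wpM2l ?expR_ge0 //; apply: le_trans (_ : A * (1 + - c) <= _).
  by rewrite mulrDr mulr1 lerD2l mulrN lerN2 mulrC.
by rewrite ler_wpM2l ?expR_ge1Dx // ltW.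
Qed.

Let M0 : (0 : R) < M%:R. Proof. by rewrite ltr0n. Qed.
Let Mn0 : M%:R != 0 :> R. Proof. by rewrite gt_eqF. Qed.

Lemma shade_ge x t : 1 - phi <= shade x t.
Proof.
rewrite /shade; case: ifP => _; last by rewrite lerBlDr lerDl ltW.
rewrite lerD2l lerN2 -mulrA -[X in _ <= X]mulr1 ler_wpM2l ?(ltW phi_gt0) //.
by rewrite ler_pdivrMr // mul1r lerBlDr lerDl.
Qed.

Lemma shade_le x t : noret x t -> shade x t <= 1.
Proof.
move=> nr; rewrite /shade; case: ifP => _ //; rewrite lerBlDr lerDl.
by rewrite divr_ge0 ?mulr_ge0 ?subr_ge0 ?ler_nat ?visits_le // ltW.
Qed.

Lemma shade_gt0 x t : 0 < shade x t.
Proof. by apply: lt_le_trans (shade_ge _ _); rewrite subr_gt0. Qed.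

Lemma potential_ge0 x t : 0 <= potential x t.
Proof. by rewrite /potential; case: ifP => // _; rewrite mulr_ge0 ?expR_ge0 // ltW ?shade_gt0. Qed.

Section Step.
Variables (v : V) (e : env) (e_in : e \in envs) (t : nat) (t0t : (t0 <= t)%N).
Let x := walk v e.
Let u := x t.
Let L := lab x t.

Let lab_extend y : lab (extend x t y) t.+1 = if y \in before x t.+1 then L else relabel L u y.
Proof.
have sk : (t.+1 - t0 = (t - t0).+1)%N by rewrite subSn.
have kk : (t0 + (t - t0).+1 = t.+1)%N by rewrite addnS subnKC.
have bx : before (extend x t y) t.+1 = before x t.+1.
  by apply: before_ext => s; rewrite ltnS => st; rewrite extend_le.
rewrite /lab sk /= kk extendE bx subnKC // extend_le //.
by rewrite (labels_ext (x' := x)) // subnKC // => s st; rewrite extend_le.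
Qed.

Let visits_extend y z : visits (extend x t y) t.+1 z = (visits x t z + (u == z))%N.
Proof.
rewrite visitsS extend_le //; congr (_ + _)%N.
by apply: visits_ext => s /ltnW st; rewrite extend_le.
Qed.

Let visits_unseen y : y \notin before x t.+1 -> visits x t y = 0%N /\ (u == y) = false.
Proof.
move=> ns; have H s : (s <= t)%N -> (x s == y) = false.
  by move=> st; apply: contraNF ns => /eqP <-; apply/beforeP; exists s.
split; last exact: H.
by rewrite -(visits0 x y); apply: visits_idle => // s _ /ltnW/H ->.
Qed.

Let bent_seen y : y \in bent L -> y \in before x t.+1.
Proof.
move=> yb; have : y \in discovered x theta (t0 + (t - t0)) by rewrite labels_discovered // yb.
by rewrite subnKC // => /setDP[].
Qed.

Let remaining_seen y : y \in before x t.+1 ->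
  remaining (extend x t y) t.+1 = remaining x t - (u \in bent L)%:R.
Proof.
move=> ys; rewrite /remaining lab_extend ys -/L.
have -> : (u \in bent L)%:R = \sum_(z in bent L) (u == z)%:R :> R.
  case: (boolP (u \in bent L)) => ub.
    rewrite (bigD1 u) //= eqxx big1 ?addr0 // => z /andP[_ nz].
    by rewrite eq_sym (negbTE nz).
  rewrite big1 // => z zb; case: eqP => // e1.
  by rewrite e1 zb in ub.
by rewrite -sumrB; apply: eq_bigr => z _; rewrite visits_extend natrD opprD addrA.
Qed.

Let remaining_unseen y : y \notin before x t.+1 ->
  remaining (extend x t y) t.+1 = remaining x t - (u \in bent L)%:R +
    ((u \in bent L) || (u \in straight L (coord true u != coord true y)))%:R * M%:R.
Proof.
move=> ns; have [v0 uy] := visits_unseen ns.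
have uy' : u \in before x t.+1 by apply/beforeP; exists t.
have rs := remaining_seen uy'.
have -> : remaining (extend x t y) t.+1 =
    \sum_(z in bent (relabel L u y)) (M%:R - (visits (extend x t u) t.+1 z)%:R).
  rewrite /remaining lab_extend (negbTE ns); apply: eq_bigr => z _.
  by rewrite !visits_extend.
rewrite -rs /remaining lab_extend uy' -/L.
have nyb : y \notin bent L by apply: contra ns; apply: bent_seen.
case h1: ((u \in bent L) || (u \in straight L (coord true u != coord true y))); last first.
  by rewrite mul0r addr0; apply: eq_bigl => z; rewrite relabel_bent h1 andbF orbF.
rewrite mul1r (bigD1 y) /=; last by rewrite relabel_bent h1 eqxx orbT.
rewrite visits_extend v0 uy addn0 subr0 addrC; congr (_ + _).
apply: eq_bigl => z; rewrite relabel_bent h1 andbT.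
by case: (z =P y) => [->|_]; rewrite ?(negbTE nyb) ?andbF ?orbF ?andbT.
Qed.

Let gain_extend y : gain (extend x t y) t.+1 =
  gain x t + (if known x t then - gamma / M%:R else delta / M%:R).
Proof.
rewrite /gain big_nat_recr //= known_extend; congr (_ + _).
apply: eq_big_nat => s /andP[_ st]; rewrite (@adapted_known _ _ s (extend x t y) x) // => r rs.
by rewrite extend_le // (leq_trans rs) // ltnW.
Qed.

Let clear_extend y : clear (extend x t y) t.+1 -> clear x t /\ noret x t.+1.
Proof.
have hx s : (s <= t)%N -> extend x t y s = x s by exact: extend_le.
have nrE : noret (extend x t y) t.+1 = noret x t.+1 by apply: adapted_noret.
move=> cl; case/and3P: (cl); rewrite nrE => nr th /forallP nc; split=> //.
have <- : clear (extend x t y) t = clear x t by exact: adapted_clear.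
rewrite /clear (noretW (leqnSn t)) ?nrE //=; apply/andP; split.
  apply/forallP=> d; apply/forallP=> c; move/forallP/(_ d)/forallP/(_ c): th.
  apply: leq_trans; apply: subset_leq_card; apply: setSI; exact: before_mono.
apply/forallP=> s; exact: nc (widen_ord (leqnSn t) s).
Qed.

Let Pot y := potential (extend x t y) t.+1.
Let E0 : R := expR (gain x t - gamma / M%:R * remaining x t).

Let Pot_le y (W : R) : ~~ known x t -> 0 <= W ->
  (noret x t.+1 -> shade (extend x t y) t.+1 <= 1 ->
   expR (- (gamma / M%:R) * (remaining (extend x t y) t.+1 - remaining x t)) *
     shade (extend x t y) t.+1 <= W) ->
  Pot y <= E0 * expR (delta / M%:R) * W.
Proof.
move=> nk W0 HW; have C0 : 0 <= E0 * expR (delta / M%:R) by rewrite mulr_ge0 ?expR_ge0.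
rewrite /Pot /potential; case: ifP => [cl|_]; last by rewrite mulr_ge0.
have [_ nr] := clear_extend cl.
have nr' : noret (extend x t y) t.+1 by case/and3P: cl.
apply: le_trans (_ : E0 * expR (delta / M%:R) *
   (expR (- (gamma / M%:R) * (remaining (extend x t y) t.+1 - remaining x t)) *
     shade (extend x t y) t.+1) <= _).
  rewrite mulrA -!expRD gain_extend (negbTE nk).
  by rewrite le_eqVlt; apply/orP; left; apply/eqP; congr (expR _ * _); ring.
by rewrite ler_wpM2l // HW // shade_le.
Qed.

Let unseen d : {set V} := [set y in nbrs d u | y \notin before x t.+1].

Let card_unseen d : thin x t -> n.-1%:R - h%:R <= #|unseen d|%:R :> R.
Proof.
move=> /forallP/(_ d)/forallP/(_ (coord d u)) th.
rewrite lerBlDr -natrD ler_nat -(card_nbrs d u) -(cardsID (before x t.+1) (nbrs d u)) addnC.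
apply: leq_add; last first.
  apply: leq_trans th; apply: subset_leq_card; apply/subsetP=> y.
  by rewrite !inE => /andP[/andP[a _] ->].
by apply: subset_leq_card; apply/subsetP=> y /setDP[a c]; apply/setIdP.
Qed.

Let seen : {set V} := [set y in targets M_gt0 v e t | y \in before x t.+1].

Let card_seen : thin x t -> (#|seen| <= 2 * h)%N.
Proof.
move=> /forallP th.
have sub : seen \subset (before x t.+1 :&: line true (coord true u)) :|: (before x t.+1 :&: line false (coord false u)).
  apply/subsetP=> y /setIdP[]; rewrite inE => /andP[ay _] yb.
  have : y \in [set y | hamming_adj u y] by rewrite inE.
  by rewrite (adj_nbrs true) !inE yb /= => /orP[] /andP[-> _]; rewrite ?orbT.
apply: leq_trans (subset_leq_card sub) _; apply: leq_trans (leq_card_setU _ _) _.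
rewrite mul2n -addnn; apply: leq_add.
  exact: (forallP (th true)).
exact: (forallP (th false)).
Qed.

Let sum_targets (F : V -> R) : \sum_(y in targets M_gt0 v e t) F y =
  \sum_(y in seen) F y + (\sum_(y in unseen true) F y + \sum_(y in unseen false) F y).
Proof.
have disj : [disjoint unseen true & unseen false].
  rewrite -setI_eq0; apply/eqP/setP=> y; rewrite [RHS]inE; apply/negbTE/negP.
  case/setIP=> /setIdP[a _] /setIdP[a' _].
  by have := nbrs_disj true u; move/setP/(_ y); rewrite inE a a' inE.
rewrite -bigU //= (bigID (fun y => y \in before x t.+1)) /=; congr (_ + _).
  by apply: eq_bigl => y; rewrite [RHS]inE.
apply: eq_bigl => y; rewrite -[RHS]/((y \in unseen true) || (y \in unseen false)) [y \in targets _ _ _ _]inE.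
have -> : (y \in unseen true) || (y \in unseen false) =
   (y \in [set y | hamming_adj u y]) && (y \notin before x t.+1).
  by rewrite (adj_nbrs true) in_setU andb_orl; congr (_ || _); rewrite [LHS]inE.
rewrite [X in _ = X && _]inE -/u; case: (hamming_adj u y) => //=.
case: (boolP (y \in before x t.+1)) => yb; rewrite ?andbF ?andbT //.
apply: contra yb => /earlierP[s [st _ ->]]; apply/beforeP; exists s => //.
exact: ltnW.
Qed.

Let C := E0 * expR (delta / M%:R).

Let sum_Pot (Wu Ws : R) (Wd : bool -> R) : ~~ known x t -> noret x t.+1 ->
  Pot u <= C * Wu -> (forall y, y \in before x t.+1 -> Pot y <= C * Ws) ->
  (forall d y, y \in unseen d -> Pot y <= C * Wd d) ->
  \sum_(f in moves x t) Pot (edge_swap f (x t)) <=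
  C * ((#|moves x t|%:R - #|seen|%:R - #|unseen true|%:R - #|unseen false|%:R) * Wu +
    #|seen|%:R * Ws + #|unseen true|%:R * Wd true + #|unseen false|%:R * Wd false).
Proof.
move=> nk nr hu hs hd.
have cT : #|targets M_gt0 v e t|%:R = #|seen|%:R + (#|unseen true|%:R + #|unseen false|%:R) :> R.
  by have := sum_targets (fun=> 1 : R); rewrite !sumr_const.
have AT : 0 <= #|moves x t|%:R - #|targets M_gt0 v e t|%:R :> R.
  have := sum_moves_unknown (fun y => (y == u)%:R : R) nk nr.
  rewrite eqxx mulr1 [X in _ + X]big1 ?addr0 => [<-|y]; first exact: sumr_ge0.
  by rewrite inE => /andP[/adj_neq uy _]; case: (y =P u) uy => // ->; rewrite eqxx.
rewrite (sum_moves_unknown Pot nk nr) sum_targets -/u.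
have bnd (A : {set V}) W : (forall y, y \in A -> Pot y <= C * W) ->
    \sum_(y in A) Pot y <= C * (#|A|%:R * W).
  move=> H; apply: le_trans (ler_sum _ H) _.
  by rewrite sumr_const -[C * W *+ _]mulr_natl mulrCA.
have h1 := bnd seen Ws (fun y ys => hs y (proj2 (setIdP ys))).
have h2 := bnd _ _ (hd true); have h3 := bnd _ _ (hd false).
have h4 : (#|moves x t|%:R - #|targets M_gt0 v e t|%:R) * Pot u <=
    (#|moves x t|%:R - #|targets M_gt0 v e t|%:R) * (C * Wu) by rewrite ler_wpM2l.
apply: le_trans (lerD h4 (lerD h1 (lerD h2 h3))) _; rewrite cT.
by rewrite le_eqVlt; apply/orP; left; apply/eqP; ring.
Qed.

Let q_ge0 : 0 <= q. Proof. exact: expR_ge0. Qed.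

Let q_le1 : q <= 1. Proof. by rewrite expR_le1 oppr_le0 ltW. Qed.

Let moves_le : #|moves x t|%:R <= #|E|%:R :> R.
Proof. by rewrite ler_nat; apply: subset_leq_card; apply/subsetP=> f /compatP[]. Qed.

Let unseen_large d : thin x t -> b * #|moves x t|%:R / M%:R <= #|unseen d|%:R.
Proof.
move=> th; rewrite ler_pdivrMr //; apply: le_trans (_ : b * #|E|%:R <= _).
  by rewrite ler_wpM2l // ltW.
apply: le_trans bE _; rewrite mulrC ler_wpM2r ?ler0n //; exact: card_unseen.
Qed.

Let rem_u : remaining (extend x t u) t.+1 - remaining x t = - (u \in bent L)%:R.
Proof.
rewrite remaining_seen; first by rewrite addrAC subrr add0r.
by apply/beforeP; exists t.
Qed.

Let potential_clear : clear x t -> potential x t = E0 * shade x t.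
Proof. by rewrite /potential => ->. Qed.

Let not_clear : ~~ (clear x t && noret x t.+1) ->
  \sum_(f in moves x t) Pot (edge_swap f (x t)) = 0.
Proof.
move=> nc; apply: big1 => f _; rewrite /Pot /potential; case: ifP => // /clear_extend[a1 a2].
by rewrite a1 a2 in nc.
Qed.

Let Cge : 0 <= C. Proof. by rewrite mulr_ge0 ?expR_ge0. Qed.
Let gM : 0 <= gamma / M%:R. Proof. by rewrite divr_ge0 // ltW. Qed.

(** Three cases. From a bent vertex every discovery is bent and brings the factor [q], while each
    phase spent brings [expR (gamma / M)]. From an unlabelled vertex a discovery is straight and
    lowers the shade to [1 - phi]. From a straight vertex a perpendicular discovery is bent and
    brings [q], a parallel one puts the shade back to its minimum, and staying raises the shade by
    [phi / M]. *)
Lemma potential_unknown : ~~ known x t -> (#|E| <= 2 * #|moves x t|)%N ->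
  \sum_(f in moves x t) Pot (edge_swap f (x t)) <= #|moves x t|%:R * potential x t.
Proof.
move=> nk EA.
have [/andP[cl nr]|/not_clear->] := boolP (clear x t && noret x t.+1); last first.
  by rewrite mulr_ge0 ?potential_ge0.
have th : thin x t by case/and3P: cl.
have nrt : noret x t by case/and3P: cl.
set A : R := #|moves x t|%:R.
have A0 : 0 < A by rewrite ltr0n (card_compat_gt0 M_gt0 v _ _ e_in).
have seen_u : u \in before x t.+1 by apply/beforeP; exists t.
have u1 := unseen_large true th; have u2 := unseen_large false th.
rewrite -/A in u1 u2; set a1 : R := #|unseen true|%:R in u1 *; set a2 : R := #|unseen false|%:R in u2 *.
have [ub|nub] := boolP (u \in bent L).
  have sh : shade x t = 1.
    rewrite /shade; case: ifP => // /orP[] us.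
      by have := labels_disjoint theta_le us; rewrite -/(lab x t) -/L ub.
    by have := labels_disjoint theta_le us; rewrite -/(lab x t) -/L ub.
  have H := @sum_Pot (expR (gamma / M%:R)) (expR (gamma / M%:R)) (fun=> expR (gamma / M%:R) * q) nk nr.
  rewrite -/A -/a1 -/a2 in H; rewrite potential_clear // sh mulr1; apply: le_trans (H _ _ _) _.
  - apply: Pot_le => //; first exact: expR_ge0.
    by move=> _ s1; rewrite rem_u ub mulrN1 opprK -[X in _ <= X]mulr1 ler_wpM2l ?expR_ge0.
  - move=> y ys; apply: Pot_le => //; first exact: expR_ge0.
    move=> _ s1; rewrite remaining_seen // ub addrAC subrr add0r mulrN1 opprK.
    by rewrite -[X in _ <= X]mulr1 ler_wpM2l ?expR_ge0.
  - move=> d y /setIdP[_ ns]; apply: Pot_le => //; first by rewrite mulr_ge0 ?expR_ge0.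
    move=> _ s1; rewrite remaining_unseen // ub mul1r.
    have -> : - (gamma / M%:R) * (remaining x t - true%:R + M%:R - remaining x t) = gamma / M%:R - gamma.
      have -> : remaining x t - true%:R + M%:R - remaining x t = M%:R - 1 by rewrite mulr1n; ring.
      by rewrite mulrBr mulr1 opprK mulNr mulfVK // addrC.
    by rewrite expRD -[X in _ <= X]mulr1 ler_wpM2l // mulr_ge0 ?expR_ge0.
  rewrite /C -(mulrA E0) (mulrC A E0) ler_wpM2l ?expR_ge0 // /=.
  rewrite [X in _ * X](_ : _ = expR (gamma / M%:R) * (A - (a1 + a2) * (1 - q))); last by ring.
  rewrite mulrA -expRD; apply: expR_compensate => //.
  apply: le_trans (_ : 2 * b * (1 - q) * (A / M%:R) <= _).
    by rewrite -mulrDl -mulrA [M%:R^-1 * A]mulrC ler_wpM2r // divr_ge0 // ltW.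
  have -> : 2 * b * (1 - q) * (A / M%:R) = (b * A / M%:R + b * A / M%:R) * (1 - q) by ring.
  by rewrite ler_wpM2r ?subr_ge0 // lerD.
have seen_rem y : y \in before x t.+1 -> remaining (extend x t y) t.+1 - remaining x t = 0.
  by move=> ys; rewrite remaining_seen // (negbTE nub) subr0 subrr.
have unseen_rem y : y \notin before x t.+1 -> remaining (extend x t y) t.+1 - remaining x t =
    (u \in straight L (coord true u != coord true y))%:R * M%:R.
  by move=> ys; rewrite remaining_unseen // (negbTE nub) subr0 addrAC subrr add0r.
have qM : expR (- (gamma / M%:R) * (1 * M%:R)) = q.
  by rewrite mul1r mulNr mulfVK.
have shade_new y : y \notin before x t.+1 -> u \notin straight L (coord true u != coord true y) ->
    shade (extend x t y) t.+1 = 1 - phi.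
  move=> ns nus; have [v0 uy] := visits_unseen ns.
  have ys : y \in straight (relabel L u y) (coord true u == coord true y).
    by rewrite relabel_straight eqxx eqxx nub nus orbT.
  rewrite /shade extendE lab_extend (negbTE ns) visits_extend v0 uy addn0 subr0 mulfK //.
  by move: ys; case: (coord true u == coord true y) => ->; rewrite ?orbT.
have dirE d y : y \in unseen d -> (coord true u == coord true y) = d.
  case/setIdP; rewrite nbrs_adj => /andP[ay]; case: d => // h1 _; apply/negbTE.
  by rewrite -(adj_coordN true ay).
have [us|nus] := boolP ((u \in straight L true) || (u \in straight L false)); last first.
  have sh : shade x t = 1 by rewrite /shade -/(lab x t) -/L (negbTE nus).
  have nus' d : u \notin straight L d by move: nus; rewrite negb_or => /andP[a b_]; case: d.
  have H := @sum_Pot 1 1 (fun=> 1 - phi) nk nr.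
  rewrite -/A -/a1 -/a2 in H; rewrite potential_clear // sh mulr1; apply: le_trans (H _ _ _) _.
  - apply: Pot_le => // _ s1; by rewrite seen_rem // mulr0 expR0 mul1r.
  - move=> y ys; apply: Pot_le => // _ s1; by rewrite seen_rem // mulr0 expR0 mul1r.
  - move=> d y /setIdP[_ ns]; apply: Pot_le => //; first by rewrite subr_ge0 ltW.
    move=> _ s1; rewrite unseen_rem // (negbTE (nus' _)) mul0r mulr0 expR0 mul1r.
    by rewrite shade_new.
  rewrite /C -(mulrA E0) (mulrC A E0) ler_wpM2l ?expR_ge0 // /=.
  rewrite [X in _ * X](_ : _ = A - (a1 + a2) * phi); last by ring.
  apply: expR_compensate => //.
  apply: le_trans (_ : 2 * b * phi * (A / M%:R) <= _).
    by rewrite -mulrA [M%:R^-1 * A]mulrC ler_wpM2r // divr_ge0 // ltW.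
  have -> : 2 * b * phi * (A / M%:R) = (b * A / M%:R + b * A / M%:R) * phi by ring.
  by rewrite ler_wpM2r ?lerD // ltW.
pose f := shade x t.
have f1 : f <= 1 by exact: shade_le.
have f0 : 1 - phi <= f by exact: shade_ge.
have fE : f = 1 - phi * (M%:R - (visits x t u)%:R) / M%:R by rewrite /f /shade -/(lab x t) -/L us.
have fp : 0 < f by exact: shade_gt0.
have [d0 us0] : exists d, u \in straight L d by case/orP: us; [exists true|exists false].
have usN : u \notin straight L (~~ d0).
  have [r [_ _ fr1 xr dr]] := straight_first us0.
  apply/negP=> /straight_first[r' [_ _ fr1' xr' dr']].
  have er : r = r'.
    apply/eqP; rewrite -eqSS eqn_leq; apply/andP; split; rewrite leqNgt; apply/negP.
      by move=> /(firstP _ _ fr1); rewrite xr xr' eqxx.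
    by move=> /(firstP _ _ fr1'); rewrite xr xr' eqxx.
  by move: dr'; rewrite -er dr; case: (d0).
have stay : shade (extend x t u) t.+1 = f + phi / M%:R.
  rewrite /shade extendE lab_extend seen_u us visits_extend eqxx fE addn1.
  by rewrite -natr1; field.
have := @sum_Pot (f + phi / M%:R) 1 (fun d => if d == d0 then 1 - phi else q) nk nr.
rewrite -/A -/a1 -/a2 potential_clear // -/f => H; apply: le_trans (H _ _ _) _.
- apply: Pot_le => //; first by rewrite addr_ge0 // ?divr_ge0 // ltW.
  by move=> _ s1; rewrite seen_rem // mulr0 expR0 mul1r stay.
- move=> y ys; apply: Pot_le => // _ s1; by rewrite seen_rem // mulr0 expR0 mul1r.
- move=> d y yu; have [_ ns] := setIdP yu; have dE := dirE d y yu.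
  apply: Pot_le => //; first by case: ifP; rewrite // subr_ge0 ltW.
  move=> _ s1; rewrite unseen_rem // dE; case: (d =P d0) => [e1|/eqP nd].
    by rewrite e1 (negbTE usN) mul0r mulr0 expR0 mul1r shade_new // dE e1.
  have -> : ~~ d = d0 by move: nd; case: (d); case: (d0).
  by rewrite us0 qM -[X in _ <= X]mulr1 ler_wpM2l.
rewrite /C -(mulrA E0) (mulrCA A E0) ler_wpM2l ?expR_ge0 // /=.
set s : R := #|seen|%:R.
have s0 : 0 <= s by [].
(* At the visited targets, at most [2 * h] of them, the shade may jump to 1. As half of the edges
   are still compatible, [SE] bounds their number by [S * A / M]. *)
have sM : s * M%:R <= S * A.
  have h1 : s <= 2 * h%:R by rewrite -natrM ler_nat card_seen.
  have h2 : s * M%:R <= 2 * h%:R * M%:R by rewrite ler_wpM2r // ltW.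
  have EA' : #|E|%:R <= 2 * A by rewrite -natrM ler_nat.
  have h3 : S * #|E|%:R <= S * (2 * A) by rewrite ler_wpM2l.
  by move: SE; lra.
have sS : s * phi <= S * phi * (A / M%:R).
  rewrite mulrA ler_pdivlMr // (mulrAC s) (mulrAC S) ler_wpM2r //.
  exact: ltW.
set A1 := A / M%:R in sS *; set m := phi / M%:R.
have m0 : 0 <= m by rewrite divr_ge0 // ltW.
have A1_ge0 : 0 <= A1 by rewrite divr_ge0 // ltW.
have mA : A * m = A1 * phi by rewrite /m /A1; ring.
have dA : delta / M%:R * (A * f) <= delta * A1.
  have -> : delta / M%:R * (A * f) = delta * A1 * f by rewrite /A1; ring.
  by rewrite -[X in _ <= X]mulr1 ler_wpM2l // mulr_ge0 // ltW.
have k0 : 0 <= 1 - phi - q.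
  rewrite -(pmulr_rge0 _ b_gt0); apply: le_trans straight_cond.
  by rewrite !addr_ge0 ?mulr_ge0 // ltW.
have main ap ae : 0 <= ae -> b * A1 <= ap -> expR (delta / M%:R) *
    ((A - s - ap - ae) * (f + m) + s + ae * (1 - phi) + ap * q) <= A * f.
  move=> ae0 hap; have ap0 : 0 <= ap by apply: le_trans hap; rewrite mulr_ge0 // ltW.
  (* The net loss: each perpendicular discovery lowers the value from [f] to [q], against a rise of
     at most [phi] at a visited target and [phi / M] for staying. What parallel discoveries bring is
     discarded. *)
  pose w := ap * (f - q) - s * phi - A * m.
  apply: le_trans (_ : expR (delta / M%:R) * (A * f - w) <= _).
    rewrite ler_wpM2l ?expR_ge0 // -subr_ge0.
    have -> : A * f - w - ((A - s - ap - ae) * (f + m) + s + ae * (1 - phi) + ap * q) =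
        s * ((f - (1 - phi)) + m) + ap * m + ae * ((f - (1 - phi)) + m) by rewrite /w; ring.
    have g0 : 0 <= f - (1 - phi) by rewrite subr_ge0.
    by rewrite addr_ge0 ?addr_ge0 // mulr_ge0 // addr_ge0.
  apply: expR_compensate; first by rewrite mulr_gt0.
  apply: le_trans dA _; rewrite /w mA.
  have h1 : b * A1 * (1 - phi - q) <= ap * (f - q).
    by apply: ler_pM => //; [rewrite mulr_ge0 // ltW | rewrite lerD2r].
  have h2 : A1 * (phi + delta + S * phi) <= A1 * (b * (1 - phi - q)) by rewrite ler_wpM2l.
  by move: h1 h2 sS; lra.
rewrite -mulrA -/A1 in u1; rewrite -mulrA -/A1 in u2.
rewrite mulr1; case: (d0) => /=.
  by have := main a2 a1 (ler0n _ _) u2; apply: le_trans; rewrite le_eqVlt; apply/orP; left; apply/eqP; ring.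
by have := main a1 a2 (ler0n _ _) u1; apply: le_trans; rewrite le_eqVlt; apply/orP; left; apply/eqP; ring.
Qed.

(** A known step visits no new vertex, so the labels do not change. At a bent vertex the drop of
    [remaining] cancels the loss in [gain]. At a straight one the shade rises by at most [phi / M],
    which [known_cond] pays; this covers a departure too, because by [leave_known] only one phase
    was then left. *)
Lemma potential_known : known x t -> potential x t.+1 <= potential x t.
Proof.
move=> kn; have agree s : (s <= t.+1)%N -> extend x t (x t.+1) s = x s.
  by rewrite leq_eqVlt ltnS => /orP[/eqP->|st]; [rewrite extendE | rewrite extend_le].
have -> : potential x t.+1 = Pot (x t.+1).
  by apply/esym; apply: (adapted_potential (leqW t0t)).
rewrite /Pot {1}/potential; case: ifP => [cl|_]; last exact: potential_ge0.
have [clt nr] := clear_extend cl.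
have nr' : noret (extend x t (x t.+1)) t.+1 by case/and3P: cl.
have sh1 := shade_le nr'.
have seen_u : u \in before x t.+1 by apply/beforeP; exists t.
have cross_seen : crossed x t -> x t.+1 \in before x t.+1.
  move=> ct; have [s [st es cs]] := knownP _ _ _ kn.
  have nst : x s != x t.
    apply: (noret_neq nr) => //; first exact: ltnW.
    by move=> e1; rewrite e1 ltnn in st.
  have [_ xq] := cross_back e_in es cs ct nst; have -> : x t.+1 = x s := xq.
  by apply/beforeP; exists s => //; apply: ltnW.
have seen_y : x t.+1 \in before x t.+1.
  have [/cross_seen//|] := boolP (crossed x t).
  by rewrite negbK => /eqP ->.
rewrite potential_clear // gain_extend kn remaining_seen //.
have -> : gain x t + - gamma / M%:R - gamma / M%:R * (remaining x t - (u \in bent L)%:R) =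
    (gain x t - gamma / M%:R * remaining x t) + (- (gamma / M%:R) * (1 - (u \in bent L)%:R)) by ring.
rewrite expRD -mulrA ler_wpM2l ?expR_ge0 //.
have small k : 0 <= k -> expR (- (gamma / M%:R) * k) <= 1.
  by move=> k0; rewrite expR_le1 mulNr oppr_le0 mulr_ge0.
have [us|nus] := boolP ((u \in straight L true) || (u \in straight L false)); last first.
  have -> : shade x t = 1 by rewrite /shade -/(lab x t) -/L (negbTE nus).
  have h1 : expR (- (gamma / M%:R) * (1 - (u \in bent L)%:R)) <= 1.
    by apply: small; case: (u \in _); rewrite ?subrr ?subr0.
  by rewrite -[X in _ <= X]mul1r; apply: ler_pM; rewrite ?expR_ge0 // ltW ?shade_gt0.
have nub : u \notin bent L.
  by case/orP: us => us; apply: (labels_disjoint theta_le us).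
rewrite (negbTE nub) subr0 mulr1.
pose f := shade x t; pose m := phi / M%:R.
have fE : f = 1 - phi * (M%:R - (visits x t u)%:R) / M%:R by rewrite /f /shade -/(lab x t) -/L us.
have fp : 0 < f by exact: shade_gt0.
have fm : shade (extend x t (x t.+1)) t.+1 <= f + m.
  have [ct|nct] := boolP (crossed x t).
    apply: le_trans sh1 _; rewrite fE.
    have [d [r [t0r rt fr xr _]]] : exists d r, [/\ (t0 <= r)%N, (r < t0 + (t - t0))%N, first x r.+1,
        x r.+1 = u & (coord true (x r) == coord true u) = d].
      by case/orP: us => /straight_first[r H]; [exists true|exists false]; exists r.
    have rt' : (r.+1 <= t)%N by move: rt; rewrite subnKC.
    have nc s p : (s < t.+1)%N -> fresh x s -> (theta <= p)%N -> (p <= t)%N ->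
        first x p -> x p = x s.+1 -> p = s.+1.
      rewrite ltnS leq_eqVlt => /orP[/eqP->|]; last exact: (clear_no_collisions clt).
      by rewrite /fresh kn andbF.
    have := @leave_known n M M_gt0 v e e_in theta t t.+1 nr nc t r.
    rewrite -/x => /(_ (leq_trans theta_le _) rt' fr (esym xr) (ltnSn t) kn ct).
    rewrite ltnS t0r xr => /(_ isT) vM.
    have -> : M%:R - (visits x t u)%:R = 1 :> R by rewrite -{1}vM -natr1 addrAC subrr add0r.
    by rewrite /m mulr1 subrK.
  have -> : x t.+1 = u by move: nct; rewrite negbK => /eqP.
  rewrite /shade extendE lab_extend seen_u us visits_extend eqxx fE addn1 /m.
  by rewrite -natr1 le_eqVlt; apply/orP; left; apply/eqP; field.
apply: le_trans (_ : expR (- (gamma / M%:R)) * (f + m) <= _).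
  by rewrite ler_wpM2l ?expR_ge0.
have h2 : f + m <= f * expR (gamma / M%:R).
  apply: le_trans (_ : f * (1 + gamma / M%:R) <= _); last by rewrite ler_wpM2l ?expR_ge1Dx // ltW.
  have fg : phi <= f * gamma.
    apply: le_trans known_cond _; rewrite ler_wpM2r ?(ltW gamma_gt0) //; exact: shade_ge.
  by rewrite mulrDr mulr1 lerD2l /m mulrA ler_wpM2r // invr_ge0 ltW.
apply: le_trans (_ : expR (- (gamma / M%:R)) * (f * expR (gamma / M%:R)) <= _).
  by rewrite ler_wpM2l ?expR_ge0.
by rewrite mulrCA -expRD addNr expR0 mulr1.
Qed.

Lemma potential_one_step : (~~ known x t -> #|E| <= 2 * #|moves x t|)%N ->
  \sum_(f in moves x t) potential (extend x t (edge_swap f (x t))) t.+1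
    <= #|moves x t|%:R * potential x t.
Proof.
move=> EA; have [kn|nk] := boolP (known x t); last exact: potential_unknown (EA nk).
have H f : f \in moves x t -> potential (extend x t (edge_swap f (x t))) t.+1 = potential x t.+1.
  move=> fA; apply: (adapted_potential (leqW t0t)) => s.
  rewrite leq_eqVlt ltnS => /orP[/eqP->|st]; last by rewrite extend_le.
  by rewrite extendE; apply: moves_known.
rewrite (eq_bigr _ H) sumr_const -[X in X <= _]mulr_natl ler_wpM2l //.
exact: potential_known.
Qed.

End Step.

Lemma potential_sum v t (G : (nat -> V) -> R) : (t0 <= t)%N -> adapted t0 G ->
  (forall x, 0 <= G x) -> (n.-1.*2 * (t %/ M) * 2 <= #|E|)%N ->
  \sum_(e in envs) G (walk v e) * potential (walk v e) t <=
  \sum_(e in envs) G (walk v e) * potential (walk v e) t0.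
Proof.
move=> t0t aG G0; elim: t t0t => [|t IH].
  by rewrite leqn0 => /eqP->.
rewrite leq_eqVlt => /orP[/eqP->//|t0t] EA.
have EA' : (n.-1.*2 * (t %/ M) * 2 <= #|E|)%N.
  by apply: leq_trans EA; rewrite leq_mul2r leq_mul2l leq_div2r ?orbT.
apply: le_trans (IH t0t EA').
apply: (@one_step_le _ _ _ M_gt0 v t (fun x => G x * potential x t.+1)
  (fun x => G x * potential x t)).
  move=> x x' hx; rewrite (adapted_potential (leqW t0t) hx); congr (_ * _).
  by apply: aG => s st; apply: hx; apply: leq_trans st _; apply: leqW.
move=> e eE; cbv zeta; set x := walk v e.
rewrite mulrCA; have -> : \sum_(f in moves x t) G (extend x t (edge_swap f (x t))) *
    potential (extend x t (edge_swap f (x t))) t.+1 =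
    G x * \sum_(f in moves x t) potential (extend x t (edge_swap f (x t))) t.+1.
  rewrite mulr_sumr; apply: eq_bigr => f _; congr (_ * _).
  by apply: aG => s st; rewrite extend_le // (leq_trans st).
rewrite ler_wpM2l //; apply: potential_one_step => // nk.
exact: half_large EA' (card_moves nk).
Qed.

(** With [theta = 0] the starting vertex is bent and wholly unexplored, which gives a full factor
    [q]; otherwise no vertex is labelled yet. *)
Lemma potential_start x : potential x t0 <= if theta == 0%N then q else 1.
Proof.
rewrite /potential; case: ifP => [_|_]; last by case: ifP; rewrite ?expR_ge0.
have -> : shade x t0 = 1 by rewrite /shade /lab subnn /= /straight /= !inE.
rewrite /gain big_geq // mulr1 add0r /remaining /lab subnn /=.
case: start => [->|[-> ->]] /=.
  by rewrite /discovered setDv big_set0 mulr0 oppr0 expR0.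
have -> : discovered x 0 0 = [set x 0%N].
  apply/setP=> y; rewrite inE; apply/discoveredP/eqP => [[r [_]]|->].
    by rewrite leqn0 => /eqP-> _ ->.
  by exists 0%N; split=> //; apply/firstP.
by rewrite big_set1 visits0 subr0 mulfVK.
Qed.

(** Markov's inequality: on the event the potential is at least
    [(1 - phi) * expR (l - gamma * c)]. *)
Lemma clear_tail v t (G : (nat -> V) -> R) (c l : R) : (t0 <= t)%N -> adapted t0 G ->
  (forall x, 0 <= G x) -> (n.-1.*2 * (t %/ M) * 2 <= #|E|)%N ->
  \sum_(e in envs) G (walk v e) * [&& clear (walk v e) t,
     remaining (walk v e) t <= c * M%:R & l <= gain (walk v e) t]%:R <=
  (1 - phi)^-1 * expR (gamma * c - l) * (if theta == 0%N then q else 1) *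
     \sum_(e in envs) G (walk v e).
Proof.
move=> t0t aG G0 EA; have phi' : 0 < 1 - phi by rewrite subr_gt0.
rewrite -mulrA mulr_sumr; set z := if _ then _ else _.
apply: le_trans (_ : (1 - phi)^-1 * expR (gamma * c - l) *
    \sum_(e in envs) G (walk v e) * potential (walk v e) t <= _).
  rewrite mulr_sumr; apply: ler_sum => e eE; rewrite mulrCA ler_wpM2l //.
  case: (boolP [&& _, _ & _]) => [/and3P[cl rem gn]|_]; last first.
    by rewrite mulr_ge0 ?potential_ge0 // mulr_ge0 ?expR_ge0 // invr_ge0 ltW.
  rewrite /potential cl -ler_pdivrMl ?mulr_gt0 ?invr_gt0 ?expR_gt0 //.
  rewrite mulr1n mulr1 invfM invrK -expRN mulrC; apply: ler_pM; rewrite ?expR_ge0 ?shade_ge ?(ltW phi') //.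
  rewrite ler_expR opprB lerD // lerN2 -mulrA ler_wpM2l ?(ltW gamma_gt0) //.
  by rewrite ler_pdivrMl // mulrC.
rewrite ler_wpM2l ?mulr_ge0 ?expR_ge0 ?invr_ge0 ?(ltW phi') //.
apply: le_trans (potential_sum v t0t aG G0 EA) _.
by apply: ler_sum => e _; rewrite mulrC ler_wpM2r // potential_start.
Qed.

End Potential.

(** * Fresh and repeated crossings in a window *)

Section Windows.
Variables (n M : nat) (M_gt0 : (0 < M)%N).
Local Open Scope nat_scope.
Local Open Scope set_scope.
Local Notation V := (hamming_vertex n).
Local Notation E := (hamming_edges n).
Local Notation env := {ffun 'I_M -> {set V}}.
Local Notation noret := (@noret n M).
Local Notation known := (@known n M).
Local Notation fresh := (@fresh n M).
Local Notation collides := (@collides n M).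
Local Notation walk := (@walk n M M_gt0).
Local Notation envs := (envs n M).
Implicit Types (x : nat -> V) (e : env) (s t r : nat) (y : V).

Definition news t0 t x := \sum_(t0 <= s < t) (fresh x s : nat).

Lemma adapted_fresh s : adapted s.+1 (fun x => fresh x s).
Proof.
move=> x x' hx; rewrite /fresh /crossed !hx //; congr (_ && ~~ _).
by apply: adapted_known => r rs; apply: hx; apply: leqW.
Qed.

Lemma adapted_news t0 t : adapted t (news t0 t).
Proof.
move=> x x' hx; apply: eq_big_nat => s /andP[_ st]; rewrite (@adapted_fresh s x x') // => r rs.
by apply: hx; apply: leq_trans rs st.
Qed.

Lemma newsS t0 t x : t0 <= t -> news t0 t.+1 x = news t0 t x + fresh x t.
Proof. by move=> t0t; rewrite /news big_nat_recr. Qed.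

Lemma news_cat t0 t1 t2 x : t0 <= t1 -> t1 <= t2 -> news t0 t2 x = news t0 t1 x + news t1 t2 x.
Proof. by move=> a c; rewrite /news (@big_cat_nat _ _ _ t1). Qed.

Lemma leq_news t0 t t' x : t <= t' -> news t0 t x <= news t0 t' x.
Proof.
move=> tt'; have [t0t|/ltnW tt0] := leqP t0 t; first by rewrite (news_cat _ t0t tt') leq_addr.
by rewrite /news big_geq.
Qed.

Lemma known_in_progression x t : noret x t -> forall r, r < t -> known x r ->
  exists s, [/\ s < r, s = r %[mod M] & fresh x s].
Proof.
move=> nr; elim/ltn_ind=> r IH rt /knownP[s [sr es cs]].
have [ks|nk] := boolP (known x s); last by exists s; split=> //; rewrite /fresh cs nk.
have [q [qs eq_ fq]] := IH s sr (ltn_trans sr rt) ks.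
by exists q; split=> //; [exact: ltn_trans sr | rewrite eq_].
Qed.

Lemma count_period s t0 : \sum_(t0 <= r < t0 + M) (r == s %[mod M] : nat) = 1.
Proof.
elim: t0 => [|t0 IH].
  rewrite add0n big_mkord (bigD1 (Ordinal (ltn_pmod s M_gt0))) //= modn_mod eqxx big1 // => r nr.
  rewrite modn_small //; case: eqP => // e; case/eqP: nr; exact: val_inj.
have := IH; rewrite big_ltn; last by rewrite -[X in X < _]addn0 ltn_add2l.
rewrite addSn big_nat_recr /=; last by rewrite -[X in X < _]addn0 ltn_add2l.
by rewrite modnDr addnC.
Qed.

Lemma count_progression s t0 w : \sum_(t0 <= r < t0 + w * M) (r == s %[mod M] : nat) = w.
Proof.
elim: w => [|w IH]; first by rewrite mul0n addn0 big_geq.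
rewrite (@big_cat_nat _ _ _ (t0 + w * M)) ?leq_addr //=; last first.
  by rewrite leq_add2l leq_mul2r leqnSn orbT.
by rewrite IH mulSn [M + _]addnC addnA count_period addn1.
Qed.

(* Every crossed slot is met once per period. *)
Lemma count_known x t0 w : noret x (t0 + w * M) ->
  \sum_(t0 <= r < t0 + w * M) (known x r : nat) <= w * news 0 (t0 + w * M) x.
Proof.
move=> nr; set t := t0 + w * M in nr *.
have -> : w * news 0 t x = \sum_(0 <= s < t) \sum_(t0 <= r < t) (fresh x s * (r == s %[mod M])).
  rewrite /news big_distrr /=; apply: eq_bigr => s _.
  by rewrite -big_distrr /= count_progression mulnC.
rewrite exchange_big /= big_nat_cond [X in _ <= X]big_nat_cond; apply: leq_sum => r /andP[/andP[_ rt] _].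
have [/(known_in_progression nr rt)[s [sr es fs]]|//] := boolP (known x r).
have st : s < t by apply: ltn_trans rt.
by rewrite big_mkord (bigD1 (Ordinal st)) //= fs es eqxx.
Qed.

Section Traj.
Variables (v : V) (e : env) (e_in : e \in envs).
Let x := walk v e.

Lemma known_seen t : noret x t.+1 -> known x t -> x t.+1 \in before x t.+1.
Proof.
move=> nr /knownP[s [st es cs]].
have [ct|] := boolP (crossed x t); last first.
  by rewrite negbK => /eqP ->; apply/beforeP; exists t.
have nst : x s != x t.
  apply: (noret_neq nr) => //; first exact: ltnW.
  by move=> e1; rewrite e1 ltnn in st.
have [_ xq] := cross_back e_in es cs ct nst; have -> : x t.+1 = x s := xq.
by apply/beforeP; exists s => //; apply: ltnW.
Qed.

Lemma unseen_fresh t : noret x t.+1 -> x t.+1 \notin before x t.+1 -> fresh x t.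
Proof.
move=> nr ns; rewrite /fresh; apply/andP; split.
  by apply: contra ns => /eqP ->; apply/beforeP; exists t.
by apply: contra ns; apply: known_seen.
Qed.

Lemma beforeS t : before x t.+1 = x t |: before x t.
Proof.
apply/setP=> y; rewrite !inE; apply/beforeP/orP => [[s]|[/eqP->|/beforeP[s st ->]]].
- rewrite ltnS leq_eqVlt => /orP[/eqP->|st] ->; [by left; rewrite eqxx|right].
  by apply/beforeP; exists s.
- by exists t.
- by exists s => //; apply: leqW.
Qed.

Lemma card_before t0 t : t0 <= t -> noret x t -> #|before x t.+1| <= #|before x t0.+1| + news t0 t x.
Proof.
elim: t => [|t IH]; first by rewrite leqn0 => /eqP->; rewrite leq_addr.
rewrite leq_eqVlt => /orP[/eqP->|t0t] nr; first by rewrite leq_addr.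
rewrite beforeS cardsU1 newsS // addnA addnC leq_add //.
  exact: IH (noretW (leqnSn t) nr).
by case: (boolP (x t.+1 \in _)) => // ns; rewrite (unseen_fresh nr ns).
Qed.

Lemma card_discovered t0 t : t0 <= t -> noret x t ->
  #|discovered x t0.+1 t| <= news t0 t x.
Proof.
move=> t0t nr; rewrite /discovered cardsD (setIidPr (before_mono _ _)) ?ltnS //.
by rewrite leq_subLR card_before.
Qed.

End Traj.
End Windows.

(** * Localization of the walk *)

Local Open Scope ring_scope.

Lemma one_le_sum4 (R : realType) (a c d f : R) : 0 <= a -> 0 <= c -> 0 <= d -> 0 <= f ->
  [\/ 1 <= a, 1 <= c, 1 <= d | 1 <= f] -> 1 <= a + c + d + f.
Proof. by move=> a0 c0 d0 f0 []; lra. Qed.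

Lemma ltn2_nmarks n (mark : nat -> (nat -> hamming_vertex n) -> bool) t0 t x s s' :
  (t0 <= s -> s < t -> t0 <= s' -> s' < t -> s <> s' ->
  mark s x -> mark s' x -> 2 <= nmarks mark t0 t x)%N.
Proof.
move=> a c a' c' /eqP ne ms ms'; rewrite /nmarks (bigD1_seq s) ?iota_uniq ?mem_index_iota ?a //=.
rewrite ms -big_filter (bigD1_seq s') ?filter_uniq ?iota_uniq //=; last first.
  by rewrite mem_filter mem_index_iota a' eq_sym ne.
by rewrite ms' addnA leq_addr.
Qed.

Section TwoMarks.
Variables (R : realType) (n M : nat) (M_gt0 : (0 < M)%N).
Local Notation V := (hamming_vertex n).
Local Notation walk := (@walk n M M_gt0).
Local Notation moves := (@moves n M M_gt0).
Local Notation envs := (envs n M).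

(** This is [chernoff] at [z = p^-1], where [p] bounds the expected number of marks. The cases
    [1 < p], where the bound is trivial, and [p = 0], where [z = 2] already shows that marks have no
    weight, are treated apart. *)
Lemma two_marks v (mark : nat -> (nat -> V) -> bool) t0 t (G : (nat -> V) -> R) (r : R) : (t0 <= t)%N ->
  (forall s, adapted s.+1 (mark s)) -> adapted t0 G -> (forall x, 0 <= G x) -> 0 <= r ->
  (forall e s, e \in envs -> (t0 <= s)%N -> (s < t)%N -> let x := walk v e in
     \sum_(f in moves x s) (mark s (extend x s (edge_swap f (x s))))%:R
       <= r * #|moves x s|%:R) ->
  \sum_(e in envs) G (walk v e) * (2 <= nmarks mark t0 t (walk v e))%:R <=
  expR 1 * (r * (t - t0)%:R) ^+ 2 * \sum_(e in envs) G (walk v e).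
Proof.
move=> t0t am aG G0 r0 hm; set p := r * _; set SG := \sum_(e in envs) G _.
have SG0 : 0 <= SG by apply: sumr_ge0.
have p0 : 0 <= p by rewrite mulr_ge0.
have [p1|p1] := ltP 1 p.
  apply: le_trans (_ : SG <= _).
    by apply: ler_sum => e _; case: (2 <= _)%N; rewrite ?mulr1n ?mulr1 // mulr0.
  rewrite -[X in X <= _]mul1r ler_wpM2r // -[X in X <= _]mulr1 ler_pM //.
    by rewrite (le_trans _ (expR_ge1Dx _)) // lerDl.
  by rewrite exprn_ege1 // ltW.
have [p00|p00] := eqVneq p 0.
  have := chernoff t0t am aG G0 (z := 2) _ r0 hm; rewrite -/SG => /(_ ltac:(by rewrite ler1n)).
  have -> : (1 + (2 - 1) * r) ^+ (t - t0) = 1.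
    move/eqP: p00; rewrite mulf_eq0 => /orP[/eqP->|]; first by rewrite mulr0 addr0 expr1n.
    by rewrite pnatr_eq0 => /eqP->; rewrite expr0.
  rewrite mul1r p00 expr0n /= mulr0 mul0r -subr_le0 -sumrB => {hm}hm; apply: le_trans hm.
  apply: ler_sum => e _; rewrite -[X in _ <= _ - X]mulr1 -mulrBr ler_wpM2l // lerBrDr.
  case: (leqP 2 _) => [n2|_]; last by rewrite add0r exprn_ege1 // ler1n.
  apply: le_trans (_ : 2 ^+ 2 <= _); last by apply: ler_weXn2l => //; rewrite ler1n.
  by rewrite expr2 mulr1n; lra.
have pp : 0 < p by rewrite lt_neqAle eq_sym p00.
have z1 : 1 <= p^-1 by rewrite invf_ge1.
have := chernoff t0t am aG G0 z1 r0 hm; rewrite -/SG => ch.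
have zp : 0 <= p ^+ 2 by rewrite exprn_ge0.
apply: le_trans (_ : p ^+ 2 * ((1 + (p^-1 - 1) * r) ^+ (t - t0) * SG) <= _); last first.
  have -> : expR 1 * p ^+ 2 * SG = p ^+ 2 * (expR 1 * SG) by ring.
  rewrite ler_wpM2l // ler_wpM2r //.
  apply: le_trans (_ : expR ((p^-1 - 1) * r) ^+ (t - t0) <= _).
    apply: lerXn2r; rewrite ?nnegrE ?expR_ge0 ?expR_ge1Dx //.
    by rewrite addr_ge0 // mulr_ge0 // subr_ge0.
  rewrite -expRM_natr ler_expR -mulrA -/p.
  by rewrite mulrBl mulVf // mul1r gerBl.
apply: le_trans (ler_wpM2l zp ch).
rewrite mulr_sumr; apply: ler_sum => e _; rewrite mulrCA ler_wpM2l //.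
case: (leqP 2 _) => [n2|_]; last by rewrite mulr_ge0 // exprn_ge0 // invr_ge0.
rewrite -[X in X%:R <= _]/(1%N) -ler_pdivrMl ?exprn_gt0 // mulr1 -exprVn.
by apply: ler_weXn2l.
Qed.

Lemma marks_rate v e s (mark : (nat -> V) -> bool) (B : {set V}) (c : nat) (a : R) : e \in envs ->
  let x := walk v e in
  0 < a -> a <= #|hamming_edges n|%:R - (n.-1.*2 * (s %/ M))%:R ->
  (forall y, mark (extend x s y) ->
     [/\ fresh M (extend x s y) s, noret M x s.+1, hamming_adj (x s) y & y \in B]) ->
  (#|[set y in B | hamming_adj (x s) y]%SET| <= c)%N ->
  \sum_(f in moves x s) (mark (extend x s (edge_swap f (x s))))%:R <= c%:R / a * #|moves x s|%:R.
Proof.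
move=> eE x a0 aE hm Bc.
have [kn|nk] := boolP (known M x s).
  rewrite big1 => [|f _]; first by rewrite mulr_ge0 // divr_ge0 // ltW.
  case: (boolP (mark _)) => // /hm[].
  by rewrite /fresh known_extend kn andbF.
apply: le_trans (sum_marks R hm) _; apply: le_trans (_ : c%:R <= _); first by rewrite ler_nat.
rewrite mulrAC ler_pdivlMr // ler_wpM2l //; apply: le_trans aE _.
by rewrite lerBlDr -natrD ler_nat; apply: card_moves.
Qed.

End TwoMarks.

Section Admissible.
Variables (n M : nat) (M_gt0 : (0 < M)%N) (h L B : nat).
Local Open Scope nat_scope.
Local Open Scope set_scope.
Local Notation V := (hamming_vertex n).
Local Notation E := (hamming_edges n).
Local Notation noret := (@noret n M).
Local Notation thin := (@thin n h).
Local Notation news := (@news n M).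
Implicit Types (x : nat -> V) (s t r : nat) (y : V).

(** The bound [B] on the fresh crossings of a window limits both the known steps and the vertices on
    which a collision can occur; [minn] cuts the windows that reach beyond [t]. *)
Definition admissible x t :=
  [&& noret x t, thin x t & [forall s : 'I_t, news s (minn t (s + L)) x <= B]].

Lemma thin_mono x t t' : t <= t' -> thin x t' -> thin x t.
Proof.
move=> tt' /forallP H; apply/forallP=> d; apply/forallP=> c.
have /forallP/(_ c) := H d; apply: leq_trans; apply/subset_leq_card/setSI/before_mono.
by rewrite ltnS.
Qed.

Lemma admissible_mono x t t' : t <= t' -> admissible x t' -> admissible x t.
Proof.
move=> tt' /and3P[nr th /forallP H]; apply/and3P; split.
- exact: noretW tt' nr.
- exact: thin_mono tt' th.
apply/forallP=> s; have st' : s < t' := leq_trans (ltn_ord s) tt'.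
apply: leq_trans (H (Ordinal st')); apply: leq_news.
by rewrite leq_min geq_minr geq_min tt'.
Qed.

Lemma adapted_admissible t : adapted t (admissible^~ t).
Proof.
move=> x x' hx; rewrite /admissible.
have -> : noret x t = noret x' t.
  by case: t hx => [|t] hx; [apply: eq_forallb => -[]|apply: adapted_noret => s /leqW/hx].
have -> : thin x t = thin x' t.
  by apply: eq_forallb => d; apply: eq_forallb => c; rewrite (adapted_before hx).
congr [&& _, _ & _]; apply: eq_forallb => s; congr (_ <= _).
apply: adapted_news => r rs; apply: hx; apply: leq_trans rs _.
by rewrite geq_minl.
Qed.

Lemma admissible_news x t s k : admissible x t -> s <= t -> t <= s + k * L -> news s t x <= k * B.
Proof.
move=> /and3P[_ _ /forallP H]; elim: k s => [|k IH] s st.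
  by rewrite mul0n addn0 => ts; rewrite /news big_geq.
move: st; rewrite leq_eqVlt => /orP[/eqP-> _|st]; first by rewrite /news big_geq.
rewrite mulSn addnA mulSn => ts; have := H (Ordinal st) => /= Hs.
have [le|/ltnW le] := leqP t (s + L).
  by move: Hs; rewrite (minn_idPl le) => /leq_trans; apply; rewrite leq_addr.
rewrite (@news_cat _ _ _ (s + L)) ?leq_addr // leq_add ?IH //.
by move: Hs; rewrite (minn_idPr le).
Qed.

End Admissible.

Section Localization.
Variables (R : realType) (n M : nat) (M_gt0 : (0 < M)%N).
Local Open Scope ring_scope.
Local Open Scope set_scope.
Local Notation V := (hamming_vertex n).
Local Notation E := (hamming_edges n).
Local Notation env := {ffun 'I_M -> {set V}}.
Local Notation noret := (@noret n M).
Local Notation known := (@known n M).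
Local Notation fresh := (@fresh n M).
Local Notation news := (@news n M).
Local Notation collides := (@collides n M).
Local Notation walk := (@walk n M M_gt0).
Local Notation moves := (@moves n M M_gt0).
Local Notation envs := (envs n M).
Implicit Types (x : nat -> V) (e : env) (s t r : nat) (y : V) (d : bool).

Variables (gamma phi delta b S : R) (h : nat).
Hypotheses (phi_gt0 : 0 < phi) (phi_lt1 : phi < 1) (gamma_gt0 : 0 < gamma)
  (delta_gt0 : 0 < delta) (b_gt0 : 0 < b) (S_ge0 : 0 <= S).
Hypothesis bE : b * #|E|%:R <= M%:R * (n.-1%:R - h%:R).
Hypothesis SE : 4 * h%:R * M%:R <= S * #|E|%:R.
Hypothesis bent_cond : delta + gamma <= 2 * b * (1 - expR (- gamma)).
Hypothesis old_cond : delta <= 2 * b * phi.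
Hypothesis straight_cond : phi + delta + S * phi <= b * (1 - phi - expR (- gamma)).
Hypothesis known_cond : phi <= (1 - phi) * gamma.

Variables (W1 W2 B k : nat).
Local Notation W := (W1 + W2)%N.
Local Notation ok := (@admissible n M h (W * M) B).
Hypothesis few_news : (gamma + delta) * (k * B)%:R <= delta / 2 * M%:R.

(** A fresh crossing creates at most one known step per period. There are at most [k * B] of them,
    and [few_news] keeps the resulting loss below half of the drift. *)
Lemma gain_ge x t0 w : ok x (t0 + w * M) -> (t0 + w * M <= k * (W * M))%N ->
  delta * w%:R / 2 <= gain M gamma delta t0 x (t0 + w * M).
Proof.
move=> okt tk; set t := (t0 + w * M)%N in okt tk *.
have M0 : 0 < M%:R :> R by rewrite ltr0n.
have nr : noret x t by case/and3P: okt.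
have nw : (news 0 t x <= k * B)%N by apply: (admissible_news okt).
have ck : (\sum_(t0 <= r < t) (known x r : nat) <= w * (k * B))%N.
  apply: leq_trans (count_known M_gt0 (w := w) nr) _.
  by rewrite leq_mul2l nw orbT.
have -> : gain M gamma delta t0 x t =
    (t - t0)%:R * (delta / M%:R) - (gamma + delta) / M%:R * (\sum_(t0 <= r < t) (known x r : nat))%:R.
  have -> : (t - t0)%:R * (delta / M%:R) = \sum_(t0 <= r < t) (delta / M%:R).
    by rewrite sumr_const_nat mulr_natl.
  rewrite natr_sum mulr_sumr -sumrB /gain.
  apply: eq_bigr => r _; case: (known x r); rewrite ?mulr1 ?mulr0 ?subr0 //.
  by field; rewrite gt_eqF.
have -> : (t - t0)%:R * (delta / M%:R) = delta * w%:R.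
  by rewrite /t addKn natrM; field; rewrite gt_eqF.
have h1 : (gamma + delta) / M%:R * (\sum_(t0 <= r < t) (known x r : nat))%:R <= w%:R * (delta / 2).
  apply: le_trans (_ : (gamma + delta) / M%:R * (w * (k * B))%:R <= _).
    by rewrite ler_wpM2l ?ler_nat // divr_ge0 // ltW // addr_gt0.
  rewrite natrM mulrCA ler_wpM2l //.
  by rewrite mulrAC ler_pdivrMr.
apply: le_trans (_ : delta * w%:R - w%:R * (delta / 2) <= _); last by rewrite lerD2l lerN2.
by rewrite le_eqVlt; apply/orP; left; apply/eqP; field.
Qed.

Section Cover.
Variables (v : V) (e : env) (e_in : e \in envs) (t0 : nat).
Let x := walk v e.
Let t1 := (t0 + W1 * M)%N.
Let t := (t0 + W * M)%N.
Hypothesis tk : (t <= k * (W * M))%N.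

Let mark s x := [&& collides t0.+1 s x, ok x s, noret x s.+1 & hamming_adj (x s) (x s.+1)].

Let t01 : (t0 <= t1)%N. Proof. exact: leq_addr. Qed.
Let tE : t = (t1 + W2 * M)%N. Proof. by rewrite /t /t1 mulnDl addnA. Qed.
Let t1t : (t1 <= t)%N. Proof. by rewrite tE leq_addr. Qed.

(** With at most one collision, either the last [W2] periods are free of collisions, or the
    collision lies there and the first [W1] are free. Without a bend, every bent vertex found in the
    free part is complete at [t]. In the second case the phases unexplored at [t1] were all used up
    during the last [W2 * M] steps. Either way [remaining] is small while [gain] is large. *)
Lemma cover : ok x t ->
  [|| [exists s : 'I_t, exists r : 'I_t, [&& (t0 <= s)%N, (t0 <= r)%N & bend M x t s r]],
      (2 <= nmarks mark t0 t x)%N,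
      [&& clear M h t1.+1 t1 x t, remaining R M t1.+1 t1 x t <= 0 * M%:R &
          delta * W2%:R / 2 <= gain M gamma delta t1 x t] |
      [&& clear M h t0.+1 t0 x t1, remaining R M t0.+1 t0 x t1 <= W2%:R * M%:R &
          delta * W1%:R / 2 <= gain M gamma delta t0 x t1]].
Proof.
move=> okt; have /and3P[nr th _] := okt.
case: (boolP [exists s : 'I_t, _]) => [//|/existsPn nb]; rewrite orFb.
have {}nb u s r : (t0 <= u)%N -> (u <= s)%N -> (s < t)%N -> ~~ bend M x t s r.
  move=> tu us st; apply/negP=> bd; have /and3P[sr rt _] := bd.
  have /existsPn/(_ (Ordinal rt)) := nb (Ordinal st); rewrite bd /= andbT.
  by rewrite (leq_trans tu us) (leq_trans (leq_trans tu us) (ltnW sr)).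
have okM s : (s < t)%N -> collides t0.+1 s x -> mark s x.
  move=> st cs; rewrite /mark cs (admissible_mono (ltnW st) okt) (noretW st nr) /=.
  by apply: crossed_adj => //; case/andP: cs => /andP[].
have g1 : delta * W1%:R / 2 <= gain M gamma delta t0 x t1.
  apply: gain_ge; first exact: admissible_mono okt.
  exact: leq_trans t1t tk.
have g2 : delta * W2%:R / 2 <= gain M gamma delta t1 x t.
  by move: okt tk; rewrite tE; apply: gain_ge.
case: (boolP (2 <= _)%N) => [//|few]; rewrite orFb g1 g2 !andbT.
have uniq_ s s' : (t0 <= s)%N -> (s < t)%N -> (t0 <= s')%N -> (s' < t)%N ->
    collides t0.+1 s x -> collides t0.+1 s' x -> s = s'.
  move=> a c a' c' cs cs'; apply/eqP; apply: contraNT few => /eqP ne.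
  exact: (ltn2_nmarks a c a' c' ne (okM _ c cs) (okM _ c' cs')).
have [/forallP nc|/forallPn[s]] :=
    boolP [forall s : 'I_t, (t1 <= s)%N ==> ~~ collides t1.+1 s x].
  apply/orP; left.
  have cl : clear M h t1.+1 t1 x t by apply/and3P; split=> //; apply/forallP.
  rewrite cl /= mul0r leNgt; apply/negP=> rem.
  have [y yb yM] : exists2 y, y \in bent (labels x t1.+1 t1 (t - t1)) & (visits x t y < M)%N.
    move: rem; rewrite /remaining => rem.
    apply/exists_inP; apply: contraLR rem => /exists_inPn H.
    rewrite -leNgt; apply: sumr_le0 => y yb.
    by rewrite subr_le0 ler_nat leqNgt H.
  have [||s [r [ts st]]] := bent_bend e_in nr _ _ yb yM; first by rewrite subnKC.
    by rewrite subnKC //; apply: (clear_no_collisions (or_introl erefl) cl).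
  by apply/negP; apply: (nb t1).
rewrite negb_imply negbK => /andP[t1s cs]; apply/orP; right.
have t0s : (t0 <= s)%N by apply: leq_trans t1s.
have cs0 : collides t0.+1 s x.
  case/andP: cs => fs xs; rewrite /collides fs /=; move: xs; apply/subsetP.
  by apply: setDS; apply: before_mono; rewrite ltnS.
have cl : clear M h t0.+1 t0 x t1.
  apply/and3P; split; [exact: noretW nr|exact: thin_mono th|].
  apply/forallP=> s'; apply/implyP=> ts'; apply/negP=> cs'.
  have s't : (s' < t)%N by apply: leq_trans t1t.
  have es := uniq_ _ _ t0s (ltn_ord s) ts' s't cs0 cs'.
  by have := ltn_ord s'; rewrite -es ltnNge t1s.
rewrite cl /= leNgt; apply/negP=> rem.
have nc s' r : (s' < t)%N -> fresh x s' -> (t0.+1 <= r)%N -> (r <= t1)%N ->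
    first x r -> x r = x s'.+1 -> r = s'.+1.
  apply: (no_collisions (or_introl erefl)) => {}s' ts' s't fs'; apply/negP=> xs'.
  have cs' : collides t0.+1 s' x.
    rewrite /collides fs' /=; move: xs'; apply/subsetP/discovered_mono; exact: geq_minl.
  have es := uniq_ _ _ t0s (ltn_ord s) ts' s't cs0 cs'.
  move: xs'; rewrite -es (minn_idPr t1s) => /setDP[xs' _].
  by case/andP: cs => _ /setDP[_]; rewrite xs'.
have [y yb yM] : exists2 y, y \in bent (labels x t0.+1 t0 (t1 - t0)) & (visits x t y < M)%N.
  apply/exists_inP; apply: contraLR rem => /exists_inPn H.
  rewrite -leNgt /remaining; set Bn := bent _ in H *.
  apply: le_trans (_ : \sum_(y in Bn) (visits x t y - visits x t1 y)%:R <= _).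
    apply: ler_sum => y yb; rewrite natrB ?leq_visits // lerD2r ler_nat leqNgt H //.
  rewrite -natr_sum -natrM ler_nat.
  have -> : (W2 * M = t - t1)%N by rewrite tE addKn.
  have vs u : (\sum_(y in Bn) visits x (t1 + u) y <= \sum_(y in Bn) visits x t1 y + u)%N.
    elim: u => [|u IH]; first by rewrite !addn0.
    rewrite addnS; under eq_bigr => y _ do rewrite visitsS.
    rewrite big_split /= addnS -addn1 leq_add //.
    by rewrite -big_mkcondr /= sum1_card; apply: leq_trans (_ : #|[set x (t1 + u)%N]| <= _)%N;
      [apply: subset_leq_card; apply/subsetP=> y; rewrite !inE unfold_in => /andP[_ /eqP<-]|rewrite cards1].
  have := vs (t - t1)%N; rewrite subnKC // => {}vs.
  rewrite sumnB => [|y _]; last exact: leq_visits.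
  by rewrite leq_subLR.
have [||s' [r [ts st]]] := bent_bend e_in nr _ _ yb yM.
- by rewrite subnKC.
- by rewrite subnKC.
by apply/negP; apply: (nb t0).
Qed.

End Cover.

(** One term per case of [cover]: a bend with prescribed endpoint, summed over its two times and its
    level; two collisions; the two tails of the supermartingale. The last is small only if [W1] is a
    large multiple of [W2]. *)
Definition locality (a : R) : R := 2 * (W * M)%:R ^+ 2 * a ^- 2 +
  expR 1 * (B%:R / a * (W * M)%:R) ^+ 2 +
  (1 - phi)^-1 * (expR (- (delta * W2%:R / 2)) + expR (gamma * W2%:R - delta * W1%:R / 2)).

Lemma localization v t0 z (G : (nat -> V) -> R) (a : R) :
  adapted t0 G -> (forall x, 0 <= G x) -> 0 < a ->
  let t := (t0 + W * M)%N in (t <= k * (W * M))%N ->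
  a <= #|E|%:R - (n.-1.*2 * (t %/ M))%:R -> (n.-1.*2 * (t %/ M) * 2 <= #|E|)%N ->
  \sum_(e in envs) G (walk v e) * (ok (walk v e) t && (walk v e t == z))%:R
    <= locality a * \sum_(e in envs) G (walk v e).
Proof.
move=> aG G0 a0 t tk aE EA; set SG := \sum_(e in envs) G (walk v e).
pose t1 := (t0 + W1 * M)%N.
have tE : t = (t1 + W2 * M)%N by rewrite /t /t1 mulnDl addnA.
have t01 : (t0 <= t1)%N by apply: leq_addr.
have t1t : (t1 <= t)%N by rewrite tE leq_addr.
have t0t : (t0 <= t)%N by apply: leq_addr.
pose mark s x := [&& collides t0.+1 s x, ok x s, noret x s.+1 & hamming_adj (x s) (x s.+1)].
pose Qb e := \sum_(t0 <= s < t) \sum_(t0 <= r < t) \sum_(c : bool)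
  [&& bend M (walk v e) t s r, level (walk v e) s == c & walk v e t == z]%:R : R.
pose Q2 e := (2 <= nmarks mark t0 t (walk v e))%N.
pose Q3 e := let x := walk v e in [&& clear M h t1.+1 t1 x t, remaining R M t1.+1 t1 x t <= 0 * M%:R &
          delta * W2%:R / 2 <= gain M gamma delta t1 x t].
pose Q4 e := let x := walk v e in [&& clear M h t0.+1 t0 x t1, remaining R M t0.+1 t0 x t1 <= W2%:R * M%:R &
          delta * W1%:R / 2 <= gain M gamma delta t0 x t1].
have SG0 : 0 <= SG by apply: sumr_ge0.
have Qb0 e : 0 <= Qb e by do 3 ![apply: sumr_ge0 => ? _].
apply: le_trans (_ : \sum_(e in envs) G (walk v e) * (Qb e + (Q2 e)%:R + (Q3 e)%:R + (Q4 e)%:R) <= _).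
  apply: ler_sum => e eE; rewrite ler_wpM2l //.
  case: (boolP (_ && _)) => [/andP[okt /eqP zt]|_]; last by rewrite !addr_ge0.
  apply: one_le_sum4 => //; case/or4P: (cover eE tk okt) => [|H|H|H].
  - case/existsP=> s /existsP[r /and3P[ts tr bd]]; apply: Or41.
    rewrite /Qb (bigD1_seq (s : nat)) ?iota_uniq ?mem_index_iota ?ts ?ltn_ord //=.
    rewrite (bigD1_seq (r : nat)) ?iota_uniq ?mem_index_iota ?tr ?ltn_ord //=.
    rewrite (bigD1 (level (walk v e) s)) //= bd zt !eqxx -!addrA lerDl.
    by rewrite !addr_ge0 //; do ?[apply: sumr_ge0 => ? _].
  - by apply: Or42; rewrite /Q2 H.
  - by apply: Or43; rewrite /Q3 H.
  - by apply: Or44; rewrite /Q4 H.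
have -> : \sum_(e in envs) G (walk v e) * (Qb e + (Q2 e)%:R + (Q3 e)%:R + (Q4 e)%:R) =
    \sum_(e in envs) G (walk v e) * Qb e + \sum_(e in envs) G (walk v e) * (Q2 e)%:R +
    \sum_(e in envs) G (walk v e) * (Q3 e)%:R + \sum_(e in envs) G (walk v e) * (Q4 e)%:R.
  by rewrite -!big_split /=; apply: eq_bigr => e _; rewrite !mulrDr.
have tW : (t - t0 = W * M)%N by rewrite /t addKn.
have bs : \sum_(e in envs) G (walk v e) * Qb e <= 2 * (W * M)%:R ^+ 2 * a ^- 2 * SG.
  have -> : \sum_(e in envs) G (walk v e) * Qb e = \sum_(t0 <= s < t) \sum_(t0 <= r < t) \sum_(c : bool)
      \sum_(e in envs) G (walk v e) *
       [&& bend M (walk v e) t s r, level (walk v e) s == c & walk v e t == z]%:R.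
    under eq_bigr => e _ do rewrite mulr_sumr.
    rewrite exchange_big /=; apply: eq_bigr => s _.
    under eq_bigr => e _ do rewrite mulr_sumr.
    rewrite exchange_big /=; apply: eq_bigr => r _.
    under eq_bigr => e _ do rewrite mulr_sumr.
    by rewrite exchange_big.
  apply: le_trans (_ : \sum_(t0 <= s < t) \sum_(t0 <= r < t) \sum_(c : bool) a ^- 2 * SG <= _).
    rewrite big_nat_cond [X in _ <= X]big_nat_cond.
    apply: ler_sum => s /andP[/andP[ts _] _]; apply: ler_sum => r _; apply: ler_sum => c _.
    exact: (bend_sum M_gt0 v r c z ts aG G0 a0 aE).
  rewrite big_bool /= !sumr_const_nat tW; set c := a ^- 2 * SG.
  rewrite -[X in X <= _]mulr_natl -[X in _ * X]mulr_natl.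
  have -> : 2 * (W * M)%:R ^+ 2 * a ^- 2 * SG = (W * M)%:R * ((W * M)%:R * (c + c)) by rewrite /c; ring.
  exact: lexx.
have mk : \sum_(e in envs) G (walk v e) * (Q2 e)%:R <=
    expR 1 * (B%:R / a * (W * M)%:R) ^+ 2 * SG.
  rewrite -tW; apply: two_marks => //.
  - move=> s x x' hx; rewrite /mark.
    have h0 r : (r <= s)%N -> x r = x' r by move=> rs; apply: hx; apply: leqW.
    have -> : ok x s = ok x' s by apply: adapted_admissible.
    have -> : noret x s.+1 = noret x' s.+1 by apply: adapted_noret.
    rewrite /collides (@adapted_fresh _ _ s x x') // !hx //.
    congr [&& _ && (_ \in pred_of_set _), _, _ & _]; case: (leqP t0 s) => [t0s|st0].
      rewrite /discovered (adapted_before h0) (adapted_before (t := t0) (x' := x')) // => r rt.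
      by apply: h0; apply: leq_trans t0s.
    have D X : discovered X t0.+1 s = set0 by apply/eqP; rewrite setD_eq0 before_mono // leqW.
    by rewrite !D.
  - by rewrite divr_ge0 // ltW.
  - move=> e s eE ts st; cbv zeta; set x := walk v e.
    have sx y r : (r <= s)%N -> x r = extend x s y r by move=> rs; rewrite extend_le.
    have aEs : a <= #|E|%:R - (n.-1.*2 * (s %/ M))%:R.
      apply: le_trans aE _; rewrite lerD2l lerN2 ler_nat leq_mul2l leq_div2r ?orbT //.
      exact: ltnW.
    have mkE y : mark s (extend x s y) -> [/\ fresh (extend x s y) s, noret x s.+1, hamming_adj (x s) y &
        y \in [set y in discovered x t0.+1 s | ok x s]].
      case/and4P=> /andP[fy dy] oky nry ady; move: dy; rewrite extendE => dy.
      have nrE : noret x s.+1 = noret (extend x s y) s.+1 by apply: adapted_noret; exact: sx.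
      have okE : ok x s = ok (extend x s y) s by apply: adapted_admissible; exact: sx.
      have nE : discovered x t0.+1 s = discovered (extend x s y) t0.+1 s.
        rewrite /discovered (adapted_before (sx y)); congr (_ :\: _).
        by apply: adapted_before => r rt; apply: sx; apply: leq_trans ts.
      split=> //; first by rewrite nrE.
        by move: ady; rewrite extendE extend_le.
      by apply/setIdP; rewrite nE okE.
    apply: (marks_rate eE a0 aEs mkE); case: (boolP (ok x s)) => [okx|nok].
      apply: leq_trans (_ : #|discovered x t0.+1 s| <= _)%N.
        by apply: subset_leq_card; apply/subsetP=> y /setIdP[/setIdP[]].
      case/and3P: (okx) => nr _ _; apply: leq_trans (card_discovered eE ts nr) _.
      by rewrite -[B]mul1n (admissible_news okx) // mul1n; exact: ltnW.
    rewrite (_ : [set y in _ | _] = set0) ?cards0 //; apply/setP=> y.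
    by rewrite [RHS]in_set0; apply/setIdP=> -[/setIdP[]].
have c3 : \sum_(e in envs) G (walk v e) * (Q3 e)%:R <=
    (1 - phi)^-1 * expR (- (delta * W2%:R / 2)) * SG.
  have := clear_tail M_gt0 (or_introl (erefl t1.+1)) phi_gt0 phi_lt1 gamma_gt0 delta_gt0 b_gt0 S_ge0 bE SE
    bent_cond old_cond straight_cond known_cond v 0 (delta * W2%:R / 2) t1t (adaptedW t01 aG) G0 EA.
  by rewrite /= mulr0 sub0r mulr1.
have c4 : \sum_(e in envs) G (walk v e) * (Q4 e)%:R <=
    (1 - phi)^-1 * expR (gamma * W2%:R - delta * W1%:R / 2) * SG.
  have EA1 : (n.-1.*2 * (t1 %/ M) * 2 <= #|E|)%N.
    by apply: leq_trans EA; rewrite leq_mul2r leq_mul2l leq_div2r ?orbT.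
  have := clear_tail M_gt0 (or_introl (erefl t0.+1)) phi_gt0 phi_lt1 gamma_gt0 delta_gt0 b_gt0 S_ge0 bE SE
    bent_cond old_cond straight_cond known_cond v W2%:R (delta * W1%:R / 2) t01 aG G0 EA1.
  by rewrite /= mulr1.
apply: le_trans (lerD (lerD (lerD bs mk) c3) c4) _.
by rewrite -!mulrDl ler_wpM2r // /locality mulrDr !addrA.
Qed.

End Localization.

(** * Orbits which do not close early hardly close later *)

Local Open Scope ring_scope.

Section DelayedChernoff.
Variables (R : realType) (n M : nat) (M_gt0 : (0 < M)%N).
Local Open Scope set_scope.
Local Notation V := (hamming_vertex n).
Local Notation walk := (@walk n M M_gt0).
Local Notation envs := (envs n M).

Lemma nmarks_recr (mark : nat -> (nat -> V) -> bool) t0 t x : (t0 <= t)%N ->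
  nmarks mark t0 t.+1 x = (nmarks mark t0 t x + mark t x)%N.
Proof. by move=> t0t; rewrite /nmarks big_nat_recr. Qed.

Lemma leq_nmarks (mark : nat -> (nat -> V) -> bool) t0 t t' x :
  (t <= t')%N -> (nmarks mark t0 t x <= nmarks mark t0 t' x)%N.
Proof.
move=> tt'; rewrite /nmarks; have [t0t|/ltnW tt0] := leqP t0 t; last by rewrite big_geq.
by rewrite (@big_cat_nat _ _ _ t _ t') //= leq_addr.
Qed.

Lemma nmarks_news (mark : nat -> (nat -> V) -> bool) t0 t x : (forall s, mark s x -> fresh M x s) ->
  (nmarks mark t0 t x <= news M t0 t x)%N.
Proof. by move=> h; apply: leq_sum => s _; case: (boolP (mark s x)) => // /h ->. Qed.

Lemma markov v (f : (nat -> V) -> nat) (j : nat) (z m : R) : 1 <= z ->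
  \sum_(e in envs) z ^+ f (walk v e) <= m * #|envs|%:R ->
  \sum_(e in envs) (j <= f (walk v e))%N%:R <= z ^- j * m * #|envs|%:R.
Proof.
move=> z1 h; have z0 : 0 < z by rewrite (lt_le_trans _ z1).
rewrite -mulrA ler_pdivlMl ?exprn_gt0 //; apply: le_trans h; rewrite mulr_sumr.
apply: ler_sum => e _; case: (leqP j _) => [jf|_]; last by rewrite mulr0 exprn_ge0 // ltW.
by rewrite mulr1; apply: ler_weXn2l.
Qed.

(* The marks are only controlled given the past before a lag; the window
   condition bounds what the most recent marks can contribute. *)
Lemma delayed_chernoff v (mark : nat -> (nat -> V) -> bool) lag T B (z y : R) :
  (forall s, adapted s.+1 (mark s)) -> 1 <= z -> 0 <= y -> (lag <= T)%N ->
  (forall x s, (lag <= s)%N -> mark s x -> (nmarks mark (s - lag) s x <= B)%N) ->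
  (forall s (G : (nat -> V) -> R), (lag <= s)%N -> (s < T)%N -> adapted (s - lag) G ->
     (forall x, 0 <= G x) ->
     \sum_(e in envs) G (walk v e) * (mark s (walk v e))%:R <= y * \sum_(e in envs) G (walk v e)) ->
  \sum_(e in envs) z ^+ nmarks mark lag T (walk v e) <=
    (1 + (z - 1) * (z ^+ B * y)) ^+ (T - lag) * #|envs|%:R.
Proof.
move=> am z1 y0 lT win prob; have z0 : 0 <= z by apply: le_trans z1.
elim: T lT prob => [|T IH].
  rewrite leqn0 => /eqP-> _; rewrite expr0 mul1r.
  under eq_bigr => e _ do rewrite /nmarks big_geq // expr0.
  by rewrite sumr_const.
rewrite leq_eqVlt => /orP[/eqP<- _|lT prob].
  rewrite subnn expr0 mul1r.
  under eq_bigr => e _ do rewrite /nmarks big_geq // expr0.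
  by rewrite sumr_const.
have {}IH := IH lT (fun s G ls st => prob s G ls (ltnW st)).
rewrite subSn // exprS -mulrA.
have c0 : 0 <= (z - 1) * (z ^+ B * y) by rewrite !mulr_ge0 ?exprn_ge0 // subr_ge0.
apply: le_trans (ler_wpM2l _ IH); last by rewrite addr_ge0.
have -> : \sum_(e in envs) z ^+ nmarks mark lag T.+1 (walk v e) =
    \sum_(e in envs) z ^+ nmarks mark lag T (walk v e) + (z - 1) *
    \sum_(e in envs) z ^+ nmarks mark lag T (walk v e) * (mark T (walk v e))%:R.
  rewrite mulr_sumr -big_split /=; apply: eq_bigr => e _; rewrite nmarks_recr // exprD.
  by case: (mark T _); rewrite ?expr1 ?expr0 /=; [ring|rewrite !mulr0 addr0 mulr1].
rewrite [X in _ <= X]mulrDl mul1r lerD2l -mulrA ler_wpM2l ?subr_ge0 //.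
have wk x : (nmarks mark lag (T - lag) x <= nmarks mark lag T x)%N.
  by apply: leq_nmarks; apply: leq_subr.
apply: le_trans (_ : z ^+ B * (y * \sum_(e in envs) z ^+ nmarks mark lag (T - lag) (walk v e)) <= _).
  apply: le_trans (_ : z ^+ B * (\sum_(e in envs) z ^+ nmarks mark lag (T - lag) (walk v e) *
      (mark T (walk v e))%:R) <= _); last first.
    rewrite ler_wpM2l ?exprn_ge0 //.
    apply: (prob T (fun x => z ^+ nmarks mark lag (T - lag) x)) => // [x x' hx|x].
      by congr (_ ^+ _); apply: adapted_nmarks hx.
    exact: exprn_ge0.
  rewrite mulr_sumr; apply: ler_sum => e _; case: (boolP (mark T _)) => [mT|_]; last by rewrite !mulr0.
  rewrite !mulr1 -exprD; apply: ler_weXn2l => //.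
  apply: leq_trans (leq_add (win _ _ lT mT) (leqnn _)).
  rewrite /nmarks; have [le|lt] := leqP lag (T - lag).
    by rewrite (@big_cat_nat _ _ _ (T - lag)) ?leq_subr //= addnC.
  rewrite (@big_geq _ _ _ lag (T - lag)%N) ?(ltnW lt) // addn0.
  by rewrite [X in (_ <= X)%N](@big_cat_nat _ _ _ lag) ?(ltnW lt) //= leq_addl.
rewrite mulrA ler_wpM2l ?mulr_ge0 ?exprn_ge0 //; apply: ler_sum => e _.
by apply: ler_weXn2l.
Qed.

(** A vertex off the line has at most one neighbour on it. Lines can thus only fill up quickly while
    the walk is on them, and this is what localization makes rare. *)
Lemma line_targets (u : V) d c : (#|[set y in line d c | hamming_adj u y]| <= 1 + n * (u \in line d c))%N.
Proof.
have [ul|nul] := boolP (u \in line d c).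
  rewrite muln1 add1n; apply: leqW; apply: leq_trans (_ : #|line d c| <= _)%N.
    by apply: subset_leq_card; apply/subsetP=> y /setIdP[].
  by rewrite card_line.
rewrite muln0 addn0; apply/card_le1_eqP => y y' /setIdP[yl ay] /setIdP[yl' ay'].
move: yl yl' nul; rewrite !inE => /eqP yl /eqP yl' nul.
apply: (@vertex_eq _ d); first by rewrite yl yl'.
have H w : hamming_adj u w -> coord d w = c -> coord (~~ d) u = coord (~~ d) w.
  move=> aw wc; apply/eqP; have := adj_coordN (~~ d) aw; rewrite negbK wc (negbTE nul).
  by case: (coord (~~ d) u == _).
by rewrite -(H _ ay yl) -(H _ ay' yl').
Qed.

End DelayedChernoff.

Section Hazard.
Variables (R : realType) (n M : nat) (M_gt0 : (0 < M)%N).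
Local Open Scope set_scope.
Local Notation V := (hamming_vertex n).
Local Notation E := (hamming_edges n).
Local Notation noret := (@noret n M).
Local Notation fresh := (@fresh n M).
Local Notation news := (@news n M).
Local Notation walk := (@walk n M M_gt0).
Local Notation moves := (@moves n M M_gt0).
Local Notation envs := (envs n M).
Implicit Types (x : nat -> V) (s t r : nat) (y : V) (d : bool).

Variables (h L B T : nat) (a : R).
Local Notation ok := (@admissible n M h L B).
Hypothesis a_gt0 : 0 < a.
Hypothesis aE : a <= #|E|%:R - (n.-1.*2 * (T %/ M))%:R.

(** The last two conditions hold at a fresh crossing of an orbit that has not closed. Including them
    in the mark makes its conditional probability bounded on every path. *)
Definition landing s x := [&& fresh x s, noret x s.+1 & hamming_adj (x s) (x s.+1)].

Lemma adapted_landing s : adapted s.+1 (landing s).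
Proof.
move=> x x' hx; rewrite /landing (adapted_fresh M hx) !hx //; congr [&& _, _ & _].
by apply: adapted_noret => r rs; apply: hx; apply: leqW.
Qed.

Lemma aE_le s : (s <= T)%N -> a <= #|E|%:R - (n.-1.*2 * (s %/ M))%:R.
Proof.
move=> sT; apply: le_trans aE _; rewrite lerD2l lerN2 ler_nat leq_mul2l leq_div2r ?orbT //.
Qed.

Lemma landing_noret x s y : noret (extend x s y) s.+1 -> noret x s.+1.
Proof.
by rewrite (_ : noret (extend x s y) s.+1 = noret x s.+1) //; apply: adapted_noret => r rs; rewrite extend_le.
Qed.

Lemma landing_rate v e s : e \in envs -> (s <= T)%N -> let x := walk v e in
  \sum_(f in moves x s) (landing s (extend x s (edge_swap f (x s))))%:R <=
    n.-1.*2%:R / a * #|moves x s|%:R.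
Proof.
move=> eE sT; cbv zeta; set x := walk v e; apply: (marks_rate (B := setT) eE a_gt0 (aE_le sT)) => [y|].
  case/and3P=> fy nry ay; split=> //; first exact: landing_noret nry.
  by move: ay; rewrite extendE extend_le.
rewrite (_ : [set y in setT | _] = [set y | hamming_adj (x s) y]) ?card_adj //.
by apply/setP=> y; rewrite !inE.
Qed.

Lemma landings v t0 t (z : R) : 1 <= z -> (t0 <= t)%N -> (t <= T)%N ->
  \sum_(e in envs) z ^+ nmarks landing t0 t (walk v e) <=
    (1 + (z - 1) * (n.-1.*2%:R / a)) ^+ (t - t0) * #|envs|%:R.
Proof.
move=> z1 t0t tT.
have c1 : adapted t0 (fun _ : nat -> V => 1 : R) by [].
have r0 : 0 <= n.-1.*2%:R / a by rewrite divr_ge0 // ltW.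
have := @chernoff R n M M_gt0 v landing t0 t _ z _ t0t adapted_landing c1 (fun _ => ler01) z1 r0.
rewrite sumr_const; under eq_bigr => e _ do rewrite mul1r.
by apply=> e s eE _ st; apply: landing_rate => //; apply: leq_trans (ltnW st) tT.
Qed.

Lemma news_landings v e t0 t t' : e \in envs -> (t <= t')%N -> noret (walk v e) t ->
  (news t0 t (walk v e) <= nmarks landing t0 t' (walk v e))%N.
Proof.
move=> eE tt' nr; apply: leq_trans (leq_nmarks _ _ _ tt'); rewrite /news /nmarks.
rewrite big_nat_cond [X in (_ <= X)%N]big_nat_cond; apply: leq_sum => s /andP[/andP[_ st] _].
case: (boolP (fresh _ s)) => // fs; rewrite /landing fs (noretW st nr) crossed_adj //.
by case/andP: fs.
Qed.

Lemma crowded_window v t0 : (t0 + L <= T)%N ->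
  \sum_(e in envs) (B < nmarks landing t0 (t0 + L) (walk v e))%N%:R <=
    2 ^- B.+1 * (1 + n.-1.*2%:R / a) ^+ L * #|envs|%:R.
Proof.
move=> tT; apply: markov; first by rewrite ler1n.
have := @landings v t0 (t0 + L) 2 _ (leq_addr _ _) tT; rewrite addKn => /(_ ltac:(by rewrite ler1n)).
by have -> : 2 - 1 = 1 :> R by [ring]; rewrite mul1r.
Qed.

Variable rho : R.
Hypothesis rho_ge0 : 0 <= rho.
Hypothesis localized : forall v t0 z (G : (nat -> V) -> R), adapted t0 G -> (forall x, 0 <= G x) ->
  (t0 + L <= T)%N ->
  \sum_(e in envs) G (walk v e) * (ok (walk v e) (t0 + L) && (walk v e (t0 + L) == z))%:R
    <= rho * \sum_(e in envs) G (walk v e).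

Definition line_landing d c s x := [&& landing s x, x s.+1 \in line d c & ok x s].

Lemma adapted_line_landing d c s : adapted s.+1 (line_landing d c s).
Proof.
move=> x x' hx; rewrite /line_landing (adapted_landing hx) hx //; congr [&& _, _ & _].
by apply: adapted_admissible => r rs; apply: hx; apply: leqW.
Qed.

Lemma line_landing_rate v e d c s : e \in envs -> (s <= T)%N -> let x := walk v e in
  \sum_(f in moves x s) (line_landing d c s (extend x s (edge_swap f (x s))))%:R <=
    #|moves x s|%:R * ((1 + n * (ok x s && (x s \in line d c)))%N%:R / a).
Proof.
move=> eE sT; cbv zeta; set x := walk v e; rewrite mulrC.
have okE y : ok (extend x s y) s = ok x s.
  by apply: adapted_admissible => r rs; rewrite extend_le.
apply: (marks_rate (B := [set y in line d c | ok x s]) eE a_gt0 (aE_le sT)) => [y|].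
  case/and3P=> /and3P[fy nry ay] ly oky; split=> //; first exact: landing_noret nry.
    by move: ay; rewrite extendE extend_le.
  by apply/setIdP; move: ly oky; rewrite extendE okE.
case: (boolP (ok x s)) => okx.
  apply: leq_trans (line_targets (x s) d c); apply: subset_leq_card; apply/subsetP=> y.
  by case/setIdP=> /setIdP[yl _] ay; apply/setIdP.
rewrite (_ : [set y in _ | _] = set0) ?cards0 //; apply/setP=> y.
by rewrite [RHS]in_set0; apply/setIdP=> -[/setIdP[]].
Qed.

(** Localized over the preceding window, the walk is on the line with probability at most [n * rho],
    and a landing then has up to [n] targets; elsewhere it has one. With [z - 1 = B.+1%:R^-1] the
    factor [z ^+ B] due to the lag stays below [expR 1]. *)
Lemma busy_line v d c j : (L <= T)%N -> let z := 1 + B.+1%:R^-1 : R in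
  \sum_(e in envs) (j <= nmarks (line_landing d c) L T (walk v e))%N%:R <=
    z ^- j * (1 + (z - 1) * (z ^+ B * (a^-1 * (1 + n%:R * (n%:R * rho))))) ^+ (T - L) * #|envs|%:R.
Proof.
move=> LT; cbv zeta; set z := 1 + _; have z1 : 1 <= z by rewrite lerDl invr_ge0.
apply: markov => //; apply: delayed_chernoff => //; first exact: adapted_line_landing.
- by rewrite mulr_ge0 ?invr_ge0 ?(ltW a_gt0) // addr_ge0 // !mulr_ge0.
- move=> x s Ls /and3P[_ _ okx]; apply: leq_trans (_ : news (s - L) s x <= _)%N.
    by apply: nmarks_news => r /and3P[/and3P[]].
  have := admissible_news (k := 1) okx (leq_subr L s); rewrite !mul1n subnK //; exact.
move=> s G Ls sT aG G0.
have aG' : adapted s G by apply: adaptedW aG; apply: leq_subr.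
apply: le_trans (_ : \sum_(e in envs) G (walk v e) *
    ((1 + n * (ok (walk v e) s && (walk v e s \in line d c)))%N%:R / a) <= _).
  apply: (@one_step_le _ _ _ M_gt0 v s (fun x => G x * (line_landing d c s x)%:R)
     (fun x => G x * ((1 + n * (ok x s && (x s \in line d c)))%N%:R / a))).
    move=> x x' hx; rewrite (adapted_line_landing d c hx); congr (_ * _).
    by apply: aG' => r rs; apply: hx; apply: leqW.
  move=> e eE; cbv zeta; set x := walk v e.
  have -> : \sum_(f in moves x s) G (extend x s (edge_swap f (x s))) *
      (line_landing d c s (extend x s (edge_swap f (x s))))%:R =
      G x * \sum_(f in moves x s) (line_landing d c s (extend x s (edge_swap f (x s))))%:R.
    rewrite mulr_sumr; apply: eq_bigr => f _; congr (_ * _).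
    by apply: aG' => r rs; rewrite extend_le.
  rewrite mulrCA ler_wpM2l //; apply: line_landing_rate => //; exact: ltnW.
have -> : \sum_(e in envs) G (walk v e) * ((1 + n * (ok (walk v e) s && (walk v e s \in line d c)))%N%:R / a) =
  a^-1 * (\sum_(e in envs) G (walk v e) + n%:R * \sum_(z in line d c) \sum_(e in envs)
     G (walk v e) * (ok (walk v e) s && (walk v e s == z))%:R).
  rewrite exchange_big /= mulrDr !mulr_sumr -big_split /=; apply: eq_bigr => e _.
  have -> : \sum_(z in line d c) G (walk v e) * (ok (walk v e) s && (walk v e s == z))%:R =
      G (walk v e) * (ok (walk v e) s && (walk v e s \in line d c))%:R.
    rewrite -mulr_sumr -natr_sum; congr (_ * _%:R).
    case: (ok _ s); last by rewrite big1.
    case: (boolP (walk v e s \in line d c)) => [xl|xl].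
      by rewrite (bigD1 (walk v e s)) //= eqxx big1 // => w /andP[_]; rewrite eq_sym; case: eqP.
    by rewrite big1 // => w wl; case: eqP => // e1; rewrite e1 wl in xl.
  by rewrite natrD natrM mulrDl mulrDr; ring.
rewrite -[X in _ <= X]mulrA ler_wpM2l ?invr_ge0 ?(ltW a_gt0) //.
rewrite [X in _ <= X]mulrDl mul1r lerD2l -[X in _ <= X]mulrA ler_wpM2l //.
apply: le_trans (_ : \sum_(z in line d c) rho * \sum_(e in envs) G (walk v e) <= _).
  apply: ler_sum => z' _; have := @localized v (s - L) z' G aG G0; rewrite subnK //; apply.
  exact: ltnW.
by rewrite sumr_const card_line -[X in X <= _]mulr_natl mulrA.
Qed.

Lemma card_before_line v e d c t : e \in envs -> let x := walk v e in noret x t ->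
  (forall s, (s < t)%N -> ok x s) ->
  (#|before x t.+1 :&: line d c| <= 1 + nmarks (line_landing d c) 0 t x)%N.
Proof.
move=> eE x; elim: t => [|t IH] nr okx.
  apply: leq_trans (_ : #|before x 1| <= _)%N; first by apply/subset_leq_card/subsetIl.
  by rewrite beforeS cardsU1 (_ : before x 0 = set0) ?cards0 ?inE // /before;
    apply/setP=> y; rewrite [RHS]inE; apply/negP=> /imsetP[[]].
have {}IH := IH (noretW (leqnSn t) nr) (fun s st => okx s (ltnW st)).
rewrite beforeS nmarks_recr // addnA.
have [xl|xl] := boolP (x t.+1 \in line d c); last first.
  rewrite (_ : _ :&: _ = before x t.+1 :&: line d c) ?(leq_trans IH) ?leq_addr //.
  apply/setP=> y; rewrite !in_setI in_setU1; case: (y =P x t.+1) => [->|//].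
  by rewrite (negbTE xl) !andbF.
rewrite setIUl (setIidPl _) ?sub1set // cardsU1 addnC leq_add // in_setI xl andbT.
case: (boolP (_ \in _)) => // ns; have fr := unseen_fresh eE nr ns.
rewrite /line_landing /landing fr nr xl okx // crossed_adj //.
by case/andP: fr.
Qed.

Hypothesis h_large : (B.+1 < h)%N.

(** At the first inadmissible time all earlier times are admissible, so a failure of [thin] is
    entirely due to marked landings. At most [B] of these precede [L], where the lagged estimate
    does not apply; this is why [h] is reduced. *)
Lemma breakdown v e t : e \in envs -> let x := walk v e in noret x t -> ~~ ok x t ->
  (t + L <= T)%N ->
  [exists s : 'I_T, (s + L <= T)%N && (B < nmarks landing s (s + L) x)%N] \/
  [exists d, exists c, (h - B.+1 <= nmarks (line_landing d c) L T x)%N].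
Proof.
move=> eE x nr nok tT.
have ex : exists s, ~~ ok x s by exists t.
case: (ex_minnP ex) => s nks smin; have st : (s <= t)%N by apply: smin.
have oks r : (r < s)%N -> ok x r.
  by move=> rs; apply: contraTT rs => /smin; rewrite -leqNgt.
have nrs : noret x s by apply: noretW nr.
move: nks; rewrite /admissible nrs /= negb_and => /orP[|/forallPn[r]]; last first.
  rewrite -ltnNge => br; left; have rs := ltn_ord r.
  have rT : (r + L <= T)%N by apply: leq_trans tT; rewrite leq_add2r ltnW // (leq_trans rs).
  have rT' : (r < T)%N.
    by apply: leq_trans (leq_trans rs st) _; apply: leq_trans tT; rewrite leq_addr.
  apply/existsP; exists (Ordinal rT'); rewrite /= rT; apply: leq_trans br _.
  apply: news_landings => //; first exact: geq_minr.
  by apply: noretW nrs; rewrite geq_minl.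
case/forallPn=> d /forallPn[c]; rewrite -ltnNge => hc; right.
have := leq_trans hc (card_before_line d c eE nrs oks); rewrite -/x add1n ltnS => {}hc.
apply/existsP; exists d; apply/existsP; exists c.
have fr r : line_landing d c r x -> fresh x r by case/andP=> /andP[].
have [sL|Ls] := leqP s L.
  case: s => [|s] in hc smin st oks nrs sL *; first by move: hc; rewrite /nmarks big_geq // leqNgt (leq_trans _ h_large).
  have := oks s (ltnSn s) => okx.
  have n1 : (news 0 s x <= B)%N.
    by rewrite -[B]mul1n; apply: (admissible_news okx); rewrite // mul1n add0n ltnW.
  have n2 := nmarks_news 0 s fr.
  by move: hc; rewrite nmarks_recr // leqNgt (leq_ltn_trans _ h_large) // -addn1 leq_add ?(leq_trans n2) ?leq_b1.
have LT : (s <= T)%N by apply: leq_trans st _; apply: leq_trans tT; rewrite leq_addr.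
apply: leq_trans (leq_nmarks _ L x LT); rewrite leq_subLR; apply: leq_trans hc _.
rewrite /nmarks (@big_cat_nat _ _ _ L) ?(ltnW Ls) //= leq_add2r; apply: leqW.
apply: leq_trans (nmarks_news 0 L fr) _; have okL := oks L Ls.
by rewrite -[B]mul1n; apply: (admissible_news okL); rewrite // mul1n add0n.
Qed.

Definition crowding : R := 2 ^- B.+1 * (1 + n.-1.*2%:R / a) ^+ L.
Definition heaviness : R := let z := 1 + B.+1%:R^-1 in
  z ^- (h - B.+1) * (1 + (z - 1) * (z ^+ B * (a^-1 * (1 + n%:R * (n%:R * rho))))) ^+ (T - L).

(** A return at an admissible time is bounded by localization at that very time, any other return by
    [breakdown]. *)
Lemma hazard v K : (L <= T)%N ->
  \sum_(e in envs) [exists p : 'I_K, [&& (L <= p * M)%N, (p * M + L <= T)%N,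
     noret (walk v e) (p * M) & walk v e (p * M) == v]]%:R <=
  (K%:R * rho + T%:R * crowding + 2 * n%:R * heaviness) * #|envs|%:R.
Proof.
move=> LT.
pose Q1 e := \sum_(p < K | (L <= p * M)%N && (p * M + L <= T)%N)
  (ok (walk v e) (p * M) && (walk v e (p * M) == v))%:R : R.
pose Q2 e := \sum_(s < T | (s + L <= T)%N) (B < nmarks landing s (s + L) (walk v e))%N%:R : R.
pose Q3 e := \sum_(d : bool) \sum_(c : 'I_n)
  (h - B.+1 <= nmarks (line_landing d c) L T (walk v e))%N%:R : R.
have Q10 e : 0 <= Q1 e by apply: sumr_ge0.
have Q20 e : 0 <= Q2 e by apply: sumr_ge0.
have Q30 e : 0 <= Q3 e by do 2 ![apply: sumr_ge0 => ? _].
apply: le_trans (_ : \sum_(e in envs) (Q1 e + Q2 e + Q3 e) <= _).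
  apply: ler_sum => e eE.
  case: (boolP [exists p : 'I_K, _]) => [/existsP[p /and4P[Lp pT nr xv]]|_]; last by rewrite !addr_ge0.
  have [okp|nok] := boolP (ok (walk v e) (p * M)).
    apply: le_trans (_ : Q1 e <= _); last by rewrite -addrA lerDl addr_ge0.
    rewrite /Q1 (bigD1 p) ?Lp ?pT //= okp xv lerDl; exact: sumr_ge0.
  have [/existsP[s /andP[sT Bs]]|/existsP[d /existsP[c hc]]] := breakdown eE nr nok pT.
    apply: le_trans (_ : Q2 e <= _); last by rewrite [_ + Q2 e]addrC -addrA lerDl addr_ge0.
    rewrite /Q2 (bigD1 s) //= Bs lerDl; exact: sumr_ge0.
  apply: le_trans (_ : Q3 e <= _); last by rewrite lerDr addr_ge0.
  rewrite /Q3 (bigD1 d) //= (bigD1 c) //= hc -addrA lerDl addr_ge0 //; first exact: sumr_ge0.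
  by do 2 ![apply: sumr_ge0 => ? _].
rewrite !big_split /= !mulrDl !lerD //.
- rewrite exchange_big /=; apply: le_trans (_ : \sum_(p < K | (L <= p * M)%N && (p * M + L <= T)%N)
    rho * #|envs|%:R <= _).
    apply: ler_sum => p /andP[Lp pT].
    have := @localized v (p * M - L) v (fun=> 1) _ (fun=> ler01); rewrite subnK // sumr_const => H.
    apply: le_trans (H _ _) => //; last by apply: leq_trans pT; rewrite leq_addr.
    by apply: ler_sum => e _; rewrite mul1r.
  have -> : K%:R * rho * #|envs|%:R = \sum_(p < K) rho * #|envs|%:R.
    by rewrite sumr_const card_ord -mulrA mulr_natl.
  by rewrite big_mkcond /=; apply: ler_sum => p _; case: ifP; rewrite ?mulr_ge0.
- rewrite exchange_big /=; apply: le_trans (_ : \sum_(s < T | (s + L <= T)%N) crowding * #|envs|%:R <= _).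
    by apply: ler_sum => s sT; apply: crowded_window.
  have cr0 : 0 <= crowding * #|envs|%:R.
    by rewrite !mulr_ge0 ?invr_ge0 ?exprn_ge0 // addr_ge0 // divr_ge0 // ltW.
  have -> : T%:R * crowding * #|envs|%:R = \sum_(p < T) crowding * #|envs|%:R.
    by rewrite sumr_const card_ord -mulrA mulr_natl.
  by rewrite big_mkcond /=; apply: ler_sum => p _; case: ifP.
rewrite exchange_big /=; under eq_bigr => d _ do rewrite exchange_big /=.
apply: le_trans (_ : \sum_(d : bool) \sum_(c : 'I_n) heaviness * #|envs|%:R <= _).
  by apply: ler_sum => d _; apply: ler_sum => c _; apply: busy_line.
rewrite le_eqVlt big_bool /= !sumr_const card_ord; apply/orP; left; apply/eqP.
set y := heaviness * _; rewrite -(mulr_natl y) /y; ring.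
Qed.

End Hazard.

(** * Survival for a short time *)

Local Open Scope ring_scope.

Section Survival.
Variables (R : realType) (n M : nat) (M_gt0 : (0 < M)%N).
Local Open Scope set_scope.
Local Notation V := (hamming_vertex n).
Local Notation E := (hamming_edges n).
Local Notation noret := (@noret n M).
Local Notation known := (@known n M).
Local Notation fresh := (@fresh n M).
Local Notation news := (@news n M).
Local Notation collides := (@collides n M).
Local Notation walk := (@walk n M M_gt0).
Local Notation moves := (@moves n M M_gt0).
Local Notation envs := (envs n M).
Local Notation landing := (@landing n M).
Implicit Types (x : nat -> V) (s t r : nat) (y : V) (d : bool).

Variables (gamma phi delta b S : R) (h : nat).
Hypotheses (phi_gt0 : 0 < phi) (phi_lt1 : phi < 1) (gamma_gt0 : 0 < gamma)
  (delta_gt0 : 0 < delta) (b_gt0 : 0 < b) (S_ge0 : 0 <= S).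
Hypothesis bE : b * #|E|%:R <= M%:R * (n.-1%:R - h%:R).
Hypothesis SE : 4 * h%:R * M%:R <= S * #|E|%:R.
Hypothesis bent_cond : delta + gamma <= 2 * b * (1 - expR (- gamma)).
Hypothesis old_cond : delta <= 2 * b * phi.
Hypothesis straight_cond : phi + delta + S * phi <= b * (1 - phi - expR (- gamma)).
Hypothesis known_cond : phi <= (1 - phi) * gamma.
Local Notation potential := (@potential R n M gamma phi delta h 0 0).
Let start0 : 0%N = 1%N \/ 0%N = 0%N /\ 0%N = 0%N. Proof. by right. Qed.

Variables (W B : nat) (a : R).
Local Notation L := (W * M)%N.
Hypothesis a_gt0 : 0 < a.
Hypothesis aE : a <= #|E|%:R - (n.-1.*2 * (L %/ M))%:R.
Hypothesis EA : (n.-1.*2 * (L %/ M) * 2 <= #|E|)%N.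
Hypothesis few_news : (gamma + delta) * B%:R <= delta / 2 * M%:R.
Hypothesis h_large : (B < h)%N.

Definition closing x t := [&& (0 < t)%N, (M %| t)%N & x t == x 0%N].

Lemma closing_noret x t : closing x t -> ~~ noret x t.+1.
Proof.
case/and3P=> t0 Mt xt; apply/negP=> /noretP/(_ 0%N t t0 (ltnSn t)).
by rewrite mod0n (eqP Mt) => /(_ erefl)/eqP; rewrite (eqP xt).
Qed.

(** A closing destroys [noret], so the potential vanishes right after it. The supermartingale
    inequality therefore also pays for the values of the potential at the closings. *)
Lemma closing_potential v t : (t <= L)%N ->
  \sum_(e in envs) \sum_(s < t) (potential (walk v e) s * (closing (walk v e) s)%:R) +
  \sum_(e in envs) potential (walk v e) t <= \sum_(e in envs) potential (walk v e) 0.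
Proof.
elim: t => [|t IH] tL.
  by rewrite big1 ?add0r // => e _; rewrite big_ord0.
apply: le_trans (IH (ltnW tL)).
under eq_bigr => e _ do rewrite big_ord_recr /=.
rewrite big_split /= -addrA lerD2l -lerBrDl -sumrB.
apply: (@one_step_le _ _ _ M_gt0 v t (fun x => potential x t.+1)
  (fun x => potential x t - potential x t * (closing x t)%:R)).
  by apply: adapted_potential => //; exact: start0.
move=> e eE; cbv zeta; set x := walk v e.
case: (boolP (closing x t)) => [/closing_noret nr|_]; last first.
  rewrite mulr0 subr0; apply: (potential_one_step start0 phi_gt0 phi_lt1 gamma_gt0 delta_gt0 b_gt0 S_ge0 bE SE
    bent_cond old_cond straight_cond known_cond eE (leq0n t)) => nk.
  apply: half_large (card_moves nk); apply: leq_trans EA.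
  by rewrite leq_mul2r leq_mul2l leq_div2r ?orbT // ltnW.
rewrite mulr1 subrr mulr0 big1 // => f _; rewrite /potential /clear.
have -> : noret (extend x t (edge_swap f (x t))) t.+1 = noret x t.+1.
  by apply: adapted_noret => s st; rewrite extend_le.
by rewrite (negbTE nr).
Qed.

Let mark s x := [&& landing s x, x s.+1 \in discovered x 0 s & (news 0 s x <= B)%N].

(** At a closing without collision no phase is left unexplored, by [closing_complete]; the shade is
    1 because the root is bent, and the gain is nonnegative. So the potential is at least 1, whereas
    it started from [expR (- gamma)]: this is where that survival bound comes from. *)
Lemma no_mark_closing v e p : e \in envs -> let x := walk v e in (0 < p)%N -> (p < W)%N ->
  noret x (p * M) -> x (p * M) = v -> (nmarks landing 0 L x <= B)%N -> nmarks mark 0 L x = 0%N ->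
  1 <= potential x (p * M) * (closing x (p * M))%:R.
Proof.
move=> eE x p0 pW nr xv fewL nm; set t := (p * M)%N in nr xv *.
have tL : (t <= L)%N by rewrite leq_mul2r ltnW ?orbT.
have t0 : (0 < t)%N by rewrite muln_gt0 p0.
have cl : closing x t by rewrite /closing t0 dvdn_mull //= xv.
rewrite cl mulr1.
have nB : (news 0 t x <= B)%N.
  by apply: leq_trans fewL; apply: news_landings.
have th : thin h x t.
  apply/forallP=> d; apply/forallP=> c; apply: leq_trans (subset_leq_card (subsetIl _ _)) _.
  apply: leq_trans (card_before eE (leq0n t) nr) _; apply: leq_trans h_large.
  rewrite -[X in (_ <= X)%N]add1n leq_add // beforeS cardsU1 (_ : before x 0 = set0) ?cards0 ?inE //.
  by apply/setP=> y; rewrite [RHS]inE; apply/negP=> /imsetP[[]].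
have clr : clear M h 0 0 x t.
  apply/and3P; split=> //; apply/forallP=> s; apply/negP=> /andP[fs xs].
  have sL : (s < L)%N by apply: leq_trans tL.
  have := leq_nmarks mark 0 x sL; rewrite nm leqn0 nmarks_recr // addn_eq0 => /andP[_].
  rewrite /mark xs /landing fs (noretW _ nr) // crossed_adj //=; last by case/andP: fs.
  by rewrite (leq_trans (leq_news M 0 x (ltnW (ltn_ord s))) nB).
have okx : admissible M h ((W + 0) * M) B x t.
  apply/and3P; split=> //; apply/forallP=> s.
  apply: leq_trans nB; apply: leq_trans (_ : news 0 (minn t (s + (W + 0) * M)) x <= _)%N; last first.
    by apply: leq_news; apply: geq_minl.
  rewrite [X in (_ <= X)%N](@news_cat _ _ _ s) ?leq_addl // leq_min ltnW //=.
  exact: leq_addr.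
have gn : 0 <= gain M gamma delta 0 x t.
  apply: le_trans (_ : delta * p%:R / 2 <= _); first by rewrite divr_ge0 // mulr_ge0 // ltW.
  have few1 : (gamma + delta) * (1 * B)%:R <= delta / 2 * M%:R by rewrite mul1n.
  apply: (gain_ge M_gt0 gamma_gt0 delta_gt0 few1); first by rewrite add0n; exact: okx.
  by rewrite add0n mul1n addn0.
rewrite /potential clr.
have le0 : (0 <= 1)%N by [].
have db : (x t \in discovered x 0 0).
  by apply/discoveredP; exists 0%N; split; rewrite ?xv //; apply/firstP.
have bm k : x t \in bent (labels x 0 0 k).
  by elim: k => [|k IH]; [exact: db|exact: labels_bent_mono].
have -> : shade M phi 0 0 x t = 1.
  rewrite /shade; case: ifP => // /orP[] h1; have := labels_disjoint (leq0n 1) h1; by rewrite bm.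
have -> : remaining R M 0 0 x t = 0.
  rewrite /remaining big1 // => y yb.
  have : y \in discovered x 0 (0 + (t - 0)) by rewrite labels_discovered // yb.
  rewrite add0n subn0 => /discoveredP[r [_ rt fr <-]].
  have {}rt : (r < t)%N.
    rewrite ltn_neqAle rt andbT; apply: contraTneq fr => ->.
    by apply/negP=> /firstP/(_ 0%N t0); rewrite xv eqxx.
  rewrite (closing_complete eE nr (clear_no_collisions start0 clr)) ?subrr //.
  by rewrite mod0n modnMl.
by rewrite mulr0 subr0 mulr1 -[X in X <= _]expR0 ler_expR.
Qed.

Let adapted_mark s : adapted s.+1 (mark s).
Proof.
move=> x x' hx; have hs r : (r <= s)%N -> x r = x' r by move=> rs; apply: hx; apply: leqW.
rewrite /mark (adapted_landing M hx) hx // (adapted_news _ _ hs).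
congr [&& _, _ \in pred_of_set _ & _]; rewrite /discovered (adapted_before hs).
by congr (_ :\: _); apply: before_ext.
Qed.

Let mark_rate v : \sum_(e in envs) 2 ^+ nmarks mark 0 L (walk v e) <=
  (1 + B.+1%:R / a) ^+ L * #|envs|%:R.
Proof.
have c1 : adapted 0 (fun _ : nat -> V => 1 : R) by [].
have r0 : 0 <= B.+1%:R / a by rewrite divr_ge0 // ltW.
have := @chernoff R n M M_gt0 v mark 0 L _ 2 _ (leq0n L) adapted_mark c1 (fun _ => ler01) _ r0.
rewrite sumr_const subn0 => /(_ ltac:(by rewrite ler1n)).
have -> : 2 - 1 = 1 :> R by [ring]; rewrite mul1r => H.
apply: le_trans (H _); first by apply: ler_sum => e _; rewrite mul1r.
move=> e s eE _ sL; cbv zeta; set x := walk v e.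
apply: (marks_rate (B := [set y in discovered x 0 s | (news 0 s x <= B)%N && noret x s.+1]) eE a_gt0).
- exact: (aE_le aE (ltnW sL)).
- move=> y /and3P[/and3P[fy nry ay] yd yn].
  have hs r : (r <= s)%N -> extend x s y r = x r by move=> rs; rewrite extend_le.
  have nrx : noret x s.+1 by apply: landing_noret nry.
  split=> //; first by move: ay; rewrite extendE extend_le.
  apply/setIdP; rewrite nrx -(adapted_news _ _ hs) yn; split=> //.
  by move: yd; rewrite extendE /discovered (adapted_before hs) (before_ext (t := 0) (x' := x)).
case: (boolP (_ && _)) => [/andP[nB nr]|_]; last first.
  rewrite (_ : [set y in _ | _] = set0) ?cards0 //; apply/setP=> y.
  by rewrite [RHS]in_set0; apply/setIdP=> -[/setIdP[]].
apply: leq_trans (_ : #|before x s.+1| <= _)%N.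
  by apply: subset_leq_card; apply/subsetP=> y /setIdP[/setIdP[/setDP[]]].
apply: leq_trans (card_before eE (leq0n s) (noretW (leqnSn s) nr)) _.
rewrite -[X in (_ <= X)%N]add1n leq_add // beforeS cardsU1 (_ : before x 0 = set0) ?cards0 ?inE //.
by apply/setP=> y; rewrite [RHS]inE; apply/negP=> /imsetP[[]].
Qed.

Lemma survival v :
  \sum_(e in envs) [exists p : 'I_W, [&& (0 < p)%N, noret (walk v e) (p * M) & walk v e (p * M) == v]]%:R <=
  (expR (- gamma) + 2 ^- B.+1 * (1 + n.-1.*2%:R / a) ^+ L + ((1 + B.+1%:R / a) ^+ L - 1)) * #|envs|%:R.
Proof.
pose Q1 e := \sum_(s < L) potential (walk v e) s * (closing (walk v e) s)%:R.
pose Q2 e := (B < nmarks landing 0 L (walk v e))%N.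
pose Q3 e := nmarks mark 0 L (walk v e).
have pot0 x t : 0 <= potential x t by apply: potential_ge0.
have Q10 e : 0 <= Q1 e by apply: sumr_ge0 => s _; rewrite mulr_ge0.
(* This quantity is at least 1 as soon as there is one collision, and its mean is given by an
   exponential moment. *)
have Q30 e : 0 <= 2 ^+ Q3 e - 1 :> R by rewrite subr_ge0 exprn_ege1 // ler1n.
apply: le_trans (_ : \sum_(e in envs) (Q1 e + (Q2 e)%:R + (2 ^+ Q3 e - 1)) <= _).
  apply: ler_sum => e eE.
  case: (boolP [exists p : 'I_W, _]) => [/existsP[p /and3P[p0 nr /eqP xv]]|_]; last by do 2 ![apply: addr_ge0 => //].
  have [q2|nq2] := boolP (Q2 e).
    by rewrite addrAC lerDr; apply: addr_ge0.
  have [q3|nq3] := eqVneq (Q3 e) 0%N; last first.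
    apply: (@le_trans _ _ (2 ^+ Q3 e - 1)); last by rewrite lerDr; apply: addr_ge0.
    rewrite lerBrDr; have -> : 1 + 1 = 2 ^+ 1 :> R by rewrite expr1; ring.
    by apply: ler_weXn2l; rewrite ?ler1n // lt0n.
  rewrite -addrA; apply: le_trans (_ : Q1 e <= _); last by rewrite lerDl; apply: addr_ge0.
  have pL : (p * M < L)%N by rewrite ltn_mul2r M_gt0 /=.
  rewrite /Q1 (bigD1 (Ordinal pL)) //=; apply: le_trans (_ : potential (walk v e) (p * M) *
      (closing (walk v e) (p * M))%:R <= _); last by rewrite lerDl sumr_ge0 // => s _; rewrite mulr_ge0.
  apply: no_mark_closing => //; first by rewrite leqNgt.
rewrite !big_split /= !mulrDl !lerD //.
- apply: le_trans (_ : \sum_(e in envs) potential (walk v e) 0 <= _).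
    apply: le_trans (closing_potential v (leqnn L)); rewrite lerDl; exact: sumr_ge0.
  have -> : expR (- gamma) * #|envs|%:R = \sum_(e in envs) expR (- gamma).
    by rewrite sumr_const mulr_natr.
  by apply: ler_sum => e _; exact: (potential_start M_gt0 _ _ _ _ start0 (walk v e)).
- have := @crowded_window R n M M_gt0 L B L a a_gt0 aE v 0 (leqnn _).
  by rewrite add0n.
- exact: mark_rate.
by rewrite sumr_const mulN1r mulNrn.
Qed.

End Survival.

(** * Concentration *)

Local Open Scope ring_scope.

Section Variance.
Variables (R : realType) (n M : nat) (M_gt0 : (0 < M)%N).
Local Open Scope set_scope.
Local Notation V := (hamming_vertex n).
Local Notation E := (hamming_edges n).
Local Notation env := {ffun 'I_M -> {set V}}.
Local Notation envs := (envs n M).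
Implicit Types (F : env -> R) (e : env) (j : 'I_M) (f : {set V}).

Lemma set_slotC e i j f g : i != j -> set_slot (set_slot e i f) j g = set_slot (set_slot e j g) i f.
Proof.
move=> ij; apply/ffunP=> k; rewrite !ffunE; case: (k =P j) => // ->.
by rewrite eq_sym (negbTE ij).
Qed.

Lemma set_slot2 e j f g : set_slot (set_slot e j f) j g = set_slot e j g.
Proof. by apply/ffunP=> k; rewrite !ffunE; case: eqP. Qed.

Definition average j F e : R := #|E|%:R^-1 * \sum_(f in E) F (set_slot e j f).

Lemma average_set_slot j F e f : average j F (set_slot e j f) = average j F e.
Proof. by congr (_ * _); apply: eq_bigr => g _; rewrite set_slot2. Qed.

Definition varies_at_most (c : R) F :=
  forall e j f, e \in envs -> f \in E -> `|F e - F (set_slot e j f)| <= c.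

Section NonEmpty.
Variables (v0 : V) (E_gt0 : (0 < #|E|)%N).
Let E0 : (0 : R) < #|E|%:R. Proof. by rewrite ltr0n. Qed.

Lemma sum_average j F : \sum_(e in envs) average j F e = \sum_(e in envs) F e.
Proof.
rewrite [RHS](resample M_gt0 v0 j 0); apply: eq_bigr => e _.
suff -> : compat M_gt0 (walk M_gt0 v0 e) j 0 = E by [].
by apply/setP=> f; apply/compatP/idP => [[]|fE].
Qed.

Lemma average_dist (c : R) F G j e : (forall f, f \in E -> `|F (set_slot e j f) - G f| <= c) ->
  `|average j F e - #|E|%:R^-1 * \sum_(f in E) G f| <= c.
Proof.
move=> h; rewrite -mulrBr -sumrB normrM ger0_norm ?invr_ge0 ?(ltW E0) // ler_pdivrMl //.
apply: le_trans (ler_norm_sum _ _ _) _; rewrite mulr_natl -sumr_const.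
exact: ler_sum.
Qed.

Lemma average_varies (c : R) F j : varies_at_most c F -> varies_at_most c (average j F).
Proof.
move=> hF e i f eE fE; have [->|ij] := eqVneq i j.
  rewrite average_set_slot subrr normr0.
  by apply: le_trans (normr_ge0 _) (hF e i f eE fE).
apply: average_dist => g gE; rewrite set_slotC //.
by apply: hF => //; apply: set_slot_envs.
Qed.

Lemma average_gap (c : R) F j e : varies_at_most c F -> e \in envs -> `|F e - average j F e| <= c.
Proof.
move=> hF eE; rewrite distrC.
have -> : F e = #|E|%:R^-1 * \sum_(f in E) F e.
  by rewrite sumr_const -[X in _ = _ * X]mulr_natl mulKf // gt_eqF.
by apply: average_dist => f fE; rewrite distrC; apply: hF.
Qed.

(** Averaging over one slot is an orthogonal projection, so the second moment splits; the
    fluctuating part is at most [c] pointwise. *)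
Lemma average_square (c : R) F j : varies_at_most c F ->
  \sum_(e in envs) F e ^+ 2 <= \sum_(e in envs) average j F e ^+ 2 + c ^+ 2 * #|envs|%:R.
Proof.
move=> hF.
have cross : \sum_(e in envs) F e * average j F e = \sum_(e in envs) average j F e ^+ 2.
  rewrite -(sum_average j (fun e => F e * average j F e)); apply: eq_bigr => e _.
  by rewrite [LHS]/average (eq_bigr _ (fun f _ => congr1 _ (average_set_slot j F e f))) -mulr_suml mulrA.
have -> : \sum_(e in envs) F e ^+ 2 = \sum_(e in envs) average j F e ^+ 2 +
    \sum_(e in envs) (F e - average j F e) ^+ 2.
  have -> : \sum_(e in envs) (F e - average j F e) ^+ 2 =
      \sum_(e in envs) (F e ^+ 2 + average j F e ^+ 2 - 2 * (F e * average j F e)).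
    by apply: eq_bigr => e _; ring.
  rewrite sumrB big_split /= -mulr_sumr cross; ring.
rewrite lerD2l mulr_natr -sumr_const; apply: ler_sum => e eE.
rewrite -[X in X <= _]real_normK ?num_real //; apply: lerXn2r; rewrite ?nnegrE //.
  exact: le_trans (normr_ge0 _) (average_gap j hF eE).
exact: average_gap.
Qed.

Fixpoint averages k F : env -> R :=
  if k is k'.+1 then average (slot M_gt0 k') (averages k' F) else F.

Lemma averages_varies (c : R) F k : varies_at_most c F -> varies_at_most c (averages k F).
Proof. by move=> hF; elim: k => //= k IH; apply: average_varies. Qed.

Lemma averages_slot k F i e f : (i < k)%N -> averages k F (set_slot e (slot M_gt0 i) f) = averages k F e.
Proof.
elim: k e => //= k IH e; rewrite ltnS leq_eqVlt => /orP[/eqP->|ik]; first exact: average_set_slot.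
have [->|ne] := eqVneq (slot M_gt0 i) (slot M_gt0 k); first exact: average_set_slot.
by rewrite /average; congr (_ * _); apply: eq_bigr => g _; rewrite set_slotC // IH.
Qed.

Lemma averages_const F e e' : averages M F e = averages M F e'.
Proof.
pose g k : env := [ffun i : 'I_M => if (i < k)%N then e' i else e i].
have -> : e = g 0%N by apply/ffunP=> i; rewrite ffunE.
have -> : e' = g M by apply/ffunP=> i; rewrite ffunE ltn_ord.
suff H k : (k <= M)%N -> averages M F (g 0%N) = averages M F (g k) by apply: H.
elim: k => // k IH kM; rewrite IH ?(ltnW kM) //.
have -> : g k.+1 = set_slot (g k) (slot M_gt0 k) (e' (slot M_gt0 k)).
  apply/ffunP=> i; rewrite !ffunE ltnS leq_eqVlt.
  have -> : (i == slot M_gt0 k) = ((i : nat) == k) by rewrite -val_eqE /= modn_small.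
  by case: ((i : nat) =P k) => // ik; congr (e' _); apply: val_inj; rewrite /= modn_small.
by rewrite averages_slot.
Qed.

(** Averaging out all slots one after the other ends at the mean, and each slot costs at most
    [c ^+ 2] in the second moment. *)
Lemma efron_stein (c m : R) F : varies_at_most c F -> \sum_(e in envs) F e = m * #|envs|%:R ->
  \sum_(e in envs) (F e - m) ^+ 2 <= M%:R * c ^+ 2 * #|envs|%:R.
Proof.
move=> hF mF.
have sums k : \sum_(e in envs) averages k F e = m * #|envs|%:R.
  by elim: k => //= k IH; rewrite sum_average.
have sq k : \sum_(e in envs) F e ^+ 2 <= \sum_(e in envs) averages k F e ^+ 2 + k%:R * (c ^+ 2 * #|envs|%:R).
  elim: k => [|k IH]; first by rewrite mul0r addr0.
  apply: le_trans IH _; rewrite -natr1 mulrDl mul1r addrA [X in _ <= X]addrAC lerD2r.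
  exact: (average_square (slot M_gt0 k) (averages_varies k hF)).
have cst e : e \in envs -> averages M F e = m.
  move=> eE; have := sums M; rewrite (eq_bigr (fun=> averages M F e)) => [|e' _]; last exact: averages_const.
  rewrite sumr_const -[X in X = _]mulr_natr => /mulIf; apply.
  by rewrite pnatr_eq0 -lt0n; apply/card_gt0P; exists e.
have -> : \sum_(e in envs) (F e - m) ^+ 2 = \sum_(e in envs) F e ^+ 2 - \sum_(e in envs) m ^+ 2.
  have -> : \sum_(e in envs) (F e - m) ^+ 2 = \sum_(e in envs) (F e ^+ 2 + m ^+ 2 - (m *+ 2) * F e).
    by apply: eq_bigr => e _; ring.
  rewrite sumrB big_split /= -[X in _ - X = _]mulr_sumr [X in _ * X]mF sumr_const.
  rewrite -[X in _ + X - _]mulr_natl -[X in _ = _ - X]mulr_natl; ring.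
rewrite lerBlDl -mulrA; apply: le_trans (sq M) _; rewrite lerD2r.
by apply: ler_sum => e eE; rewrite cst.
Qed.

End NonEmpty.
End Variance.

(** * Orbits of the permutation as returns of the walk *)

Section Flow.
Variables (n M : nat) (M_gt0 : (0 < M)%N).
Local Open Scope nat_scope.
Local Open Scope set_scope.
Local Notation V := (hamming_vertex n).
Local Notation E := (hamming_edges n).
Local Notation env := {ffun 'I_M -> {set V}}.
Local Notation noret := (@noret n M).
Local Notation walk := (@walk n M M_gt0).
Local Notation envs := (envs n M).
Implicit Types (e : env) (s t r : nat) (u v : V).

Definition flow e : {perm V} := (\prod_(i < M) edge_swap (e i))%g.

Let partial_flow e i : {perm V} := (\prod_(0 <= j < i) edge_swap (e (slot M_gt0 j)))%g.

Lemma slot_period p i : slot M_gt0 (p * M + i) = slot M_gt0 i.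
Proof. by apply: val_inj; rewrite /= modnMDl. Qed.

Lemma partial_flowE e v p i : walk v e (p * M + i) = partial_flow e i (walk v e (p * M)).
Proof.
elim: i => [|i IH]; first by rewrite addn0 /partial_flow big_geq // perm1.
by rewrite addnS [LHS]/= IH slot_period /partial_flow big_nat_recr //= permM.
Qed.

Lemma partial_flow_full e : partial_flow e M = flow e.
Proof.
rewrite /partial_flow big_mkord; apply: eq_bigr => i _; congr (edge_swap (e _)).
by apply: val_inj; rewrite /= modn_small.
Qed.

Lemma walk_iter v e p : walk v e (p * M) = iter p (flow e) v.
Proof.
elim: p => [|p IH]; first by rewrite mul0n.
by rewrite mulSnr partial_flowE partial_flow_full IH.
Qed.

Lemma walk_step u e : walk u e M = flow e u.
Proof. by rewrite -[M in walk u e M]mul1n walk_iter. Qed.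

Lemma iter_neq v e a b : a < b -> b < #|porbit (flow e) v| -> iter a (flow e) v != iter b (flow e) v.
Proof.
move=> ab bp; have := uniq_traject_porbit (flow e) v; set p := #|_| in bp * => un.
have ap : a < p by apply: ltn_trans bp.
rewrite -(nth_traject _ ap) -(nth_traject _ bp) nth_uniq ?size_traject //.
by rewrite neq_ltn ab.
Qed.

(** Times of equal phase differ by whole periods, and each period acts by a bijection, so a
    repetition would already occur among the iterates below the orbit length. *)
Lemma porbit_noret v e p : p <= #|porbit (flow e) v| -> noret (walk v e) (p * M).
Proof.
move=> pp; apply/noretP=> r s rs st; rewrite [in X in X -> _](divn_eq r M) [in X in X -> _](divn_eq s M) !modnMDl.
rewrite !modn_mod => ers; rewrite (divn_eq r M) (divn_eq s M) !partial_flowE ers (inj_eq perm_inj) !walk_iter.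
apply: iter_neq; last by apply: leq_trans pp; rewrite ltn_divLR.
rewrite ltn_neqAle leq_div2r 1?ltnW // andbT; apply: contraTneq rs => e1.
by rewrite (divn_eq r M) (divn_eq s M) ers e1 ltnn.
Qed.

Lemma porbit_return v e : walk v e (#|porbit (flow e) v| * M) = v.
Proof. by rewrite walk_iter iter_porbit. Qed.

Definition short_cycles k e := [set v | #|porbit (flow e) v| < k].

Lemma porbit_agree k v e e' : (forall u, u \in porbit (flow e) v -> flow e u = flow e' u) ->
  v \in short_cycles k e -> v \in short_cycles k e'.
Proof.
move=> h; rewrite !inE; apply: leq_ltn_trans; apply: subset_leq_card; apply/subsetP=> u.
case/porbitP=> i ->; apply/porbitP; exists i; rewrite !permX; elim: i => //= i ->.
by rewrite h // -permX mem_porbit.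
Qed.

Lemma card_edge_le e j : e \in envs -> #|e j| <= 2.
Proof. by move=> eE; rewrite card_edge //; move/envsP: eE. Qed.

(* An orbit can only change if it meets one of the at most four vertices that the
   two permutations map differently. *)
Lemma short_cycles_slot k e j f : e \in envs -> f \in E ->
  #|short_cycles k e| <= #|short_cycles k (set_slot e j f)| + 4 * k.
Proof.
move=> eE fE; set e' := set_slot e j f.
have e'E : e' \in envs by apply: set_slot_envs.
pose D := [set u | walk u e j \in e j :|: f].
have cardD : #|D| <= 4.
  have inj : injective (fun u => walk u e j).
    move=> u w /eqP; rewrite -[j : nat]add0n -[0](mul0n M) !partial_flowE (inj_eq perm_inj).
    by rewrite mul0n => /eqP.
  rewrite -(card_imset _ inj); apply: leq_trans (_ : #|e j :|: f| <= _).
    by apply: subset_leq_card; apply/subsetP=> w /imsetP[u]; rewrite inE => ? ->.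
  apply: leq_trans (leq_card_setU _ _) _; rewrite -[4]/(2 + 2) leq_add ?card_edge_le //.
  by rewrite card_edge.
have agree u : u \notin D -> flow e u = flow e' u.
  rewrite inE in_setU negb_or => /andP[ue uf]; rewrite -!walk_step.
  have before_j t : t <= j -> walk u e t = walk u e' t.
    elim: t => //= t IH tj; rewrite IH ?(ltnW tj) //; congr (edge_swap _ _); rewrite ffunE.
    case: eqP => // /(congr1 val) /=; rewrite modn_small => [e1|].
      by move: tj; rewrite e1 ltnn.
    exact: ltn_trans (ltn_ord j).
  have jE : slot M_gt0 j = j by apply: val_inj; rewrite /= modn_small.
  have after_j t : j < t -> t <= M -> walk u e t = walk u e' t.
    elim: t => // t IH; rewrite ltnS leq_eqVlt => /orP[/eqP jt|jt] tM; rewrite [LHS]/= [RHS]/=.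
      rewrite -jt jE -before_j // swap_out //; last by move/envsP: eE.
      by rewrite ffunE eqxx swap_out.
    rewrite IH ?(ltnW tM) //; congr (edge_swap _ _); rewrite ffunE; case: eqP => // /(congr1 val) /=.
    by rewrite modn_small // => e1; rewrite e1 ltnn in jt.
  by apply: after_j.
pose bad := \bigcup_(u in D | #|porbit (flow e) u| < k) porbit (flow e) u.
have sub : short_cycles k e \subset short_cycles k e' :|: bad.
  apply/subsetP=> v vs; rewrite in_setU; apply/orP.
  case: (boolP [exists u in D, u \in porbit (flow e) v]) => [/exists_inP[u uD uv]|/exists_inPn h].
    right; apply/bigcupP; exists u; last by rewrite porbit_sym.
    by move: vs; rewrite inE uD; move: uv; rewrite -eq_porbit_mem => /eqP->.
  by left; apply: porbit_agree vs => u uv; apply: agree; apply/negP=> /h; rewrite uv.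
apply: leq_trans (subset_leq_card sub) _; apply: leq_trans (leq_card_setU _ _) _.
rewrite leq_add2l; apply: leq_trans (_ : \sum_(u in D | #|porbit (flow e) u| < k) k <= _).
  apply: leq_trans (_ : \sum_(u in D | #|porbit (flow e) u| < k) #|porbit (flow e) u| <= _).
    rewrite /bad; elim/big_rec2: _ => [|u A m _ IH]; first by rewrite cards0.
    by apply: leq_trans (leq_card_setU _ _) _; rewrite leq_add2l.
  by apply: leq_sum => u /andP[_ /ltnW].
rewrite sum_nat_const leq_mul2r; apply/orP; right; apply: leq_trans cardD.
by apply: subset_leq_card; apply/subsetP=> u; rewrite unfold_in => /andP[].
Qed.

(** Before the orbit closes a vertex is visited at most [M] times, so [k * M] steps need [k]
    distinct vertices, all but the first found by a landing. *)
Lemma long_news v e k : e \in envs -> k <= #|porbit (flow e) v| ->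
  k <= (nmarks (landing M) 0 (k * M) (walk v e)).+1.
Proof.
move=> eE kp; set x := walk v e; have nr : noret x (k * M) by apply: porbit_noret.
apply: leq_trans (_ : (news M 0 (k * M) x).+1 <= _); last by rewrite ltnS news_landings.
rewrite -add1n; have b1 : #|before x 1| <= 1.
  by rewrite beforeS cardsU1 (_ : before x 0 = set0) ?cards0 ?inE //; apply/setP=> y;
    rewrite [RHS]inE; apply/negP=> /imsetP[[]].
apply: leq_trans (_ : #|before x (k * M).+1| <= _); last first.
  by apply: leq_trans (card_before eE (leq0n _) nr) _; rewrite leq_add2r.
rewrite -(leq_pmul2r M_gt0).
have vis y : visits x (k * M) y <= M by apply: visits_le.
apply: leq_trans (_ : \sum_(y in before x (k * M).+1) visits x (k * M) y <= _); last first.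
  by apply: leq_trans (leq_sum _ (fun y _ => vis y)) _; rewrite sum_nat_const.
rewrite /visits exchange_big /= -[X in X <= _]card_ord -sum1_card; apply: leq_sum => s _.
rewrite (bigD1 (x s)) /= ?eqxx //; apply/beforeP; exists (s : nat) => //.
by apply: ltnW; rewrite ltnS.
Qed.

End Flow.

Local Open Scope ring_scope.

Lemma cancel_scale (R : realType) (nn hz N eta : R) : 0 < nn -> 0 < eta ->
  nn * hz * N / (eta * nn) = hz / eta * N.
Proof. by move=> nn0 eta0; field; rewrite !gt_eqF. Qed.

Lemma short_excess (R : realType) (nn s eta mu X Y L : R) : mu <= s * nn ->
  L < (1 - s - 2 * eta) * nn -> nn <= X + Y + L -> Y < eta * nn -> eta * nn <= X - mu.
Proof. by move=> *; lra. Qed.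

(** * From single orbits to the number of vertices in long cycles *)

Section Counts.
Variables (R : realType) (n M : nat) (M_gt0 : (0 < M)%N).
Local Open Scope set_scope.
Local Notation V := (hamming_vertex n).
Local Notation E := (hamming_edges n).
Local Notation env := {ffun 'I_M -> {set V}}.
Local Notation noret := (@noret n M).
Local Notation walk := (@walk n M M_gt0).
Local Notation envs := (envs n M).
Implicit Types (e : env) (v : V).

Definition long_set k e : {set V} := [set v | k <= #|porbit (flow e) v|]%N.

Lemma card_sum (P : pred env) : #|[set e in envs | P e]|%:R = \sum_(e in envs) (P e)%:R :> R.
Proof.
rewrite -sum1_card natr_sum big_mkcond [RHS]big_mkcond /=; apply: eq_bigr => e _.
by rewrite [e \in [set _ in _ | _]]in_set; case: (e \in envs); case: (P e).
Qed.

Lemma card_vertices : #|{: V}| = (n * n)%N.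
Proof. by rewrite card_prod card_ord. Qed.

Lemma long_rare (k : nat) (a z : R) : 0 < a -> a <= #|E|%:R - (n.-1.*2 * k)%:R -> 1 <= z ->
  #|[set e in envs | [exists v, k <= #|porbit (flow e) v|]%N]|%:R <=
  (n * n)%:R * (z ^- k.-1 * (1 + (z - 1) * (n.-1.*2%:R / a)) ^+ (k * M)) * #|envs|%:R.
Proof.
move=> a0 aE z1; rewrite card_sum.
apply: le_trans (_ : \sum_(e in envs) \sum_(v : V)
    (k.-1 <= nmarks (landing M) 0 (k * M) (walk v e))%N%:R <= _).
  apply: ler_sum => e eE; case: (boolP [exists v, _]) => [/existsP[v kv]|_]; last exact: sumr_ge0.
  rewrite (bigD1 v) //= (_ : (k.-1 <= _)%N); first by rewrite lerDl; exact: sumr_ge0.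
  have := long_news M_gt0 eE kv; by case: (k).
rewrite exchange_big /=.
apply: le_trans (_ : \sum_(v : V) z ^- k.-1 * (1 + (z - 1) * (n.-1.*2%:R / a)) ^+ (k * M) * #|envs|%:R <= _).
  apply: ler_sum => v _; apply: markov => //.
  have := @landings R n M M_gt0 (k * M) a a0 _ v 0 (k * M) z z1 (leq0n _) (leqnn _).
  by rewrite mulnK // subn0; apply.
by rewrite sumr_const card_vertices -[X in X <= _]mulr_natl mulrA.
Qed.

Variables (W K : nat) (s hz : R).
Hypothesis survival : forall v, \sum_(e in envs)
  [exists p : 'I_W, [&& (0 < p)%N, noret (walk v e) (p * M) & walk v e (p * M) == v]]%:R <= s * #|envs|%:R.
Hypothesis hazard : forall v, \sum_(e in envs)
  [exists p : 'I_K, [&& (W <= p)%N, noret (walk v e) (p * M) & walk v e (p * M) == v]]%:R <= hz * #|envs|%:R.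

Definition middle e : {set V} := [set v | (W <= #|porbit (flow e) v| < K)%N].

Lemma porbit_gt0 v e : (0 < #|porbit (flow e) v|)%N.
Proof. by apply/card_gt0P; exists v; apply: porbit_id. Qed.

Lemma mean_short : \sum_(e in envs) #|short_cycles W e|%:R <= (n * n)%:R * s * #|envs|%:R :> R.
Proof.
apply: le_trans (_ : \sum_(v : V) s * #|envs|%:R <= _); last first.
  by rewrite sumr_const card_vertices -[X in X <= _]mulr_natl mulrA.
apply: le_trans (ler_sum _ (fun v _ => survival v)); rewrite exchange_big /=.
apply: ler_sum => e eE; rewrite -sum1_card natr_sum big_mkcond /=; apply: ler_sum => v _.
rewrite inE; case: (ltnP _ W) => // pW.
suff -> : [exists p : 'I_W, [&& (0 < p)%N, noret (walk v e) (p * M) & walk v e (p * M) == v]] by [].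
by apply/existsP; exists (Ordinal pW); rewrite /= porbit_gt0 porbit_noret //= porbit_return eqxx.
Qed.

Lemma mean_middle : \sum_(e in envs) #|middle e|%:R <= (n * n)%:R * hz * #|envs|%:R :> R.
Proof.
apply: le_trans (_ : \sum_(v : V) hz * #|envs|%:R <= _); last first.
  by rewrite sumr_const card_vertices -[X in X <= _]mulr_natl mulrA.
apply: le_trans (ler_sum _ (fun v _ => hazard v)); rewrite exchange_big /=.
apply: ler_sum => e eE; rewrite -sum1_card natr_sum big_mkcond /=; apply: ler_sum => v _.
rewrite inE; case: (boolP (_ && _)) => // /andP[Wp pK].
suff -> : [exists p : 'I_K, [&& (W <= p)%N, noret (walk v e) (p * M) & walk v e (p * M) == v]] by [].
by apply/existsP; exists (Ordinal pK); rewrite /= Wp porbit_noret //= porbit_return eqxx.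
Qed.

Lemma short_varies : varies_at_most (4 * W%:R) (fun e => #|short_cycles W e|%:R : R).
Proof.
move=> e j f eE fE; have e'E := set_slot_envs j eE fE; have eS : e j \in E by move/envsP: eE.
have := short_cycles_slot M_gt0 W j eE fE; have := short_cycles_slot M_gt0 W j e'E eS.
have -> : 4 * W%:R = (4 * W)%N%:R :> R by rewrite natrM.
rewrite set_slotK; move: (4 * W)%N (#|_|) (#|_|) => c p p'.
rewrite -!(ler_nat R) !natrD ler_norml => h1 h2; apply/andP; split; lra.
Qed.

(** Chebyshev's inequality for orbits shorter than [W], whose number varies little with one edge;
    Markov's inequality for those between [W] and [K], whose mean is already small. Each deviation
    may use up [eta]. *)
Lemma many_long (eta : R) : 0 < eta -> (0 < n)%N -> (0 < #|E|)%N -> 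
  #|[set e in envs | #|long_set K e|%:R < (1 - s - 2 * eta) * (n * n)%:R]|%:R <=
  (M%:R * (4 * W%:R) ^+ 2 / (eta * (n * n)%:R) ^+ 2 + hz / eta) * #|envs|%:R.
Proof.
move=> eta0 n0 E0; have nn0 : 0 < (n * n)%:R :> R by rewrite ltr0n muln_gt0 n0.
have N0 : 0 < #|envs|%:R :> R.
  rewrite ltr0n; apply/card_gt0P; case/card_gt0P: E0 => f fE.
  by exists [ffun=> f]; apply/envsP=> i; rewrite ffunE.
pose X e : R := #|short_cycles W e|%:R; pose mu := (\sum_(e in envs) X e) / #|envs|%:R.
have muE : \sum_(e in envs) X e = mu * #|envs|%:R by rewrite mulfVK // gt_eqF.
have mus : mu <= s * (n * n)%:R by rewrite ler_pdivrMr // (mulrC s); exact: mean_short.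
have v0 : V by exact: (Ordinal n0, Ordinal n0).
have es := efron_stein M_gt0 v0 E0 short_varies muE.
pose Y e : R := #|middle e|%:R.
have c1 : 0 < (eta * (n * n)%:R) ^+ 2 by rewrite exprn_gt0 // mulr_gt0.
apply: le_trans (_ : \sum_(e in envs) ((X e - mu) ^+ 2 / (eta * (n * n)%:R) ^+ 2 +
    Y e / (eta * (n * n)%:R)) <= _); last first.
  rewrite big_split /= -!mulr_suml mulrDl lerD //.
    apply: le_trans (ler_wpM2r _ es) _; first by rewrite invr_ge0 ltW.
    by rewrite mulrAC.
  apply: le_trans (ler_wpM2r _ mean_middle) _; first by rewrite invr_ge0 mulr_ge0 // ltW.
  by rewrite cancel_scale.
rewrite card_sum; apply: ler_sum => e eE.
have Y0 : 0 <= Y e / (eta * (n * n)%:R) by rewrite divr_ge0 // mulr_ge0 // ltW.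
have X0 : 0 <= (X e - mu) ^+ 2 / (eta * (n * n)%:R) ^+ 2 by rewrite divr_ge0 ?sqr_ge0 // ltW.
case: ltP => [few|_]; last exact: addr_ge0.
have part : (n * n)%:R <= X e + Y e + #|long_set K e|%:R :> R.
  rewrite -card_vertices -!natrD ler_nat -cardsT.
  apply: leq_trans (_ : #|short_cycles W e :|: middle e :|: long_set K e| <= _)%N.
    apply: subset_leq_card; apply/subsetP=> v _; rewrite !inE.
    by case: (ltnP _ W) => //= _; case: (ltnP _ K).
  by apply: leq_trans (leq_card_setU _ _) _; rewrite leq_add2r leq_card_setU.
have [Yb|Yb] := leP (eta * (n * n)%:R) (Y e).
  by rewrite (le_trans _ (_ : Y e / (eta * (n * n)%:R) <= _)) ?lerDr // ler_pdivlMr ?mulr_gt0 // mul1r.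
apply: le_trans (_ : (X e - mu) ^+ 2 / (eta * (n * n)%:R) ^+ 2 <= _); last by rewrite lerDl.
have gap := short_excess mus few part Yb.
have e0 : 0 <= eta * (n * n)%:R by rewrite mulr_ge0 // ltW.
by rewrite ler_pdivlMr // mul1r; apply: lerXn2r; rewrite ?nnegrE // (le_trans e0 gap).
Qed.

End Counts.

(** * Asymptotics, subcritical *)

Local Open Scope ring_scope.
Local Open Scope set_scope.

Lemma nat_above (R : realType) (x : R) : exists n0, forall m : nat, (n0 <= m)%N -> x <= m%:R.
Proof.
exists (Num.truncn x).+1 => m h; apply: le_trans (ltW (real_truncnS_gt (num_real x))) _.
by rewrite ler_nat.
Qed.

Lemma exprD1_le (R : realType) (x y : R) m : 0 <= x -> x * m%:R <= y -> (1 + x) ^+ m <= expR y.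
Proof.
move=> x0 xy; apply: le_trans (_ : expR x ^+ m <= _); last by rewrite -expRM_natr ler_expR.
by apply: lerXn2r; rewrite ?nnegrE ?expR_ge0 ?expR_ge1Dx // addr_ge0.
Qed.

Lemma double_predR (R : realType) n : (0 < n)%N -> n.-1.*2%:R = 2 * (n%:R - 1) :> R.
Proof. by move=> n0; rewrite -muln2 natrM mulrC; case: n n0 => // m _; rewrite /= -[m.+1%:R]natr1 addrK. Qed.

Lemma card_edgesR (R : realType) n : (0 < n)%N ->
  #|hamming_edges n|%:R = n%:R ^+ 2 * (n%:R - 1) :> R.
Proof. by case: n => // m _; rewrite card_edges !natrM /= -[m.+1%:R]natr1; ring. Qed.

Lemma subcritical_arith (R : realType) (lam beta n2 k M : R) : 2 * lam * k <= (lam - 2 * beta) * n2 ->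
  M <= beta * n2 -> 2 * M <= lam * (n2 - 2 * k).
Proof. by move=> *; lra. Qed.

Section Subcritical.
Variables (R : realType) (beta lam c : R).
Hypotheses (lam_gt0 : 0 < lam) (lam_lt1 : lam < 1) (lb : 0 < lam - 2 * beta)
  (c_gt0 : 0 < c) (cE : c = lam - 1 - ln lam).

Lemma subcritical_rate (n k M : R) : 0 < n -> 0 <= k -> 2 * lam * k <= (lam - 2 * beta) * n ^+ 2 ->
  0 <= M -> M <= beta * n ^+ 2 -> 0 < n ^+ 2 - 2 * k ->
  (lam^-1 - 1) * (2 / (n ^+ 2 - 2 * k)) * (k * M) <= (1 - lam) * k.
Proof.
move=> n0 k0 h M0 hM d0.
have -> : (lam^-1 - 1) * (2 / (n ^+ 2 - 2 * k)) * (k * M) =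
    (1 - lam) * k * ((2 * M) / (lam * (n ^+ 2 - 2 * k))) by field; rewrite !gt_eqF.
rewrite -[X in _ <= X]mulr1 ler_wpM2l ?mulr_ge0 ?subr_ge0 ?(ltW lam_lt1) //.
rewrite ler_pdivrMr; last by rewrite mulr_gt0.
by rewrite ?mul1r; exact: subcritical_arith h hM.
Qed.

Lemma subcritical_rare_aux : exists C : R, 0 < C /\ forall eps : R, 0 < eps ->
  exists n0, forall n M : nat, (n0 <= n)%N -> (0 < M)%N -> M%:R <= beta * n%:R ^+ 2 ->
  #|[set e in envs n M | [exists v, C * ln n%:R <= #|porbit (flow e) v|%:R]]|%:R
    <= eps * #|envs n M|%:R :> R.
Proof.
(* The exponential rate per unit of length is [c], so this length gives [n^-3], against the [n^2]
   starting vertices of the union bound. *)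
exists (3 / c); split; first by rewrite divr_gt0.
have C0 : 0 < 3 / c by rewrite divr_gt0.
have CE : c * (3 / c) = 3 by field; rewrite gt_eqF.
move: (3 / c) C0 CE => C C0 CE eps eps0.
have [n1 hn1] := nat_above (4 * C + 2 * lam * C / (lam - 2 * beta)).
have [n2 hn2] := nat_above (lam^-1 * expR c / eps).
exists (maxn 2 (maxn n1 n2)) => n M; rewrite !geq_max => /and3P[n2' /hn1 nC /hn2 neps] M0 Mb.
have n0 : (0 < n)%N by apply: leq_trans n2'.
have nr0 : 0 < n%:R :> R by rewrite ltr0n.
have n1r : 0 < n%:R - 1 :> R by rewrite subr_gt0 ltr1n.
have ln0 : 0 <= ln n%:R :> R by rewrite ln_ge0 // ler1n.
set k := Num.truncn (C * ln n%:R).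
have /andP[kle kgt] : k%:R <= C * ln n%:R < k.+1%:R by apply: truncn_itv; rewrite mulr_ge0 // ltW.
have lnn := ltW (ln_sublinear nr0).
have kn : k%:R <= C * n%:R by apply: le_trans kle _; rewrite ler_wpM2l // ltW.
have D0 : 0 <= 2 * lam * C / (lam - 2 * beta) by apply/ltW; rewrite divr_gt0 // mulr_gt0 // mulr_gt0.
have C4 : 4 * C <= n%:R by apply: le_trans nC; rewrite lerDl.
have Cl : 2 * lam * C <= (lam - 2 * beta) * n%:R.
  by rewrite -ler_pdivrMl // mulrC; apply: le_trans nC; rewrite lerDr; apply/ltW; rewrite mulr_gt0.
have n2k : 0 < n%:R ^+ 2 - 2 * k%:R :> R.
  have : C * n%:R * 4 <= n%:R * n%:R by rewrite mulrAC ler_wpM2r // mulrC.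
  by move: kn nr0; rewrite expr2; nra.
pose a : R := (n%:R - 1) * (n%:R ^+ 2 - 2 * k%:R).
have a0 : 0 < a by rewrite mulr_gt0.
have aE : a <= #|hamming_edges n|%:R - (n.-1.*2 * k)%:R.
  by rewrite card_edgesR // natrM double_predR // /a le_eqVlt; apply/orP; left; apply/eqP; ring.
have z1 : 1 <= lam^-1 by rewrite invf_ge1 // ltW.
have := long_rare M0 a0 aE z1 => H.
have sub : #|[set e in envs n M | [exists v, C * ln n%:R <= #|porbit (flow e) v|%:R :> R]]|%:R <=
   #|[set e in envs n M | [exists v, k <= #|porbit (flow e) v|]%N]|%:R :> R.
  rewrite ler_nat; apply: subset_leq_card; apply/subsetP=> e /setIdP[eE /existsP[v hv]].
  by apply/setIdP; split=> //; apply/existsP; exists v; rewrite -(ler_nat R) (le_trans kle).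
apply: le_trans sub _; apply: le_trans H _; rewrite ler_wpM2r //.
have r2 : n.-1.*2%:R / a = 2 / (n%:R ^+ 2 - 2 * k%:R).
  by rewrite double_predR // /a; field; rewrite !gt_eqF.
have r0 : 0 <= (lam^-1 - 1) * (n.-1.*2%:R / a) by rewrite mulr_ge0 ?subr_ge0 // divr_ge0 // ltW.
have up : (1 + (lam^-1 - 1) * (n.-1.*2%:R / a)) ^+ (k * M) <= expR ((1 - lam) * k%:R).
  apply: exprD1_le => //; rewrite natrM r2; apply: subcritical_rate => //.
  rewrite -mulrA; apply: le_trans (_ : 2 * (lam * (C * n%:R)) <= _).
    by rewrite !ler_wpM2l // ltW.
  have -> : 2 * (lam * (C * n%:R)) = 2 * lam * C * n%:R by rewrite -!mulrA.
  by rewrite expr2 [X in _ <= X]mulrA ler_wpM2r.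
have zk : lam^-1 ^- k.-1 <= lam^-1 * expR (k%:R * ln lam).
  rewrite expRM_natl lnK ?posrE // exprVn invrK; case: (k) => [|m].
    by rewrite /= !expr0 mulr1.
  by rewrite exprS mulKf ?gt_eqF.
have main : lam^-1 ^- k.-1 * (1 + (lam^-1 - 1) * (n.-1.*2%:R / a)) ^+ (k * M) <=
    lam^-1 * expR c * n%:R ^- 3.
  apply: le_trans (ler_pM _ _ zk up) _; rewrite ?exprn_ge0 ?addr_ge0 //.
    by rewrite invr_ge0 exprn_ge0 // invr_ge0 ltW.
  rewrite -!mulrA ler_wpM2l ?invr_ge0 ?(ltW lam_gt0) // -expRD.
  have -> : n%:R ^- 3 = expR (- (3 * ln n%:R)) :> R.
    by rewrite expRN expRM_natl lnK ?posrE.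
  rewrite -expRD ler_expR.
  have : c * C * ln n%:R <= c * k.+1%:R by rewrite -mulrA ler_wpM2l ?(ltW c_gt0) // ltW.
  by rewrite CE -natr1 cE; lra.
apply: le_trans (ler_wpM2l _ main) _ => //.
have -> : (n * n)%:R * (lam^-1 * expR c * n%:R ^- 3) = lam^-1 * expR c / n%:R.
  by rewrite natrM; field; rewrite !gt_eqF.
by rewrite ler_pdivrMr // -ler_pdivrMl // mulrC.
Qed.

End Subcritical.

Lemma subcritical_rare (R : realType) (beta : R) : 0 < beta -> beta < 1 / 2 ->
  exists C : R, 0 < C /\ forall eps : R, 0 < eps ->
  exists n0, forall n M : nat, (n0 <= n)%N -> (0 < M)%N -> M%:R <= beta * n%:R ^+ 2 ->
  #|[set e in envs n M | [exists v, C * ln n%:R <= #|porbit (flow e) v|%:R]]|%:R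
    <= eps * #|envs n M|%:R :> R.
Proof.
(* A value strictly between [2 * beta] and 1: the gap to [2 * beta] absorbs the edges excluded by
   the past, and the gap to 1 makes the rate [lam - 1 - ln lam] positive. The exponential moment is
   taken at [lam^-1]. *)
move=> beta_gt0 beta_lt; pose lam : R := (1 + 2 * beta) / 2.
have lam_gt0 : 0 < lam by rewrite /lam; lra.
have lam_lt1 : lam < 1 by rewrite /lam; lra.
have lb : 0 < lam - 2 * beta by rewrite /lam; lra.
apply: (subcritical_rare_aux lam_gt0 lam_lt1 lb _ erefl).
have h : ln lam != 0.
  apply/eqP=> h; have := lnK (x := lam); rewrite h expR0 posrE lam_gt0 => /(_ isT) e.
  by move: lam_lt1; rewrite -e ltxx.
by have := expR_gt1Dx h; rewrite lnK ?posrE ?lam_gt0 // -addrA -opprD subr_gt0.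
Qed.

(** * Asymptotics, supercritical *)

Local Open Scope ring_scope.
Local Open Scope set_scope.

Lemma locality_ge0 (R : realType) M (gamma phi delta a : R) W1 W2 B : phi < 1 -> 0 < a ->
  0 <= locality M gamma phi delta W1 W2 B a.
Proof.
move=> phi1 a0; rewrite /locality; apply: addr_ge0; first apply: addr_ge0.
- by rewrite mulr_ge0 ?mulr_ge0 ?exprn_ge0 // invr_ge0 exprn_ge0 // ltW.
- by rewrite mulr_ge0 ?expR_ge0 // exprn_ge0 // mulr_ge0 // divr_ge0 // ltW.
- by rewrite mulr_ge0 ?invr_ge0 ?subr_ge0 ?(ltW phi1) // addr_ge0 ?expR_ge0.
Qed.

(** * The supercritical bound at fixed size *)

Section SupercriticalFinite.
Variables (R : realType) (n M : nat) (M_gt0 : (0 < M)%N).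
Local Notation E := (hamming_edges n).
Local Notation walk := (@walk n M M_gt0).
Local Notation envs := (envs n M).
Variables (gamma phi delta b S : R) (h : nat).
Hypotheses (phi_gt0 : 0 < phi) (phi_lt1 : phi < 1) (gamma_gt0 : 0 < gamma)
  (delta_gt0 : 0 < delta) (b_gt0 : 0 < b) (S_ge0 : 0 <= S).
Hypothesis bE : b * #|E|%:R <= M%:R * (n.-1%:R - h%:R).
Hypothesis SE : 4 * h%:R * M%:R <= S * #|E|%:R.
Hypothesis bent_cond : delta + gamma <= 2 * b * (1 - expR (- gamma)).
Hypothesis old_cond : delta <= 2 * b * phi.
Hypothesis straight_cond : phi + delta + S * phi <= b * (1 - phi - expR (- gamma)).
Hypothesis known_cond : phi <= (1 - phi) * gamma.
Variables (W1 W2 B k : nat) (a eta : R).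
Local Notation W := (W1 + W2)%N.
Local Notation L := (W * M)%N.
Local Notation T := (k.+1 * W * M)%N.
Hypothesis few_news : (gamma + delta) * (k.+1 * B)%:R <= delta / 2 * M%:R.
Hypothesis a_gt0 : 0 < a.
Hypothesis aE : a <= #|E|%:R - (n.-1.*2 * (k.+1 * W))%:R.
Hypothesis EA : (n.-1.*2 * (k.+1 * W) * 2 <= #|E|)%N.
Hypothesis h_large : (B.+1 < h)%N.

Local Notation rho := (locality M gamma phi delta W1 W2 B a).

Definition survival_bound : R :=
  expR (- gamma) + crowding n L B a + ((1 + B.+1%:R / a) ^+ L - 1).
Definition hazard_bound : R :=
  (k * W)%:R * rho + T%:R * crowding n L B a + 2 * n%:R * heaviness n h L B T a rho.

Lemma supercritical_finite : 0 < eta -> (0 < n)%N -> (0 < #|E|)%N ->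
  #|[set e in envs | #|long_set (k * W) e|%:R < (1 - survival_bound - 2 * eta) * (n * n)%:R]|%:R <=
  (M%:R * (4 * W%:R) ^+ 2 / (eta * (n * n)%:R) ^+ 2 + hazard_bound / eta) * #|envs|%:R.
Proof.
move=> eta0 n0 E0.
have LT : (L <= T)%N by rewrite -mulnA leq_pmull.
have aT : a <= #|E|%:R - (n.-1.*2 * (T %/ M))%:R by rewrite mulnK.
have aL : a <= #|E|%:R - (n.-1.*2 * (L %/ M))%:R.
  apply: le_trans aT _; rewrite lerD2l lerN2 ler_nat leq_mul2l leq_div2r ?orbT //.
have EL : (n.-1.*2 * (L %/ M) * 2 <= #|E|)%N.
  apply: leq_trans EA; rewrite mulnK // leq_mul2r leq_mul2l mulSn leq_addr !orbT //.
apply: (many_long (M_gt0 := M_gt0)) => // v.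
  apply: (survival M_gt0 phi_gt0 phi_lt1 gamma_gt0 delta_gt0 b_gt0 S_ge0 bE SE bent_cond old_cond
    straight_cond known_cond a_gt0 aL EL) => //; last exact: (ltnW h_large).
  apply: le_trans few_news; rewrite ler_wpM2l ?addr_ge0 ?(ltW gamma_gt0) ?(ltW delta_gt0) //.
  by rewrite ler_nat mulSn leq_addr.
have rho0 : 0 <= rho by exact: locality_ge0.
have loc u t0 z (G : (nat -> hamming_vertex n) -> R) : adapted t0 G -> (forall x, 0 <= G x) ->
    (t0 + L <= T)%N ->
    \sum_(e in envs) G (walk u e) * (admissible M h L B (walk u e) (t0 + L) && (walk u e (t0 + L) == z))%:R
      <= rho * \sum_(e in envs) G (walk u e).
  move=> aG G0 tT.
  apply: (localization M_gt0 phi_gt0 phi_lt1 gamma_gt0 delta_gt0 b_gt0 S_ge0 bE SE bent_cond old_cond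
    straight_cond known_cond few_news) => //; first by rewrite mulnA.
    by apply: le_trans aT _; rewrite lerD2l lerN2 ler_nat leq_mul2l leq_div2r ?orbT.
  apply: leq_trans EA; rewrite leq_mul2r leq_mul2l; apply/orP; right; apply/orP; right.
  by rewrite -[(k.+1 * W)%N](mulnK _ M_gt0) leq_div2r.
apply: le_trans (hazard a_gt0 aT rho0 loc h_large v (k * W) LT).
apply: ler_sum => e _; case: (boolP [exists p : 'I_(k * W), _]) => // /existsP[p /and3P[Wp nr xv]].
rewrite (_ : [exists p0 : 'I_(k * W), _]) //; apply/existsP; exists p.
rewrite nr xv leq_mul2r Wp orbT /= andbT -mulnDl leq_mul2r mulSnr leq_add2r.
by rewrite (ltnW (ltn_ord p)) orbT.
Qed.

End SupercriticalFinite.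

Lemma exp_decay (R : realType) (c : R) m : 0 < c ->
  exists D : R, 0 < D /\ forall x, 0 <= x -> x ^+ m * expR (- (c * x)) <= D.
Proof.
move=> c0; exists (m.+1`!%:R / c ^+ m.+1 + 1).
have D0 : 0 < m.+1`!%:R / c ^+ m.+1 :> R by rewrite divr_gt0 ?exprn_gt0 // ltr0n fact_gt0.
split=> [|x x0]; first by rewrite addr_gt0.
have [x1|x1] := leP x 1.
  apply: le_trans (_ : 1 * 1 <= _); last by rewrite mul1r lerDr ltW.
  apply: ler_pM; rewrite ?exprn_ge0 ?expR_ge0 ?exprn_ile1 //.
  by rewrite -[X in _ <= X]expR0 ler_expR oppr_le0 mulr_ge0 // ltW.
apply: le_trans (_ : m.+1`!%:R / c ^+ m.+1 <= _); last by rewrite lerDl.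
have cx : 0 < c * x by rewrite mulr_gt0 // (lt_trans _ x1).
have := expR_ge1Dxn m (ltW cx); set f := m.+1`!%:R => hx.
have f0 : 0 < f by rewrite ltr0n fact_gt0.
have xx : 0 < x by apply: lt_trans x1.
rewrite expRN ler_pdivrMr ?expR_gt0 //.
apply: le_trans (_ : f / c ^+ m.+1 * ((c * x) ^+ m.+1 / f) <= _); last first.
  by rewrite ler_wpM2l ?(ltW D0) // (le_trans _ hx) // lerDr.
have -> : f / c ^+ m.+1 * ((c * x) ^+ m.+1 / f) = x ^+ m.+1.
  rewrite exprMn; have : 0 < c ^+ m.+1 by rewrite exprn_gt0.
  move: (c ^+ m.+1) (x ^+ m.+1) => u y u0.
  by field; rewrite !gt_eqF.
by rewrite exprS ler_peMl ?exprn_ge0 // ltW.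
Qed.

(** As [w] is comparable to a root of [n], powers of [n] become powers of [w], which the exponential
    absorbs. *)
Lemma exp_poly (R : realType) (c : R) j q : 0 < c ->
  exists D : R, 0 < D /\ forall n w, 0 <= n -> 0 <= w -> n <= (2 * w) ^+ q ->
    n ^+ j * w * expR (- (c * w)) <= D.
Proof.
move=> c0; have [D [D0 hD]] := exp_decay (q * j).+1 c0.
exists (2 ^+ (q * j) * D); split=> [|n w n0 w0 nw]; first by rewrite mulr_gt0 // exprn_gt0.
apply: le_trans (_ : 2 ^+ (q * j) * (w ^+ (q * j).+1 * expR (- (c * w))) <= _); last first.
  by rewrite ler_wpM2l ?exprn_ge0 // hD.
rewrite mulrA ler_wpM2r ?expR_ge0 // exprSr mulrA ler_wpM2r // -exprMn exprM.
by apply: lerXn2r; rewrite ?nnegrE ?exprn_ge0 ?mulr_ge0.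
Qed.

Local Open Scope ring_scope.
Local Open Scope set_scope.

(** * Elementary estimates of the error terms *)

Section Asymptotics.
Variable R : realType.
Implicit Types (n w M a x y z C D rho : R).

Lemma half_edges n : 2 <= n -> n ^+ 3 / 4 <= n ^+ 2 * (n - 1) / 2.
Proof. by move=> n2; have := sqr_ge0 n; rewrite !exprS expr0 mulr1 => n0; nra. Qed.

Lemma steps_ratio n w M C beta : 2 <= n -> 0 <= w -> 0 <= C -> 0 <= beta -> M <= beta * n ^+ 2 ->
  C * w * M / (n ^+ 2 * (n - 1) / 2) <= 4 * C * beta * (w / n).
Proof.
move=> n2 w0 C0 b0 hM; have n0 : 0 < n by lra.
have a0 : 0 < n ^+ 2 * (n - 1) / 2 by rewrite divr_gt0 // mulr_gt0 ?exprn_gt0 //; lra.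
rewrite ler_pdivrMr //; apply: le_trans (_ : C * w * (beta * n ^+ 2) <= _).
  by rewrite ler_wpM2l // mulr_ge0.
have -> : 4 * C * beta * (w / n) * (n ^+ 2 * (n - 1) / 2) = C * w * beta * (2 * (n * (n - 1))).
  by field; rewrite gt_eqF.
by rewrite -[X in _ <= X]mulrA ler_wpM2l ?mulr_ge0 // ler_wpM2l // expr2; nra.
Qed.

Lemma exp_half x : 0 <= x -> x <= 1 -> expR (x / 2) <= 1 + x.
Proof.
move=> x0 x1; have := expR_ge1Dx (- (x / 2)); rewrite expRN => h.
have d0 : 0 < 1 - x / 2 by lra.
apply: le_trans (_ : (1 - x / 2)^-1 <= _).
  by rewrite -[X in X <= _]invrK lef_pV2 ?posrE ?invr_gt0 ?expR_gt0.
by rewrite -[X in X <= _]mul1r ler_pdivrMr //; nra.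
Qed.

Lemma exp_double x : 0 <= x -> x <= 1 / 2 -> expR x - 1 <= 2 * x.
Proof.
move=> x0 x1; have h : 2 * x / 2 = x by field.
by have := @exp_half (2 * x); rewrite h => /(_ _ _)/le_trans; rewrite lerBlDl; apply; lra.
Qed.

Lemma locality_arith n w y c C D p e E1 E2 : 1 <= w -> 0 < n -> 0 <= y -> y <= c * (w / n) -> 0 <= c ->
  0 <= C -> 0 <= e -> 0 <= p -> 0 <= D -> E1 * n ^+ 2 <= D -> E2 * n ^+ 2 <= D ->
  2 * y ^+ 2 + e * (C * w * y) ^+ 2 + p * (E1 + E2) <=
  (2 * c ^+ 2 + e * C ^+ 2 * c ^+ 2 + 2 * p * D) * (w ^+ 4 / n ^+ 2).
Proof.
move=> w1 n0 y0 yc c0 C0 e0 p0 D0 h1 h2; have w0 : 0 <= w by apply: le_trans w1.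
have n2 : 0 < n ^+ 2 by rewrite exprn_gt0.
have y2 : y ^+ 2 <= c ^+ 2 * w ^+ 2 / n ^+ 2.
  have -> : c ^+ 2 * w ^+ 2 / n ^+ 2 = (c * (w / n)) ^+ 2 by rewrite !exprMn exprVn mulrA.
  by apply: lerXn2r; rewrite ?nnegrE // mulr_ge0 // divr_ge0 // ltW.
have w24 : w ^+ 2 <= w ^+ 4 by apply: ler_weXn2l.
have w4 : 1 <= w ^+ 4 by apply: exprn_ege1.
set r := w ^+ 4 / n ^+ 2.
have -> : (2 * c ^+ 2 + e * C ^+ 2 * c ^+ 2 + 2 * p * D) * r =
  2 * (c ^+ 2 * r) + e * C ^+ 2 * c ^+ 2 * r + 2 * p * D * r by ring.
rewrite /r; apply: lerD; first apply: lerD.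
- rewrite ler_wpM2l //; apply: le_trans y2 _.
  by rewrite [X in _ <= X]mulrA ler_wpM2r ?invr_ge0 ?(ltW n2) // ler_wpM2l ?exprn_ge0.
- have -> : e * C ^+ 2 * c ^+ 2 * (w ^+ 4 / n ^+ 2) = e * (C ^+ 2 * w ^+ 2 * (c ^+ 2 * w ^+ 2 / n ^+ 2)).
    by have -> : w ^+ 4 = w ^+ 2 * w ^+ 2 by [rewrite -exprD]; ring.
  by rewrite ler_wpM2l // !exprMn ler_wpM2l // mulr_ge0 ?exprn_ge0.
have Ed E : E * n ^+ 2 <= D -> E <= D * (w ^+ 4 / n ^+ 2).
  move=> h; rewrite mulrA ler_pdivlMr //; apply: le_trans h _.
  by rewrite ler_peMr.
have -> : 2 * p * D * (w ^+ 4 / n ^+ 2) = p * (D * (w ^+ 4 / n ^+ 2) + D * (w ^+ 4 / n ^+ 2)) by ring.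
by rewrite ler_wpM2l // lerD // Ed.
Qed.

(** With [expR (1 / 2) <= 2] the exponent is at most [- C * w / 2 + 4 * c * w]; the condition on [C]
    brings it below [- w]. *)
Lemma crowding_bound (n B L : nat) a w C c : 0 <= w -> (2 <= n)%N ->
  a = n%:R ^+ 2 * (n%:R - 1) / 2 -> L%:R <= c * w * n%:R ^+ 2 -> B%:R = C * w -> 8 * c + 2 <= C ->
  crowding n L B a <= expR (- w).
Proof.
move=> w0 n2 aE hL hB hC; have n0 : (0 < n)%N by apply: leq_trans n2.
have nr : 0 < n%:R :> R by rewrite ltr0n.
have n1 : 0 < n%:R - 1 :> R by rewrite subr_gt0 ltr1n.
have r4 : n.-1.*2%:R / a = 4 / n%:R ^+ 2 by rewrite double_predR // aE; field; rewrite !gt_eqF.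
rewrite /crowding r4.
have up : (1 + 4 / n%:R ^+ 2) ^+ L <= expR (4 * c * w).
  apply: exprD1_le; first by rewrite divr_ge0 // exprn_ge0 // ltW.
  rewrite mulrAC ler_pdivrMr ?exprn_gt0 //.
  have -> : 4 * c * w * n%:R ^+ 2 = 4 * (c * w * n%:R ^+ 2) by ring.
  by rewrite ler_wpM2l.
have low : 2 ^- B.+1 <= expR (- (B%:R / 2)) :> R.
  rewrite expRN lef_pV2 ?posrE ?expR_gt0 ?exprn_gt0 //.
  apply: le_trans (_ : 2 ^+ B <= _); last by apply: ler_weXn2l; rewrite ?ler1n.
  rewrite expRM_natl; apply: lerXn2r; rewrite ?nnegrE ?expR_ge0 ?ler0n //.
  by have := @exp_half 1 ler01 (lexx 1); rewrite mul1r.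
apply: le_trans (ler_pM _ _ low up) _; rewrite ?invr_ge0 ?exprn_ge0 ?addr_ge0 ?divr_ge0 ?exprn_ge0 //.
by rewrite -expRD ler_expR hB; nra.
Qed.

(** Both factors are exponentials at scale [B.+1%:R^-1]: the tail exponent is at least
    [n / (4 * kap)] in this unit, the moment exponent at most half of that by hypothesis. *)
Lemma heaviness_bound (n h L B T : nat) a rho Y kap : 0 < kap -> 0 < a -> 0 <= rho ->
  n%:R / (2 * kap) <= (h - B.+1)%:R -> a^-1 * (1 + n%:R * (n%:R * rho)) * T%:R <= Y ->
  expR 1 * Y <= n%:R / (8 * kap) ->
  heaviness n h L B T a rho <= expR (- (n%:R / (8 * kap * B.+1%:R))).
Proof.
move=> k0 a0 rho0 hh hY hn; rewrite /heaviness /=.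
set z := 1 + B.+1%:R^-1; set y := a^-1 * _ in hY *.
have b0 : 0 < B.+1%:R :> R by [].
have z1 : z - 1 = B.+1%:R^-1 by rewrite /z addrC addKr.
have y0 : 0 <= y by rewrite mulr_ge0 ?invr_ge0 ?(ltW a0) // addr_ge0 // !mulr_ge0.
have z0 : 0 < z by rewrite addr_gt0 // invr_gt0.
clearbody y.
have zB : z ^+ B <= expR 1.
  apply: exprD1_le; rewrite ?invr_ge0 // mulrC ler_pdivrMr // mul1r ler_nat.
  exact: leqnSn.
have up : (1 + (z - 1) * (z ^+ B * y)) ^+ (T - L) <= expR (B.+1%:R^-1 * (expR 1 * Y)).
  apply: exprD1_le; first by rewrite z1 mulr_ge0 ?invr_ge0 // mulr_ge0 ?exprn_ge0 // ltW.
  rewrite z1 -mulrA ler_wpM2l ?invr_ge0 // -mulrA; apply: ler_pM; rewrite ?exprn_ge0 ?mulr_ge0 ?(ltW z0) //.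
  apply: le_trans hY; rewrite ler_wpM2l // ler_nat; exact: leq_subr.
have low : z ^- (h - B.+1) <= expR (- (B.+1%:R^-1 * (n%:R / (4 * kap)))).
  rewrite expRN lef_pV2 ?posrE ?expR_gt0 ?exprn_gt0 //.
  apply: le_trans (_ : expR (B.+1%:R^-1 / 2) ^+ (h - B.+1) <= _); last first.
    apply: lerXn2r; rewrite ?nnegrE ?expR_ge0 ?(ltW z0) //; apply: exp_half; rewrite ?invr_ge0 //.
    by rewrite invf_le1 // ler1n.
  rewrite -expRM_natl ler_expR; set hB := (h - B.+1)%:R in hh *; set iB := B.+1%:R^-1.
  have -> : hB * (iB / 2) = iB * (hB / 2) by ring.
  rewrite ler_wpM2l ?invr_ge0 // ler_pdivlMr //; apply: le_trans hh; rewrite le_eqVlt.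
  by apply/orP; left; apply/eqP; field; rewrite gt_eqF.
have u0 : 0 <= 1 + (z - 1) * (z ^+ B * y).
  by rewrite addr_ge0 // z1 mulr_ge0 ?invr_ge0 // mulr_ge0 ?exprn_ge0 // ltW.
apply: le_trans (ler_pM _ _ low up) _.
- by rewrite invr_ge0 exprn_ge0 // ltW.
- exact: exprn_ge0.
rewrite -expRD ler_expR -mulrN -mulrDr.
have -> : n%:R / (8 * kap * B.+1%:R) = B.+1%:R^-1 * (n%:R / (8 * kap)).
  by rewrite [in LHS]invfM [LHS]mulrA [LHS]mulrC.
rewrite -[X in _ <= X]mulrN ler_wpM2l ?invr_ge0 //.
have -> : n%:R / (4 * kap) = n%:R / (8 * kap) + n%:R / (8 * kap) by field; rewrite gt_eqF.
by move: hn; lra.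
Qed.

Lemma exp_inverse_square x : 0 < x -> expR (- x) <= 2 / x ^+ 2.
Proof.
move=> x0; rewrite expRN -[2 / _]invf_div lef_pV2 ?posrE ?expR_gt0 ?divr_gt0 ?exprn_gt0 //.
by apply: le_trans (expR_ge1Dxn 1 (ltW x0)); rewrite lerDr.
Qed.

End Asymptotics.

Local Open Scope ring_scope.
Local Open Scope set_scope.

Lemma regime_arith (R : realType) (N kap h C w B : R) : N <= kap * (h + 1) ->
  2 * kap * (C + 2) * w <= N -> 1 <= w -> B = C * w + 1 -> 0 < kap ->
  N + 2 * kap * B <= h * (2 * kap).
Proof. by move=> h1 h2 w1 -> k0; nra. Qed.

Lemma regime_arith2 (R : realType) (N2 N1 X : R) : 0 <= N1 -> X * 4 <= N2 ->
  N2 * N1 / 2 <= N2 * N1 - 2 * N1 * X.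
Proof. by move=> h1 h2; nra. Qed.

Lemma regime_arith3 (R : realType) (N2 N1 X : R) : 0 <= N1 -> X * 4 <= N2 ->
  2 * N1 * X * 2 <= N2 * N1.
Proof. by move=> h1 h2; nra. Qed.

Lemma half_arith (R : realType) (u w : R) : 2 * u <= w -> u <= 1 / 2 * w.
Proof. by move=> *; lra. Qed.

(** * Choice of the scales *)

Section Regime.
Variables (R : realType) (n M w kap C3 C4 q : nat) (beta1 beta2 gamma phi delta eta D1 D2 : R).
Local Notation N := (n%:R : R).
Local Notation w' := (w%:R : R).
Local Notation Cw := (C3.+1%:R : R).
(** Lines may hold up to [n / kap] visited vertices. Relative to [n - 1] this is at most [2 / kap],
    because [n <= 2 * (n - 1)]. *)
Let b := beta1 * (1 - 2 / kap%:R).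
Let S := 8 * beta2 / kap%:R.
Hypotheses (beta1_gt : 1 / 2 < beta1) (beta2_gt0 : 0 < beta2)
  (ML : beta1 * N ^+ 2 <= M%:R) (MU : M%:R <= beta2 * N ^+ 2).
Hypotheses (kap_gt : (2 < kap)%N) (phi_gt0 : 0 < phi) (phi_lt1 : phi < 1) (gamma_gt0 : 0 < gamma)
  (delta_gt0 : 0 < delta).
Hypothesis bent_cond : delta + gamma <= 2 * b * (1 - expR (- gamma)).
Hypothesis old_cond : delta <= 2 * b * phi.
Hypothesis straight_cond : phi + delta + S * phi <= b * (1 - phi - expR (- gamma)).
Hypothesis known_cond : phi <= (1 - phi) * gamma.
Hypotheses (C3_large : 1 + 2 * gamma / delta <= C3%:R) (C4_large : 8 * (Cw * beta2) + 2 <= C4%:R).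
Hypotheses (w_ge2 : (2 <= w)%N) (wn : w' ^+ 9 <= N).
Hypothesis D1P : N ^+ 2 * w' * expR (- (delta / 2 * w')) <= D1.
Hypothesis D2P : N ^+ 4 * w' * expR (- (1 * w')) <= D2.
Let c1 := 4 * Cw * beta2.
Let Rho := 2 * c1 ^+ 2 + expR 1 * C4%:R ^+ 2 * c1 ^+ 2 + 2 * (1 - phi)^-1 * D1.
Let Cy := 8 * (1 + Rho) * Cw * beta2.
Hypothesis l2 : 8 * Cw <= w'.
Hypothesis l3 : 4 * (gamma + delta) * C4%:R <= delta * beta1 * w'.
Hypothesis l4 : 2 * kap%:R * (C4%:R + 2) <= w'.
Hypothesis l5 : 8 * kap%:R * expR 1 * Cy <= w'.
Hypothesis l6 : 2 * (C4%:R + 1) * c1 <= w'.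

(** Half of the number of edges: the walk is followed for at most [n^2 / 4] periods ([rounds]), so
    its past never excludes more. A window has [W] periods, a constant times the small scale [w],
    and about [n^2 / w^8] windows are used. *)
Let a := N ^+ 2 * (N - 1) / 2.
Let h := (n %/ kap)%N.
Let k := (n ^ 2 %/ w ^ 8)%N.
Let W := (C3 * w + w)%N.
Let B := (C4 * w)%N.
Let L := (W * M)%N.
Let T := (k.+1 * W * M)%N.

Let w0 : 0 < w'. Proof. by rewrite ltr0n (leq_trans _ w_ge2). Qed.
Let w1 : 1 <= w'. Proof. by rewrite ler1n (leq_trans _ w_ge2). Qed.
Let wj j : (j <= 9)%N -> w' ^+ j <= N.
Proof. by move=> j9; apply: le_trans wn; apply: ler_weXn2l. Qed.
Let n2 : 2 <= N. Proof. by apply: le_trans (wj (j := 1) isT); rewrite expr1 ler_nat. Qed.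
Let n0 : 0 < N. Proof. exact: lt_le_trans n2. Qed.
Let n1 : 0 < N - 1. Proof. by rewrite subr_gt0 (lt_le_trans _ n2) // ltr1n. Qed.
Let n_gt0 : (0 < n)%N. Proof. by rewrite -(ltr0n R). Qed.
Let n_ge2 : (2 <= n)%N. Proof. by rewrite -(ler_nat R). Qed.
Let E_card : #|hamming_edges n|%:R = N ^+ 2 * (N - 1). Proof. exact: card_edgesR. Qed.
Let a0 : 0 < a. Proof. by rewrite divr_gt0 // mulr_gt0 // exprn_gt0. Qed.
Let WE : W%:R = Cw * w'. Proof. by rewrite natrD natrM -natr1 mulrDl mul1r. Qed.
Let BE : B%:R = C4%:R * w'. Proof. by rewrite natrM. Qed.
Let M0 : (0 : R) < M%:R.
Proof.
apply: lt_le_trans ML; rewrite mulr_gt0 ?exprn_gt0 //.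
by apply: lt_trans beta1_gt; rewrite divr_gt0.
Qed.
Let M_gt0 : (0 < M)%N. Proof. by rewrite -(ltr0n R). Qed.
Let Cw0 : 0 < Cw. Proof. by []. Qed.
Let c10 : 0 < c1. Proof. by rewrite /c1 mulr_gt0 // mulr_gt0. Qed.
Let D10 : 0 <= D1. Proof. by apply: le_trans D1P; rewrite !mulr_ge0 ?expR_ge0 ?exprn_ge0. Qed.
Let p0 : 0 <= (1 - phi)^-1. Proof. by rewrite invr_ge0 subr_ge0 ltW. Qed.
Let Rho0 : 0 <= Rho.
Proof.
rewrite /Rho; apply: addr_ge0; first apply: addr_ge0.
- by rewrite mulr_ge0 // exprn_ge0 // ltW.
- by rewrite mulr_ge0 ?exprn_ge0 ?(ltW c10) // mulr_ge0 ?expR_ge0 // exprn_ge0.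
- by rewrite mulr_ge0 // mulr_ge0.
Qed.

Let yb : L%:R / a <= c1 * (w' / N).
Proof.
rewrite natrM WE; apply: steps_ratio => //; by rewrite ltW.
Qed.

(** [L / a] has order [w / n], which makes the quadratic terms of order at most [w^4 / n^2]; [D1P]
    brings the exponential terms below the same order. *)
Let rho_bound : locality M gamma phi delta (C3 * w) w B a <= Rho * (w' ^+ 4 / N ^+ 2).
Proof.
rewrite /locality -/W -/L.
have -> : 2 * L%:R ^+ 2 * a ^- 2 = 2 * (L%:R / a) ^+ 2 by rewrite [(L%:R / a) ^+ 2]exprMn exprVn -[LHS]mulrA.
have -> : B%:R / a * L%:R = C4%:R * w' * (L%:R / a) by rewrite BE -[LHS]mulrA [a^-1 * _]mulrC.
have n20 : 0 <= N ^+ 2 by rewrite exprn_ge0.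
have e1 : expR (- (delta / 2 * w')) * N ^+ 2 <= D1.
  apply: le_trans D1P; rewrite mulrC ler_wpM2r ?expR_ge0 //.
  by rewrite ler_peMr.
apply: locality_arith => //; rewrite ?expR_ge0 ?(ltW c10) //.
- by rewrite divr_ge0 // ltW.
- by move: e1; rewrite [_ * w' / 2]mulrAC.
(* [C3_large] lets the drift over [C3 * w] periods exceed [gamma * w] with [delta / 2 * w] to
   spare. *)
apply: le_trans e1; rewrite ler_wpM2r // ler_expR natrM.
rewrite -subr_ge0; have : 0 <= (C3%:R - (1 + 2 * gamma / delta)) * (delta / 2 * w').
  by rewrite mulr_ge0 ?subr_ge0 // mulr_ge0 ?divr_ge0 // ltW.
have -> : (C3%:R - (1 + 2 * gamma / delta)) * (delta / 2 * w') =
   - (delta / 2 * w') - (gamma * w' - delta * (C3%:R * w') / 2) by field; rewrite gt_eqF.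
by [].
Qed.

Let kU : k.+1%:R <= 2 * (N ^+ 2 / w' ^+ 8).
Proof.
have w80 : 0 < w' ^+ 8 by rewrite exprn_gt0.
rewrite -natr1 mulrDl mul1r lerD //.
  by rewrite ler_pdivlMr // -!natrX -natrM ler_nat leq_divM.
rewrite ler_pdivlMr // mul1r; apply: le_trans (wj (j := 8) isT) _.
by rewrite expr2 ler_peMr // (le_trans _ n2) // ler1n.
Qed.

Let kW : (k.+1 * W)%:R <= 2 * Cw * (N ^+ 2 / w' ^+ 7).
Proof.
rewrite natrM WE; apply: le_trans (ler_wpM2r _ kU) _; first by rewrite mulr_ge0.
rewrite le_eqVlt; apply/orP; left; apply/eqP; rewrite [w' ^+ 8]exprS; have := exprn_gt0 7 w0.
by move: (w' ^+ 7) => u u0; field; rewrite !gt_eqF.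
Qed.

Let rounds : (k.+1 * W)%:R * 4 <= N ^+ 2.
Proof.
apply: le_trans (ler_wpM2r _ kW) _ => //.
have -> : 2 * Cw * (N ^+ 2 / w' ^+ 7) * 4 = N ^+ 2 * ((8 * Cw) / w' ^+ 7).
  have := exprn_gt0 7 w0; move: (w' ^+ 7) => u u0; by field; rewrite gt_eqF.
rewrite ler_piMr ?exprn_ge0 // ler_pdivrMr ?exprn_gt0 // mul1r; apply: le_trans l2 _.
by rewrite -[X in X <= _]expr1; apply: ler_weXn2l.
Qed.

Let TE : T%:R <= 2 * Cw * beta2 * (N ^+ 4 / w' ^+ 7).
Proof.
rewrite natrM; apply: le_trans (ler_pM _ _ kW MU) _ => //.
rewrite le_eqVlt; apply/orP; left; apply/eqP; have := exprn_gt0 7 w0.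
have -> : N ^+ 4 = N ^+ 2 * N ^+ 2 by rewrite -exprD.
by move: (w' ^+ 7) (N ^+ 2) => u y u0; field; rewrite gt_eqF.
Qed.

Let crowd : crowding n L B a <= expR (- w').
Proof.
apply: (crowding_bound (c := Cw * beta2) (C := C4%:R)) => //.
rewrite natrM WE; have -> : Cw * beta2 * w' * N ^+ 2 = Cw * w' * (beta2 * N ^+ 2) by ring.
by rewrite ler_wpM2l // mulr_ge0 // ltW.
Qed.

Let exp_w : expR (- w') <= w'^-1.
Proof.
rewrite expRN lef_pV2 ?posrE ?expR_gt0 //; apply: le_trans (expR_ge1Dx _); by rewrite lerDr.
Qed.

Let hh : N / (2 * kap%:R) <= (h - B.+1)%:R /\ (B.+1 < h)%N.
Proof.
have kap0 : (0 < kap)%N by apply: ltn_trans kap_gt.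
have kr : 0 < kap%:R :> R by rewrite ltr0n.
have hN : N <= kap%:R * (h%:R + 1).
  by rewrite natr1 -natrM ler_nat mulnC ltnW // ltn_ceil.
have wN : 2 * kap%:R * (C4%:R + 2) * w' <= N.
  apply: le_trans (wj (j := 2) isT); by rewrite expr2 ler_wpM2r // ltW.
have key : N / (2 * kap%:R) + B.+1%:R <= h%:R.
  have -> : N / (2 * kap%:R) + B.+1%:R = (N + 2 * kap%:R * B.+1%:R) / (2 * kap%:R).
    by move: B.+1%:R => u; field; rewrite gt_eqF.
  rewrite ler_pdivrMr ?mulr_gt0 //.
  have BS : B.+1%:R = C4%:R * w' + 1 by rewrite -natr1 BE.
  exact: (regime_arith hN wN w1 BS kr).
have lt : (B.+1 < h)%N.
  by rewrite -(ltr_nat R); apply: lt_le_trans key; rewrite ltrDr divr_gt0 // mulr_gt0.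
by split=> //; rewrite natrB ?(ltnW lt) // lerBrDr.
Qed.

Let sqr_ratio : w' ^+ 2 / N <= w'^-1.
Proof. by rewrite ler_pdivrMr // ler_pdivlMl // -exprS; apply: wj. Qed.

Let heavy : 2 * N * heaviness n h L B T a (locality M gamma phi delta (C3 * w) w B a) <=
  4 * (8 * kap%:R * (C4%:R + 1)) ^+ 2 / w'.
Proof.
have [h1 h2] := hh; set rho := locality _ _ _ _ _ _ _ _.
have rho0 : 0 <= rho by apply: locality_ge0.
have kr : 0 < kap%:R :> R by rewrite ltr0n (ltn_trans _ kap_gt).
have ia : a^-1 <= 4 / N ^+ 3.
  have u0 : 0 < N ^+ 3 by rewrite exprn_gt0.
  rewrite -[X in X <= _]mul1r ler_pdivrMr //.
  apply: le_trans (_ : 4 / N ^+ 3 * (N ^+ 3 / 4) <= _).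
    rewrite le_eqVlt; apply/orP; left; apply/eqP.
    by move: (N ^+ 3) u0 => u u0; field; rewrite gt_eqF.
  by rewrite ler_wpM2l ?divr_ge0 ?(ltW u0) //; exact: half_edges.
have r1 : 1 + N * (N * rho) <= (1 + Rho) * w' ^+ 4.
  rewrite mulrDl mul1r lerD ?exprn_ege1 //; apply: le_trans (_ : N * (N * (Rho * (w' ^+ 4 / N ^+ 2))) <= _).
    by rewrite !ler_wpM2l // ltW.
  rewrite le_eqVlt; apply/orP; left; apply/eqP; move: (w' ^+ 4) Rho => u v.
  by field; rewrite gt_eqF.
have Yb : a^-1 * (1 + N * (N * rho)) * T%:R <= Cy * (N / w' ^+ 3).
  apply: le_trans (ler_pM _ _ (ler_pM _ _ ia r1) TE) _; rewrite ?mulr_ge0 ?invr_ge0 ?(ltW a0) ?addr_ge0 ?mulr_ge0 //.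
  rewrite le_eqVlt; apply/orP; left; apply/eqP; rewrite /Cy; move: (Rho) Cw => u v.
  by field; rewrite !gt_eqF.
have eY : expR 1 * (Cy * (N / w' ^+ 3)) <= N / (8 * kap%:R).
  rewrite ler_pdivlMr ?mulr_gt0 //.
  have -> : expR 1 * (Cy * (N / w' ^+ 3)) * (8 * kap%:R) = N * ((8 * kap%:R * expR 1 * Cy) / w' ^+ 3).
    by move: (expR 1) Cy => u v; field; rewrite gt_eqF.
  rewrite ler_piMr ?(ltW n0) // ler_pdivrMr ?exprn_gt0 // mul1r; apply: le_trans l5 _.
  by rewrite -[X in X <= _]expr1; apply: ler_weXn2l.
apply: le_trans (ler_wpM2l _ (heaviness_bound L kr a0 rho0 h1 Yb eY)) _; first by rewrite mulr_ge0 // ltW.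
set cc := 8 * kap%:R * (C4%:R + 1).
have c41 : 0 < C4%:R + 1 :> R by rewrite ltr_wpDl.
have cc0 : 0 < cc by rewrite !mulr_gt0.
have x0 : 0 < N / (cc * w') by rewrite divr_gt0 // mulr_gt0.
apply: le_trans (_ : 2 * N * (2 / (N / (cc * w')) ^+ 2) <= _).
  rewrite ler_wpM2l ?mulr_ge0 ?(ltW n0) //; apply: le_trans (exp_inverse_square x0).
  rewrite ler_expR lerN2 ler_wpM2l ?(ltW n0) // lef_pV2 ?posrE ?mulr_gt0 //.
  rewrite /cc -[X in _ <= X]mulrA ler_wpM2l ?mulr_ge0 // -natr1 BE mulrDl mul1r lerD2l.
  exact: w1.
have -> : 2 * N * (2 / (N / (cc * w')) ^+ 2) = 4 * cc ^+ 2 * (w' ^+ 2 / N).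
  by move: cc cc0 {x0} => u u0; field; rewrite !gt_eqF.
have q0 : 0 <= 4 * cc ^+ 2 by rewrite mulr_ge0 // exprn_ge0 // ltW.
rewrite ler_wpM2l //; exact: sqr_ratio.
Qed.

Definition hazard_constant : R :=
  2 * Cw * Rho + 2 * Cw * beta2 * D2 + 4 * (8 * kap%:R * (C4%:R + 1)) ^+ 2.

(** The eighth power of [w] in [k] pays for localization: the number [k * W] of periods times [rho]
    has order [w^-7 * w^4]. *)
Let hazard_le : hazard_bound n M gamma phi delta h (C3 * w) w B k a <= hazard_constant / w'.
Proof.
rewrite /hazard_bound -/W -/L -/T /hazard_constant [X in _ <= X]mulrDl; apply: lerD; last exact: heavy.
rewrite [X in _ <= X]mulrDl.
have w3 : w' <= w' ^+ 3 by rewrite -[X in X <= _]expr1; apply: ler_weXn2l.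
have w7 : 1 <= w' ^+ 7 by apply: exprn_ege1.
apply: lerD.
  apply: le_trans (_ : 2 * Cw * (N ^+ 2 / w' ^+ 7) * (Rho * (w' ^+ 4 / N ^+ 2)) <= _).
    apply: ler_pM => //; first exact: locality_ge0.
    by apply: le_trans kW; rewrite ler_nat leq_mul2r leqnSn orbT.
  have -> : 2 * Cw * (N ^+ 2 / w' ^+ 7) * (Rho * (w' ^+ 4 / N ^+ 2)) = 2 * Cw * Rho / w' ^+ 3.
    by move: Rho Cw => u v; field; rewrite !gt_eqF.
  by rewrite ler_wpM2l ?mulr_ge0 // lef_pV2 ?posrE ?exprn_gt0.
apply: le_trans (ler_pM _ _ TE crowd) _ => //.
  by rewrite /crowding mulr_ge0 ?invr_ge0 ?exprn_ge0 ?addr_ge0 // divr_ge0 // ltW.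
have -> : 2 * Cw * beta2 * (N ^+ 4 / w' ^+ 7) * expR (- w') =
    2 * Cw * beta2 / w' * (N ^+ 4 * w' * expR (- (1 * w')) / w' ^+ 7).
  by rewrite mul1r; move: (expR _) Cw => u v; field; rewrite gt_eqF.
rewrite [X in _ <= X]mulrAC ler_wpM2l ?divr_ge0 ?mulr_ge0 ?(ltW beta2_gt0) ?(ltW w0) //.
rewrite ler_pdivrMr ?exprn_gt0 //; apply: le_trans D2P _; rewrite ler_peMr //.
by apply: le_trans D2P; rewrite !mulr_ge0 ?expR_ge0 ?exprn_ge0.
Qed.

Definition survival_constant : R := 1 + 2 * ((C4%:R + 1) * c1).

Let survival_le : survival_bound n M gamma (C3 * w) w B a <= expR (- gamma) + survival_constant / w'.
Proof.
rewrite /survival_bound -/W -/L /survival_constant -addrA lerD2l [X in _ <= X]mulrDl.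
apply: lerD; first by rewrite mul1r; apply: le_trans crowd exp_w.
set y := (C4%:R + 1) * c1 / w'.
have y0 : 0 <= y by rewrite divr_ge0 ?mulr_ge0 ?addr_ge0 ?(ltW c10) // ltW.
have y1 : y <= 1 / 2.
  by rewrite ler_pdivrMr //; apply: half_arith; rewrite mulrA.
rewrite -[2 * _ / w']mulrA; apply: le_trans (exp_double y0 y1); rewrite lerD2r.
apply: exprD1_le; first by rewrite divr_ge0 // ltW.
have -> : B.+1%:R / a * L%:R = B.+1%:R * (L%:R / a) by rewrite -[LHS]mulrA [a^-1 * _]mulrC.
apply: le_trans (_ : ((C4%:R + 1) * w') * (c1 * (w' / N)) <= _).
  apply: ler_pM => //; first by rewrite divr_ge0 // ltW.
  by rewrite -natr1 BE mulrDl mul1r lerD2l.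
have -> : (C4%:R + 1) * w' * (c1 * (w' / N)) = (C4%:R + 1) * c1 * (w' ^+ 2 / N).
  by move: c1 => u; field; rewrite gt_eqF.
have q0 : 0 <= (C4%:R + 1) * c1 by rewrite mulr_ge0 ?(ltW c10) // addr_ge0.
by rewrite /y ler_wpM2l.
Qed.

Definition regime_constant : R := 16 * beta2 * Cw ^+ 2 / eta ^+ 2 + hazard_constant / eta.

Lemma regime : 0 < eta ->
  #|[set e in envs n M | #|long_set (k * W) e|%:R <
     (1 - (expR (- gamma) + survival_constant / w') - 2 * eta) * (n * n)%:R]|%:R <=
  regime_constant / w' * #|envs n M|%:R.
Proof.
move=> eta0; have [h1 h2] := hh.
have kr : 0 < kap%:R :> R by rewrite ltr0n (ltn_trans _ kap_gt).
have nn : (n * n)%:R = N ^+ 2 by rewrite natrM expr2.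
have N20 : 0 < N ^+ 2 by rewrite exprn_gt0.
have E0 : (0 < #|hamming_edges n|)%N by rewrite -(ltr0n R) E_card mulr_gt0.
have hk : h%:R <= 2 / kap%:R * (N - 1).
  have : h%:R * kap%:R <= N by rewrite -natrM ler_nat leq_divM.
  rewrite mulrAC ler_pdivlMr // => hk; apply: le_trans hk _.
  by rewrite mulrBr mulr1 lerBrDr mulrC mulr_natr mulr2n lerD2l n2.
have nb : n.-1%:R = N - 1 by rewrite -[in RHS](prednK n_gt0) -natr1 addrK.
have b1 : 0 < beta1 by apply: lt_trans beta1_gt; rewrite divr_gt0.
have k21 : 0 < 1 - 2 / kap%:R :> R by rewrite subr_gt0 ltr_pdivrMr // mul1r ltr_nat.
have b0 : 0 < b by rewrite mulr_gt0.
have S0 : 0 <= S by rewrite divr_ge0 ?mulr_ge0 // ltW.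
have bE : b * #|hamming_edges n|%:R <= M%:R * (n.-1%:R - h%:R).
  rewrite E_card nb.
  have lo : (1 - 2 / kap%:R) * (N - 1) <= N - 1 - h%:R by rewrite mulrBl mul1r lerD2l lerN2.
  apply: le_trans (_ : beta1 * N ^+ 2 * ((1 - 2 / kap%:R) * (N - 1)) <= _).
    by rewrite le_eqVlt; apply/orP; left; apply/eqP; rewrite /b; move: (_ / _) => u; ring.
  apply: ler_pM; rewrite ?mulr_ge0 ?(ltW b1) ?(ltW k21) ?(ltW n1) ?(ltW N20) //.
have SE : 4 * h%:R * M%:R <= S * #|hamming_edges n|%:R.
  rewrite E_card; apply: le_trans (_ : 4 * (2 / kap%:R * (N - 1)) * (beta2 * N ^+ 2) <= _).
    by apply: ler_pM => //; rewrite ?mulr_ge0 // ler_wpM2l.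
  by rewrite le_eqVlt; apply/orP; left; apply/eqP; rewrite /S; field; rewrite gt_eqF.
have few : (gamma + delta) * (k.+1 * B)%:R <= delta / 2 * M%:R.
  have gd : 0 < gamma + delta by rewrite addr_gt0.
  apply: le_trans (_ : delta / 2 * (beta1 * N ^+ 2) <= _); last first.
    by rewrite ler_wpM2l // divr_ge0 // ltW.
  apply: le_trans (_ : (gamma + delta) * (2 * (N ^+ 2 / w' ^+ 8) * (C4%:R * w')) <= _).
    by rewrite ler_wpM2l ?(ltW gd) // natrM BE ler_wpM2r // mulr_ge0 // ltW.
  have -> : (gamma + delta) * (2 * (N ^+ 2 / w' ^+ 8) * (C4%:R * w')) =
      (4 * (gamma + delta) * C4%:R) * (N ^+ 2 / 2 / w' ^+ 7).
    by move: (gamma + delta) => u; field; rewrite gt_eqF.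
  apply: le_trans (ler_wpM2r _ l3) _; first by rewrite !mulr_ge0 ?invr_ge0 ?exprn_ge0 // ltW.
  have -> : delta * beta1 * w' * (N ^+ 2 / 2 / w' ^+ 7) = delta / 2 * (beta1 * N ^+ 2) / w' ^+ 6.
    by field; rewrite gt_eqF.
  rewrite ler_pdivrMr ?exprn_gt0 // ler_peMr ?exprn_ege1 //.
  by rewrite !mulr_ge0 ?invr_ge0 ?(ltW delta_gt0) ?(ltW b1) ?(ltW N20).
have aE : a <= #|hamming_edges n|%:R - (n.-1.*2 * (k.+1 * W))%:R.
  rewrite E_card natrM double_predR // /a.
  by have := regime_arith2 (ltW n1) rounds.
have EA : (n.-1.*2 * (k.+1 * W) * 2 <= #|hamming_edges n|)%N.
  rewrite -(ler_nat R) E_card natrM natrM double_predR //.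
  by have := regime_arith3 (ltW n1) rounds.
have := supercritical_finite M_gt0 phi_gt0 phi_lt1 gamma_gt0 delta_gt0 b0 S0 bE SE bent_cond old_cond
  straight_cond known_cond few a0 aE EA h2 eta0 n_gt0 E0 => fin.
apply: le_trans (le_trans _ fin) _.
  rewrite ler_nat; apply/subset_leq_card/subsetP=> e /setIdP[eE le]; apply/setIdP; split=> //.
  apply: lt_le_trans le _; rewrite ler_wpM2r // lerD2r lerD2l lerN2; exact: survival_le.
rewrite ler_wpM2r // /regime_constant [X in _ <= X]mulrDl; apply: lerD; last first.
  by rewrite mulrAC ler_wpM2r ?invr_ge0 ?(ltW eta0) //; exact: hazard_le.
rewrite -/W WE nn; apply: le_trans (_ : beta2 * N ^+ 2 * (4 * (Cw * w')) ^+ 2 / (eta * N ^+ 2) ^+ 2 <= _).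
  by rewrite ler_wpM2r ?invr_ge0 ?exprn_ge0 ?mulr_ge0 ?(ltW eta0) ?(ltW N20) // ler_wpM2r // exprn_ge0 // !mulr_ge0.
have -> : beta2 * N ^+ 2 * (4 * (Cw * w')) ^+ 2 / (eta * N ^+ 2) ^+ 2 =
   16 * beta2 * Cw ^+ 2 / eta ^+ 2 * (w' ^+ 2 / N ^+ 2).
  by move: Cw => u; field; rewrite !gt_eqF.
rewrite ler_wpM2l ?divr_ge0 ?mulr_ge0 ?exprn_ge0 ?(ltW beta2_gt0) ?(ltW eta0) //.
rewrite ler_pdivrMr // ler_pdivlMl // -exprS; apply: le_trans (wj (j := 3) isT) _.
by rewrite expr2 ler_peMr ?(ltW n0) // (le_trans _ n2) // ler1n.
Qed.

End Regime.

Local Open Scope ring_scope.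
Local Open Scope set_scope.

Lemma rates (R : realType) (b S : R) : 1 / 2 < b -> 0 <= S -> exists gamma phi delta : R,
  [/\ 0 < phi, phi < 1, 0 < gamma & 0 < delta] /\
  [/\ delta + gamma <= 2 * b * (1 - expR (- gamma)), delta <= 2 * b * phi,
      phi + delta + S * phi <= b * (1 - phi - expR (- gamma)) & phi <= (1 - phi) * gamma].
Proof.
move=> bh S0; pose theta := 2 * b - 1; have th0 : 0 < theta by rewrite /theta; lra.
(* Chosen so that [(1 + theta / 2) * (1 + gamma) = 1 + theta = 2 * b]. With [gamma / (1 + gamma) <=
   1 - expR (- gamma)] this yields [gamma * (1 + theta / 2) <= 2 * b * (1 - expR (- gamma))], which
   leaves room for [delta]. *)
pose gamma := theta / (2 + theta); have d0 : 0 < 2 + theta by lra.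
have gE : gamma * (2 + theta) = theta by rewrite /gamma mulfVK // gt_eqF.
have g0 : 0 < gamma by rewrite divr_gt0.
clearbody gamma; have s0 : 0 < 8 * (1 + S + b) by lra.
(* [phi] is small against [gamma], also after multiplication by [S] or [b]; [delta] will be
   [phi * gamma], of still lower order. *)
pose phi := gamma / (8 * (1 + S + b)); have p0 : 0 < phi by rewrite divr_gt0.
have pE : phi * (8 * (1 + S + b)) = gamma by rewrite /phi mulfVK // gt_eqF.
clearbody phi; have qE : gamma <= (1 - expR (- gamma)) * (1 + gamma).
  have h1 : 0 < 1 + gamma by lra.
  have : expR (- gamma) <= (1 + gamma)^-1.
    by rewrite expRN lef_pV2 ?posrE ?expR_gt0 ?expR_ge1Dx.
  rewrite -ler_pdivrMr // => h; apply: le_trans (_ : 1 - (1 + gamma)^-1 <= _); last by rewrite lerD2l lerN2.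
  by rewrite le_eqVlt; apply/orP; left; apply/eqP; field; rewrite gt_eqF.
have [Q QE] : exists Q, expR (- gamma) = Q by exists (expR (- gamma)).
rewrite QE in qE.
have g1 : gamma < 1 by nra.
have gth : gamma * 2 <= theta by nra.
have p12 : phi * 12 <= gamma.
  by rewrite -[X in _ <= X]pE ler_wpM2l ?(ltW p0) //; lra.
have X2 : gamma * (1 + theta / 2) <= 2 * b * (1 - Q).
  have : gamma * (1 + theta / 2) <= (1 - Q) * (1 + gamma) * (1 + theta / 2) by rewrite ler_wpM2r //; lra.
  have -> : (1 - Q) * (1 + gamma) * (1 + theta / 2) = (1 - Q) * (1 + theta / 2 + gamma * (2 + theta) / 2) by field.
  rewrite gE; have -> : 1 + theta / 2 + theta / 2 = 2 * b by rewrite /theta; field.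
  by rewrite [(1 - Q) * _]mulrC.
exists gamma, phi, (phi * gamma); rewrite QE; split; split=> //.
- by lra.
- exact: mulr_gt0.
- apply: le_trans X2; have : phi * gamma <= theta / 2 * gamma by rewrite ler_wpM2r ?(ltW g0) //; lra.
  by lra.
- rewrite mulrC ler_wpM2r ?(ltW p0) //; lra.
- have h1 : phi * gamma <= phi by rewrite -[X in _ <= X]mulr1 ler_wpM2l ?(ltW p0) // ltW.
  have h2 : gamma <= 2 * b * (1 - Q).
    by apply: le_trans X2; rewrite ler_peMr ?(ltW g0) //; lra.
  have h3 : 0 <= S * phi by rewrite mulr_ge0 // ltW.
  have h4 : 0 <= b * phi by rewrite mulr_ge0 ?(ltW p0) //; lra.
  by lra.
have h1 : phi * gamma <= gamma / 12 by rewrite mulrC ler_wpM2l ?(ltW g0) //; lra.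
by lra.
Qed.

Lemma integer_root q n : (0 < q)%N -> exists w, (w ^ q <= n)%N /\ forall u, (u ^ q <= n)%N -> (u <= w)%N.
Proof.
move=> q0; have ex : exists w, (w ^ q <= n)%N by exists 0%N; rewrite exp0n.
have ub w : (w ^ q <= n)%N -> (w <= n)%N.
  apply: leq_trans; case: w => // w; rewrite -[X in (X <= _)%N]expn1 leq_pexp2l //.
by case: (ex_maxnP ex ub) => w h m; exists w.
Qed.

(** [w^8 <= n^eps] because [w^q <= n] and [8 <= q * eps]. The rounding in the quotient costs a
    factor 2, which [2 <= w] recovers. *)
Lemma long_threshold (R : realType) (n w C3 q : nat) (eps : R) : (2 <= w)%N -> (9 <= q)%N ->
  (w ^ q <= n)%N -> 0 < eps -> 8 <= q%:R * eps ->
  n%:R `^ (2 - eps) <= (n ^ 2 %/ w ^ 8 * (C3 * w + w))%N%:R :> R.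
Proof.
move=> w2 q9 wn e0 qe; have w0 : (0 < w)%N by apply: leq_trans w2.
have n0 : (0 < n)%N by apply: leq_trans wn; rewrite expn_gt0 w0.
have nr : 0 < n%:R :> R by rewrite ltr0n.
have w8n : (2 * w ^ 8 <= n)%N.
  apply: leq_trans wn; apply: leq_trans (_ : w ^ 9 <= _)%N; last by rewrite leq_pexp2l.
  by rewrite [(w ^ 9)%N]expnS leq_mul2r w2 orbT.
set k := (n ^ 2 %/ w ^ 8)%N.
have k1 : (n ^ 2 <= w ^ 8 * (2 * k))%N.
  have : (n ^ 2 < k.+1 * w ^ 8)%N by rewrite ltn_ceil // expn_gt0 w0.
  have : (2 * w ^ 8 <= n ^ 2)%N by apply: leq_trans w8n _; rewrite -{1}[n]expn1 leq_pexp2l.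
  by move: (w ^ 8)%N (n ^ 2)%N k => u y k; clear; nia.
apply: le_trans (_ : (2 * k)%:R <= _); last first.
  by rewrite ler_nat mulnC leq_mul2l (leq_trans w2 (leq_addl _ _)) orbT.
have w80 : 0 < w%:R ^+ 8 :> R by rewrite exprn_gt0 // ltr0n.
have we : w%:R ^+ 8 <= n%:R `^ eps :> R.
  rewrite -powR_mulrn ?ler0n //; apply: le_trans (_ : w%:R `^ (q%:R * eps) <= _).
    by apply: ler_powR => //; rewrite ler1n.
  rewrite powRrM powR_mulrn ?ler0n // ge0_ler_powR ?nnegrE ?(ltW e0) ?exprn_ge0 //.
  by rewrite -natrX ler_nat.
have pe : 0 < n%:R `^ eps :> R by rewrite powR_gt0.
have -> : n%:R `^ (2 - eps) = n%:R ^+ 2 / n%:R `^ eps :> R.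
  rewrite powRD; last by rewrite (gt_eqF nr) implybT.
  by rewrite powRN powR_mulrn ?ler0n.
rewrite ler_pdivrMr //; apply: le_trans (_ : (2 * k)%:R * w%:R ^+ 8 <= _); last by apply: ler_wpM2l.
by rewrite -!natrX -natrM ler_nat mulnC.
Qed.

Lemma supercritical_rare (R : realType) (beta1 beta2 eps : R) : 1 / 2 < beta1 -> 0 < beta2 -> 0 < eps ->
  exists C : R, 0 < C /\ forall err : R, 0 < err ->
  exists n0, forall n M : nat, (n0 <= n)%N -> beta1 * n%:R ^+ 2 <= M%:R -> M%:R <= beta2 * n%:R ^+ 2 ->
  #|[set e in envs n M | #|[set v | n%:R `^ (2 - eps) <= #|porbit (flow e) v|%:R :> R]|%:R < C * n%:R ^+ 2]|%:R
    <= err * #|envs n M|%:R :> R.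
Proof.
move=> b1 b2 e0.
have b10 : 0 < beta1 by lra.
have [kap [kap3 bh]] : exists kap : nat, (2 < kap)%N /\ 1 / 2 < beta1 * (1 - 2 / kap%:R).
  have t0 : 0 < beta1 - 1 / 2 by lra.
  have [k0 hk] := nat_above (4 * beta1 / (beta1 - 1 / 2)); exists (maxn k0 3); split; first by rewrite leq_maxr.
  have := hk _ (leq_maxl k0 3); have : (0 < (maxn k0 3))%N by rewrite leq_max orbT.
  rewrite -(ltr0n R); move: (maxn k0 3)%:R => kp kp0; rewrite ler_pdivrMr // => hkp.
  have -> : beta1 * (1 - 2 / kp) = beta1 - 2 * beta1 / kp by field; rewrite gt_eqF.
  rewrite ltrBrDr addrC -ltrBrDr ltr_pdivrMr //; lra.
have S0 : 0 <= 8 * beta2 / kap%:R by rewrite divr_ge0 // mulr_ge0 // ltW.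
have [gamma [phi [delta [[phi0 phi1 g0 d0] [bent old str kn]]]]] := rates bh S0.
have [C3 /(_ C3 (leqnn _)) hC3] := nat_above (1 + 2 * gamma / delta).
have [C4 /(_ C4 (leqnn _)) hC4] := nat_above (8 * (C3.+1%:R * beta2) + 2).
have [q0 /(_ (maxn q0 9) (leq_maxl _ _)) hq] := nat_above (8 / eps).
set q := maxn q0 9 in hq; have q9 : (9 <= q)%N by rewrite leq_maxr.
rewrite ler_pdivrMr // in hq.
have d20 : 0 < delta / 2 by rewrite divr_gt0.
have [D1 [_ hD1]] := exp_poly 2 q d20; have [D2 [_ hD2]] := exp_poly 4 q (@ltr01 R).
have Q1 : 0 < 1 - expR (- gamma) by rewrite subr_gt0 expR_lt1 oppr_lt0.
(* The surviving fraction falls short of [1 - expR (- gamma)] by [2 * eta] plus the term [sc / w],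
   also made at most [2 * eta]: half of it is left, which is the constant [C]. *)
pose eta := (1 - expR (- gamma)) / 8; have eta0 : 0 < eta by rewrite divr_gt0.
exists ((1 - expR (- gamma)) / 2); split=> [|err err0]; first by rewrite divr_gt0.
pose sc : R := survival_constant C3 C4 beta2.
pose rc := regime_constant kap C3 C4 beta2 phi eta D1 D2.
set c1 := 4 * C3.+1%:R * beta2 in sc rc *.
pose Rho := 2 * c1 ^+ 2 + expR 1 * C4%:R ^+ 2 * c1 ^+ 2 + 2 * (1 - phi)^-1 * D1.
have [w1 h1] := nat_above (8 * C3.+1%:R : R).
have [w2 h2] := nat_above (4 * (gamma + delta) * C4%:R / (delta * beta1)).
have [w3 h3] := nat_above (2 * kap%:R * (C4%:R + 2) : R).
have [w4 h4] := nat_above (8 * kap%:R * expR 1 * (8 * (1 + Rho) * C3.+1%:R * beta2)).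
have [w5 h5] := nat_above (2 * (C4%:R + 1) * c1).
have [w6 h6] := nat_above (sc / (2 * eta)).
have [w7 h7] := nat_above (rc / err).
pose w0 := maxn 2 (maxn w1 (maxn w2 (maxn w3 (maxn w4 (maxn w5 (maxn w6 w7)))))).
(* The integer root [w] of such an [n] is at least [w0], hence beyond all the thresholds. *)
exists (w0 ^ q)%N => n M nw ML MU.
have q_gt0 : (0 < q)%N by apply: leq_trans q9.
have [w [wn wmax]] := integer_root n q_gt0.
have : (w0 <= w)%N by apply: wmax.
rewrite /w0 !geq_max => /andP[ww /andP[/h1 l2 /andP[/h2 l3' /andP[/h3 l4 /andP[/h4 l5 /andP[/h5 l6 /andP[/h6 hs /h7 hr]]]]]]].
have wr : 0 < w%:R :> R by rewrite ltr0n (leq_trans _ ww).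
have l3 : 4 * (gamma + delta) * C4%:R <= delta * beta1 * w%:R.
  by move: l3'; rewrite ler_pdivrMr; [rewrite [w%:R * _]mulrC|exact: mulr_gt0].
have n2w : n%:R <= (2 * w%:R) ^+ q :> R.
  rewrite -natrM -natrX ler_nat leqNgt; apply/negP=> h; have : (w.+1 <= w)%N; last by rewrite ltnn.
  apply: wmax; apply: leq_trans (ltnW h); rewrite leq_exp2r //.
  by rewrite mul2n -addnn -addn1 leq_add2l (leq_trans _ ww).
have w9 : w%:R ^+ 9 <= n%:R :> R.
  rewrite -natrX ler_nat; apply: leq_trans wn; by rewrite leq_pexp2l // (leq_trans _ ww).
have := regime b1 b2 ML MU kap3 phi0 phi1 g0 d0 bent old str kn hC3 hC4 ww w9
  (hD1 _ _ (ler0n _ _) (ltW wr) n2w) (hD2 _ _ (ler0n _ _) (ltW wr) n2w) l2 l3 l4 l5 l6 eta0.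
rewrite -/rc -/sc => reg; apply: le_trans (le_trans _ reg) _; last first.
  have rw : rc <= w%:R * err by rewrite -ler_pdivrMr.
  have rwe : rc / w%:R <= err by rewrite ler_pdivrMr // [err * _]mulrC.
  by rewrite ler_wpM2r.
rewrite ler_nat; apply/subset_leq_card/subsetP=> e /setIdP[eE le]; apply/setIdP; split=> //.
apply: le_lt_trans (lt_le_trans le _).
  rewrite ler_nat; apply/subset_leq_card/subsetP=> v; rewrite !inE -(ler_nat R) => hv.
  apply: le_trans hv; exact: (long_threshold C3 ww q9 wn e0 hq).
rewrite natrM -expr2 ler_wpM2r ?exprn_ge0 //.
have : sc / w%:R <= 2 * eta.
  have e2 : 0 < 2 * eta by rewrite mulr_gt0.
  have sw : sc <= w%:R * (2 * eta) by rewrite -ler_pdivrMr.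
  by rewrite ler_pdivrMr // [2 * eta * _]mulrC.
by rewrite /eta; move: (sc / _) (expR _) => u v; lra.
Qed.

(** * From a fixed number of jumps to Poisson time *)

From mathcomp Require Import all_classical all_reals all_analysis.
Import numFieldNormedType.Exports.
Local Open Scope classical_set_scope.
Local Open Scope ring_scope.

Section PoissonTails.
Variable R : realType.
Implicit Types (lam theta : R) (k K : nat).

(** The large deviation rate function of the Poisson law of mean 1. *)
Definition poisson_rate_function theta : R := theta * ln theta - theta + 1.

Lemma poisson_rate_gt0 theta : 0 < theta -> theta != 1 -> 0 < poisson_rate_function theta.
Proof.
move=> t0 t1; have h : - ln theta != 0.
  rewrite oppr_eq0; apply: contra_neq t1 => h; have := lnK (x := theta).
  by rewrite posrE t0 h expR0 => /(_ isT).
have := expR_gt1Dx h; rewrite expRN lnK ?posrE // => h1.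
have : theta * (1 - ln theta) < theta * theta^-1 by rewrite ltr_pM2l.
by rewrite mulfV ?gt_eqF // /poisson_rate_function mulrBr mulr1; lra.
Qed.

Lemma poisson_pmfE lam k : 0 < lam -> poisson_pmf lam k = exp_coeff lam k * expR (- lam).
Proof. by move=> l0; rewrite /poisson_pmf l0. Qed.

Lemma exp_partial lam K : 0 <= lam -> \sum_(k < K) exp_coeff lam k <= expR lam.
Proof.
move=> l0; rewrite -(big_mkord predT (exp_coeff lam)).
apply: (@nondecreasing_cvgn_le R (series (exp_coeff lam))); last exact: is_cvg_series_exp_coeff.
by apply: nondecreasing_series => k _ _; apply: exp_coeff_ge0.
Qed.

(* Tilting the rate by theta moves the mean to theta * lam. *)
Lemma poisson_tail lam theta K : 0 < lam -> 0 < theta ->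
  \sum_(k < K | 0 <= (k%:R - theta * lam) * ln theta) poisson_pmf lam k <=
  expR (- (lam * poisson_rate_function theta)).
Proof.
move=> l0 t0; have tl : 0 < theta * lam by rewrite mulr_gt0.
apply: le_trans (_ : \sum_(k < K) exp_coeff (theta * lam) k * (expR (- lam) * expR (- (theta * lam * ln theta))) <= _).
  rewrite big_mkcond /=; apply: ler_sum => k _; case: ifP => [h|_]; last first.
    by rewrite mulr_ge0 ?exp_coeff_ge0 ?(ltW tl) // mulr_ge0 ?expR_ge0.
  rewrite poisson_pmfE // /exp_coeff /=.
  have -> : (theta * lam) ^+ k = lam ^+ k * expR (k%:R * ln theta).
    by rewrite expRM_natl lnK ?posrE // exprMn mulrC.
  have c0 : 0 <= lam ^+ k / k`!%:R * expR (- lam).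
    by rewrite !mulr_ge0 ?expR_ge0 ?invr_ge0 // exprn_ge0 // ltW.
  apply: le_trans (_ : lam ^+ k / k`!%:R * expR (- lam) * expR ((k%:R - theta * lam) * ln theta) <= _).
    by rewrite ler_peMr // -[X in X <= _]expR0 ler_expR.
  by rewrite mulrBl expRD le_eqVlt; apply/orP; left; apply/eqP; ring.
rewrite -mulr_suml; apply: le_trans (ler_wpM2r _ (exp_partial K (ltW tl))) _.
  by rewrite mulr_ge0 ?expR_ge0.
rewrite -!expRD ler_expR /poisson_rate_function le_eqVlt; apply/orP; left; apply/eqP; ring.
Qed.

(** The sign of [ln] lets [poisson_tail] serve as lower tail at [beta1] and as upper tail at
    [beta2]; [err] accounts for the truncation at [K], which keeps the sum finite. *)
Lemma poisson_bulk lam beta1 beta2 (err : R) : 0 < lam -> 0 < beta1 -> beta1 < 1 -> 1 < beta2 -> 0 < err ->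
  exists K, 1 - err - expR (- (lam * poisson_rate_function beta1)) - expR (- (lam * poisson_rate_function beta2))
   <= \sum_(k < K | (beta1 * lam <= k%:R) && (k%:R <= beta2 * lam)) poisson_pmf lam k.
Proof.
move=> l0 b0 b1 b2 e0; have b20 : 0 < beta2 by apply: lt_trans b2.
have /cvgrPdist_le/(_ (err * expR lam) (mulr_gt0 e0 (expR_gt0 _)))[K _ /(_ K (leqnn K))] :
    series (exp_coeff lam) @ \oo --> expR lam by exact: is_cvg_series_exp_coeff.
rewrite /series /= => hK; exists K.
have mass : 1 - err <= \sum_(k < K) poisson_pmf lam k.
  have -> : \sum_(k < K) poisson_pmf lam k = (\sum_(0 <= k < K) exp_coeff lam k) * expR (- lam).
    by rewrite mulr_suml big_mkord; apply: eq_bigr => k _; rewrite poisson_pmfE.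
  rewrite expRN ler_pdivlMr ?expR_gt0 // mulrBl mul1r lerBlDl -lerBlDr.
  exact: le_trans (ler_norm _) hK.
have ln1 : ln beta1 <= 0 by rewrite ln_le0 // ltW.
have ln2 : 0 <= ln beta2 by rewrite ln_ge0 // ltW.
have t1 := poisson_tail K l0 b0; have t2 := poisson_tail K l0 b20.
rewrite -addrA -opprD lerBlDr; apply: le_trans mass _.
apply: le_trans (lerD (lexx _) (lerD t1 t2)).
rewrite [X in _ <= X + _]big_mkcond [X in _ <= _ + (X + _)]big_mkcond [X in _ <= _ + (_ + X)]big_mkcond /=.
rewrite -!big_split /=; apply: ler_sum => k _; have p0 := poisson_pmf_ge0 lam k.
have [k1|k1] := leP (beta1 * lam) k%:R; last first.
  by rewrite mulr_le0 // ?subr_le0 ?(ltW k1) //=; case: ifP; rewrite ?add0r ?addr0 // lerDl.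
have [k2|k2] := leP k%:R (beta2 * lam) => /=; first by do 2 case: ifP => _; rewrite ?addr0 ?lerDl ?addr_ge0.
by rewrite (mulr_ge0 _ ln2) ?subr_ge0 ?(ltW k2) //; case: ifP => _; rewrite ?add0r // lerDl.
Qed.

End PoissonTails.

(** * Mixing over the number of jumps *)

Section Transfer.
Variables (R : realType) (n : nat) (d : measure_display) (T : measurableType d) (P : probability T R)
  (sigma : R -> T -> {perm hamming_vertex n}).
Hypothesis n_ge2 : (2 <= n)%N.
Hypothesis ip : interchange_process P sigma.
Local Notation E := (hamming_edges n).
Variables (t : R) (t_gt0 : 0 < t) (good : pred {perm hamming_vertex n}).

Let event := [set w | good (sigma t w)].

Lemma card_envs M : #|envs n M| = (#|E| ^ M)%N.
Proof.
rewrite -[M in RHS]card_ord -(card_ffun_on 'I_M (mem E)); apply: eq_card => e.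
by apply/envsP/ffun_onP.
Qed.

(** The event is a countable disjoint union of cylinders fixing the number [M] of jumps and the
    first [M] edges. By independence all cylinders with the same [M] have the same probability, so
    the conditional probability given [M] is a proportion of [envs n M]. *)
Lemma transfer : measurable event /\ forall (err : R) (K : nat) (J : pred nat),
  (forall M, (M < K)%N -> J M ->
     #|[set e in envs n M | ~~ good (flow e)]%SET|%:R <= err * #|envs n M|%:R :> R) ->
  (((1 - err) * \sum_(M < K | J M) poisson_pmf t M)%:E <= P event)%E.
Proof.
case: ip => N [e [pN iE sE]].
have E0 : (0 < #|E|)%N by rewrite card_edges !muln_gt0; case: n n_ge2 => [|[]].
pose cyl M (c : {ffun 'I_M -> {set hamming_vertex n}}) : set T :=
  [set w | N t w = M] `&` [set w | forall i : 'I_M, e i w = c i].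
have mN M : measurable [set w | N t w = M] by apply: (poisson_meas pN); exact: ltW.
have mcyl M c : measurable (cyl M c).
  apply: measurableI => //; have -> : [set w | forall i : 'I_M, e i w = c i] =
      \bigcap_(i in [set: 'I_M]) [set w | e i w = c i].
    by apply/seteqP; split=> w /= h i => [_|]; apply: h.
  by apply: fin_bigcap_measurable => // i _; exact: (iid_meas iE).
have flowE M w c : cyl M c w -> sigma t w = flow c.
  case=> /= NM ec; rewrite sE ?(ltW t_gt0) // NM; apply: eq_bigr => i _; by rewrite ec.
pose A M := [set c in envs n M | good (flow c)]%SET.
pose ev M := \big[setU/set0]_(c in A M) cyl M c.
have evE M : ev M = [set w | N t w = M] `&` event.
  rewrite /ev -bigcup_seq_cond /=; apply/seteqP; split=> w.
    move=> [c /= /andP[_ /setIdP[_ gc]] cc]; split; first by case: cc.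
    by rewrite /event /= (flowE _ _ _ cc).
  move=> [/= NM gw]; pose c := [ffun i : 'I_M => e i w].
  have cc : cyl M c w by split=> // i; rewrite ffunE.
  exists c => //=; rewrite mem_index_enum /=; apply/setIdP; split.
    by apply/envsP=> i; rewrite ffunE; apply: (iid_supp iE).
  by rewrite -(flowE _ _ _ cc).
have mev M : measurable (ev M) by apply: bigsetU_measurable.
have eventE : event = \bigcup_M ev M.
  apply/seteqP; split=> w; first by move=> gw; exists (N t w) => //; rewrite evE.
  by move=> [M _]; rewrite evE => -[].
have mevent : measurable event by rewrite eventE; apply: bigcupT_measurable.
split=> // err K J hI.
have Pcyl M c : c \in envs n M -> P (cyl M c) = (poisson_pmf t M * (#|E| ^ M)%N%:R^-1)%:E.
  (* The independence rule takes a sequence of edges; the empty set is its default value from index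
     [M] on. *)
  move=> /envsP cE; pose a i := if insub i is Some j then c j else finset.set0.
  have aE (i : 'I_M) : a i = c i by rewrite /a valK.
  have := iid_indep iE 1 M (fun=> M) a (fun=> ltW t_gt0).
  have -> : [set w | forall j, (j < 1)%N -> N t w = M] = [set w | N t w = M].
    by apply/seteqP; split=> w /= h => [|j _]; [exact: (h 0%N)|].
  have -> : [set w | forall i, (i < M)%N -> e i w = a i] = [set w | forall i : 'I_M, e i w = c i].
    apply/seteqP; split=> w /= h => [i|i iM]; first by rewrite h // aE.
    by rewrite (h (Ordinal iM)) -aE.
  rewrite -/(cyl M c) => ->.
  have -> : P [set w | N t w = M] = (poisson_pmf t M)%:E.
    have := poisson_law pN M (lexx 0) t_gt0; rewrite subr0 mul1r => <-; congr (P _).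
    by apply/seteqP; split=> w /=; rewrite (poisson_init pN) subn0.
  under eq_bigr => i _ do rewrite aE (iid_law iE) //.
  by rewrite prodEFin EFinM prodr_const card_ord natrX exprVn.
have tcyl M : trivIset [set: {ffun 'I_M -> {set hamming_vertex n}}] (cyl M).
  apply/trivIsetP => c c' _ _ cc'; apply/seteqP; split=> // w [[_ h] [_ h']].
  by case/eqP: cc'; apply/ffunP=> i; rewrite -(h i) -(h' i).
have Pev M : P (ev M) = (poisson_pmf t M * (#|E| ^ M)%N%:R^-1 * #|A M|%:R)%:E.
  rewrite /ev big_enum_val measure_bigsetU_ord //=; last first.
    apply/trivIsetP => i j _ _ ij; move/trivIsetP: (tcyl M) => /(_ (enum_val i) (enum_val j) I I).
    by apply; apply: contra_neq ij; apply: enum_val_inj.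
  rewrite (eq_bigr (fun=> (poisson_pmf t M * (#|E| ^ M)%N%:R^-1)%:E)) => [|i _]; last first.
    by apply: Pcyl; case/setIdP: (enum_valP i).
  by rewrite sumEFin sumr_const card_ord mulr_natr.
have PevL M : (M < K)%N -> J M -> (((1 - err) * poisson_pmf t M)%:E <= P (ev M))%E.
  move=> MK JM; rewrite Pev lee_fin -card_envs; have hb := hI M MK JM.
  have D0 : 0 < #|envs n M|%:R :> R by rewrite ltr0n card_envs expn_gt0 E0.
  have cnt : #|envs n M|%:R = #|A M|%:R + #|[set e in envs n M | ~~ good (flow e)]%SET|%:R :> R.
    rewrite -natrD; congr (_%:R); rewrite -(cardsID [set c | good (flow c)]%SET (envs n M)).
    congr (_ + _)%N; apply: eq_card => c.
      by rewrite [LHS]finset.in_setI [RHS]finset.in_set [X in _ && X]finset.in_set.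
    by rewrite [LHS]finset.in_setD [RHS]finset.in_set [X in ~~ X]finset.in_set andbC.
  have lo : (1 - err) * #|envs n M|%:R <= #|A M|%:R.
    by rewrite mulrBl mul1r lerBlDr [X in X <= _]cnt lerD2l.
  have -> : poisson_pmf t M * #|envs n M|%:R^-1 * #|A M|%:R = poisson_pmf t M * (#|A M|%:R / #|envs n M|%:R).
    by rewrite mulrAC mulrA.
  by rewrite [X in X <= _]mulrC ler_wpM2l ?poisson_pmf_ge0 // ler_pdivlMr.
apply: (@le_trans _ _ (\sum_(M < K | J M) P (ev M))%E).
  by rewrite mulr_sumr -sumEFin; apply: lee_sum => M JM; apply: PevL.
have tev : trivIset [set: nat] ev.
  apply/trivIsetP => M M' _ _ MM'; apply/seteqP; split=> // w; rewrite !evE.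
  by move=> [[/= h _] [/= h' _]]; case/eqP: MM'; rewrite -h -h'.
rewrite -(measure_bigsetU_ord P (fun M : 'I_K => J M) (F := fun M : 'I_K => ev M)) //; last first.
  apply/trivIsetP => i j _ _ ij; move/trivIsetP: tev => /(_ i j Logic.I Logic.I); apply.
  by apply: contra_neq ij; apply: val_inj.
apply: le_measure; rewrite ?inE //; first by apply: bigsetU_measurable.
rewrite eventE => w; rewrite -bigcup_seq_cond => -[M _ wM]; by exists (M : nat).
Qed.

End Transfer.

Lemma final_arith (R : realType) (err f e4 : R) : (1 - e4) * (1 - e4 - e4 - e4) <= f -> e4 <= err / 4 ->
  1 - f <= err.
Proof. by move=> h1 h2; have := sqr_ge0 e4; rewrite expr2 => h3; lra. Qed.

Section Limit.
Variables (R : realType) (beta : R) (beta_gt0 : 0 < beta).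

Lemma poisson_rare (c err : R) : 0 < c -> 0 < err -> exists n0, forall n, (n0 <= n)%N ->
  expR (- (beta * n%:R ^+ 2 * c)) <= err.
Proof.
move=> c0 e0; have bc : 0 < beta * c by rewrite mulr_gt0.
have [n1 h1] := nat_above (err^-1 / (beta * c)); exists (maxn 1 n1) => n; rewrite geq_max => /andP[n1' /h1].
rewrite ler_pdivrMr // => h; have n_ge1 : 1 <= n%:R :> R by rewrite ler1n.
rewrite expRN -[err]invrK lef_pV2 ?posrE ?expR_gt0 ?invr_gt0 //.
apply: le_trans (expR_ge1Dx _); apply: le_trans h _; apply: le_trans (_ : beta * n%:R ^+ 2 * c <= _).
  rewrite mulrAC [X in _ <= X]mulrC ler_wpM2r ?(ltW bc) // expr2 ler_peMr //.
by rewrite lerDr.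
Qed.

(** The number of jumps is Poisson of mean [beta * n^2] and stays between [beta1 * n^2] and
    [beta2 * n^2] with probability tending to 1, so a bound uniform over this range is enough. *)
Lemma whp (beta1 beta2 : R) (good : forall n, pred {perm hamming_vertex n}) :
  0 < beta1 -> beta1 < beta -> beta < beta2 ->
  (forall err : R, 0 < err -> exists n0, forall n M : nat, (n0 <= n)%N ->
     beta1 * n%:R ^+ 2 <= M%:R -> M%:R <= beta2 * n%:R ^+ 2 ->
     #|[set e in envs n M | ~~ good n (flow e)]%SET|%:R <= err * #|envs n M|%:R) ->
  forall (d : nat -> measure_display) (T : forall n : nat, measurableType (d n))
    (P : forall n : nat, probability (T n) R)
    (sigma : forall n : nat, R -> T n -> {perm hamming_vertex n}),
    (forall n : nat, (2 <= n)%N -> interchange_process (P n) (sigma n)) ->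
  P n [set w | good n (sigma n (beta * n%:R ^+ 2) w)] @[n --> \oo] --> 1%E.
Proof.
move=> b10 b1 b2 rare d T P sigma ip.
have t0 n : (2 <= n)%N -> 0 < beta * n%:R ^+ 2.
  by move=> n2; rewrite mulr_gt0 // exprn_gt0 // ltr0n (leq_trans _ n2).
have me n : (2 <= n)%N -> measurable [set w | good n (sigma n (beta * n%:R ^+ 2) w)].
  by move=> n2; have [] := transfer n2 (ip n n2) (t0 n n2) (good n).
apply/fine_cvgP; split.
  by exists 2%N => // n /= n2; rewrite fin_num_measure //; exact: me.
apply/cvgrPdist_le => err err0.
pose th1 := beta1 / beta; pose th2 := beta2 / beta.
have th10 : 0 < th1 by rewrite divr_gt0.
have th11 : th1 < 1 by rewrite ltr_pdivrMr // mul1r.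
have th21 : 1 < th2 by rewrite ltr_pdivlMr // mul1r.
have th20 : 0 < th2 by apply: lt_trans th21.
have c1 := poisson_rate_gt0 th10 (negbT (lt_eqF th11)).
have c2 := poisson_rate_gt0 th20 (negbT (gt_eqF th21)).
(* One quarter each for the bad environments, the truncation and the two Poisson tails; the cap at 1
   keeps [1 - e4] nonnegative. *)
pose e4 := Num.min (err / 4) 1; have e40 : 0 < e4 by rewrite lt_min divr_gt0 //=.
have e4e : e4 <= err / 4 by rewrite ge_min lexx.
have e41 : e4 <= 1 by rewrite ge_min lexx orbT.
have [n1 h1] := poisson_rare c1 e40; have [n2 h2] := poisson_rare c2 e40.
have [n3 h3] := rare e4 e40.
exists (maxn 2 (maxn n1 (maxn n2 n3))) => // n /=; rewrite !geq_max => /and4P[nn /h1 p1 /h2 p2 n3n].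
have [mev low] := transfer nn (ip n nn) (t0 n nn) (good n).
have [K hK] := poisson_bulk (t0 n nn) th10 th11 th21 e40.
have thE b : b / beta * (beta * n%:R ^+ 2) = b * n%:R ^+ 2 by rewrite mulrA mulfVK // gt_eqF.
rewrite !thE in hK.
pose J M := (beta1 * n%:R ^+ 2 <= M%:R) && (M%:R <= beta2 * n%:R ^+ 2) : bool.
have hJ M : (M < K)%N -> J M ->
    #|[set e in envs n M | ~~ good n (flow e)]%SET|%:R <= e4 * #|envs n M|%:R :> R.
  by move=> _ /andP[ML MU]; apply: h3.
set ev := [set w | _]; have fin : P n ev \is a fin_num by rewrite fin_num_measure.
have up : fine (P n ev) <= 1 by rewrite -lee_fin fineK // probability_le1.
have lo : (1 - e4) * (1 - e4 - e4 - e4) <= fine (P n ev).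
  rewrite -lee_fin fineK //; apply: le_trans (low e4 K J hJ); rewrite lee_fin ler_wpM2l ?subr_ge0 //.
  by apply: le_trans hK; rewrite lerB // lerB.
rewrite /= ger0_norm ?subr_ge0 //; exact: final_arith lo e4e.
Qed.

End Limit.

Theorem theorem1p1 (R : realType) (beta : R) (beta_gt0 : 0 < beta) :
  (beta < 1 / 2 ->
    exists C : R, 0 < C /\
      forall (d : nat -> measure_display)
        (T : forall n : nat, measurableType (d n))
        (P : forall n : nat, probability (T n) R)
        (sigma : forall n : nat, R -> T n -> {perm hamming_vertex n}),
        (forall n : nat, (2 <= n)%N -> interchange_process (P n) (sigma n)) ->
        P n [set w | #|long_cycles (sigma n (beta * n%:R ^+ 2) w)
                                   (C * ln n%:R)| = 0%N]
          @[n --> \oo] --> 1%E)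
  /\
  (1 / 2 < beta ->
    forall eps : R, 0 < eps ->
    exists C : R, 0 < C /\
      forall (d : nat -> measure_display)
        (T : forall n : nat, measurableType (d n))
        (P : forall n : nat, probability (T n) R)
        (sigma : forall n : nat, R -> T n -> {perm hamming_vertex n}),
        (forall n : nat, (2 <= n)%N -> interchange_process (P n) (sigma n)) ->
        P n [set w | C * n%:R ^+ 2 <=
                     #|long_cycles (sigma n (beta * n%:R ^+ 2) w)
                                   (n%:R `^ (2 - eps))|%:R]
          @[n --> \oo] --> 1%E).
Proof.
split=> [beta_lt|beta_gt eps eps_gt0].
  (* The midpoint between [beta] and the critical value keeps the whole range of jump numbers
     subcritical. *)
  have b2 : (beta + 1 / 2) / 2 < 1 / 2 by lra.
  have b20 : 0 < (beta + 1 / 2) / 2 by lra.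
  have [C [C0 rare]] := subcritical_rare b20 b2; exists C; split=> // d T P sigma ip.
  pose good n (s : {perm hamming_vertex n}) := #|long_cycles s (C * ln n%:R)| == 0%N.
  have -> : (fun n => P n [set w | #|long_cycles (sigma n (beta * n%:R ^+ 2) w) (C * ln n%:R)| = 0%N]) =
      (fun n => P n [set w | good n (sigma n (beta * n%:R ^+ 2) w)]).
    by apply/funext=> n; congr (P n _); apply/seteqP; split=> w /= /eqP.
  apply: (whp beta_gt0 (beta1 := beta / 2) (beta2 := (beta + 1 / 2) / 2)); [lra|lra|lra| |exact: ip].
  move=> err /rare[n0 h]; exists (maxn 1 n0) => n M; rewrite geq_max => /andP[n1 nn0] ML MU.
  have M0 : (0 < M)%N.
    by rewrite -(ltr0n R); apply: lt_le_trans ML; rewrite mulr_gt0 ?divr_gt0 // exprn_gt0 // ltr0n.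
  apply: le_trans (h n M nn0 M0 MU).
  rewrite ler_nat; apply/subset_leq_card/fintype.subsetP=> e /setIdP[eE ng]; apply/setIdP; split=> //.
  move: ng; rewrite /good -lt0n => /card_gt0P[v vl]; apply/existsP; exists v.
  by move: vl; rewrite /long_cycles finset.in_set.
(* Here the lower end of the range must stay supercritical; the upper end [beta + 1] enters only
   through constants. *)
have b1 : 1 / 2 < (beta + 1 / 2) / 2 by lra.
have b2 : 0 < beta + 1 by lra.
have [C [C0 rare]] := supercritical_rare b1 b2 eps_gt0; exists C; split=> // d T P sigma ip.
pose good n (s : {perm hamming_vertex n}) :=
  C * n%:R ^+ 2 <= #|long_cycles s (n%:R `^ (2 - eps))|%:R.
apply: (whp beta_gt0 (good := good) (beta1 := (beta + 1 / 2) / 2) (beta2 := beta + 1)); [lra|lra|lra| |exact: ip].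
move=> err /rare[n0 h]; exists n0 => n M nn0 ML MU; apply: le_trans (h n M nn0 ML MU).
rewrite ler_nat; apply/subset_leq_card/fintype.subsetP=> e /setIdP[eE ng]; apply/setIdP; split=> //.
by move: ng; rewrite /good -ltNge.
Qed.
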